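(* Let $(\hat M,\hat g)$ be a pseudo-Riemannian manifold of dimension $n+m$ and signature $(n,m)$, with Riemann curvature tensor $\hat R$, and let $M\subset\hat M$ be an $n$-dimensional spacelike submanifold whose second fundamental form has vanishing trace (zero mean curvature). Let $g$ denote the restriction of $\hat g$ to $M$. Let $\hat S$ be a positive definite symmetric smooth $(0,2)$-tensor field on $\hat M$, and let $S$ denote its restriction to $M$. Let $\hat\varphi$ be a nonnegative smooth function on $\hat M$, and let $\varphi$ denote its restriction to $M$. Suppose that $p_0\in M$ is a point such that $\varphi(p_0)>0$ and the largest eigenvalue of $\varphi^{2n-2}S$ with respect to $g$, as a function on $M$, attains its maximum at $p_0$. Suppose that $\{e_1,\dots,e_n\}\subset T_{p_0}M$ is an orthonormal basis with respect to $g$ that diagonalizes $S$, and that $S(e_n,e_n)$ is the largest eigenvalue of $S$ with respect to $g$ at $p_0$. Then $$\sum_{l=1}^n\hat R(e_l,e_n,e_l,e_n)\le C\,\varphi^{-2}\,S(e_n,e_n)$$ at the point $p_0$, where $C$ is a constant depending only on $n$, $m$ and $\|\hat g,\hat g^{-1},\hat S,\hat\varphi\|_{C^2(\{p_0\})}$ (in particular not otherwise on $M$).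
   Context: Signature $(n,m)$ means $n$ positive and $m$ negative directions. A submanifold $M$ is spacelike if the restriction $g$ of $\hat g$ to $M$ is positive definite. $\hat D$ is the Levi-Civita connection of $\hat g$, $D$ that of $g$; the second fundamental form is $I\!I(X,Y)=\hat D_XY-D_XY$ for tangential vector fields $X,Y$ on $M$, and its trace is taken with respect to $g$. The curvature sign convention is $\hat R(X,Y,Z,W)=-\hat g(\hat D_X\hat D_YZ-\hat D_Y\hat D_XZ-\hat D_{[X,Y]}Z,W)$. Norm: $\|\hat g,\hat g^{-1},\hat S,\hat\varphi\|_{C^2(\{p_0\})}$ is the infimum, over local coordinate systems of $\hat M$ near $p_0$ in which $\hat S_{\alpha\beta}(p_0)=\delta_{\alpha\beta}$, of the largest absolute value at $p_0$ of the components of $\hat g$, of its inverse $\hat g^{-1}$, of $\hat S$, of the function $\hat\varphi$, and of all their partial derivatives of order at most $2$. *)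

(* Defs.v *)
(* MathComp-Analysis.  Points of R^d and coordinate vectors are row vectors
   ['rV[R]_d], so a linear map acts on the right: ['d f p v = v *m jacobian f p].
   Tensor calculus is written in local coordinates. *)
From HB Require Import structures.
From mathcomp Require Import all_boot all_order all_algebra.
From mathcomp Require Import all_classical all_reals all_analysis.
Set Implicit Arguments.
Unset Strict Implicit.
Unset Printing Implicit Defensive.
Import Order.TTheory GRing.Theory Num.Theory.
Import numFieldNormedType.Exports.
Local Open Scope classical_set_scope.
Local Open Scope ring_scope.

Section EuclideanCalculus.
Context {R : realType}.

Definition basis_vec {d : nat} (i : 'I_d) : 'rV[R]_d := delta_mx 0 i.

Definition pderive {d : nat} {V : normedModType R} (i : 'I_d)
    (f : 'rV[R]_d -> V) : 'rV[R]_d -> V :=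
  fun y => 'D_(basis_vec i) f y.

(* [C^oo] on an open set [U]: every iterated partial derivative is (Frechet)
   differentiable, hence continuous, at every point of [U]. *)
Definition smooth_on {d : nat} {V : normedModType R} (U : set 'rV[R]_d)
    (f : 'rV[R]_d -> V) : Prop :=
  forall s : seq 'I_d, forall y, U y ->
    differentiable (foldr pderive f s) y.

(* Christoffel symbol [Gamma^k_ij] of the metric [G = (g_ij)]. *)
Definition christoffel {d : nat} (G : 'rV[R]_d -> 'M[R]_d) (y : 'rV[R]_d)
    (k i j : 'I_d) : R :=
  2^-1 * \sum_(l < d) invmx (G y) k l *
    (pderive i (fun z => G z j l) y + pderive j (fun z => G z i l) y
     - pderive l (fun z => G z i j) y).

Definition christoffel_app {d : nat} (G : 'rV[R]_d -> 'M[R]_d) (y : 'rV[R]_d)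
    (u v : 'rV[R]_d) : 'rV[R]_d :=
  \row_k \sum_(i < d) \sum_(j < d) u 0 i * v 0 j * christoffel G y k i j.

(* Levi-Civita connection [D_X Y] of [G]. *)
Definition levi_civita {d : nat} (G : 'rV[R]_d -> 'M[R]_d)
    (X Y : 'rV[R]_d -> 'rV[R]_d) : 'rV[R]_d -> 'rV[R]_d :=
  fun y => 'D_(X y) Y y + christoffel_app G y (X y) (Y y).

Definition lie_bracket {d : nat} (X Y : 'rV[R]_d -> 'rV[R]_d) :
    'rV[R]_d -> 'rV[R]_d :=
  fun y => 'D_(X y) Y y - 'D_(Y y) X y.

Definition riemann_fields {d : nat} (G : 'rV[R]_d -> 'M[R]_d)
    (X Y Z W : 'rV[R]_d -> 'rV[R]_d) (y : 'rV[R]_d) : R :=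
  let D := levi_civita G in
  let A := D X (D Y Z) y - D Y (D X Z) y - D (lie_bracket X Y) Z y in
  - (A *m G y *m (W y)^T) 0 0.

(* The value of the curvature tensor on vectors at a point, extended to fields
   with constant components. *)
Definition riemann_coord {d : nat} (G : 'rV[R]_d -> 'M[R]_d) (y : 'rV[R]_d)
    (u v w z : 'rV[R]_d) : R :=
  riemann_fields G (cst u) (cst v) (cst w) (cst z) y.

Definition induced_metric {n d : nat} (G : 'rV[R]_d -> 'M[R]_d)
    (F : 'rV[R]_n -> 'rV[R]_d) : 'rV[R]_n -> 'M[R]_n :=
  fun y => jacobian F y *m G (F y) *m (jacobian F y)^T.

(* [\hat D_X V] for a field [V] of ambient vectors along [F]. *)
Definition levi_civita_along {n d : nat} (G : 'rV[R]_d -> 'M[R]_d)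
    (F : 'rV[R]_n -> 'rV[R]_d) (X : 'rV[R]_n -> 'rV[R]_n)
    (V : 'rV[R]_n -> 'rV[R]_d) : 'rV[R]_n -> 'rV[R]_d :=
  fun y => 'D_(X y) V y + christoffel_app G (F y) ('D_(X y) F y) (V y).

(* [II(X, Y) = \hat D_X Y - D_X Y], where the tangential field [Y] is
   identified with its image [dF(Y)]. *)
Definition second_fundamental_form {n d : nat} (G : 'rV[R]_d -> 'M[R]_d)
    (F : 'rV[R]_n -> 'rV[R]_d) (X Y : 'rV[R]_n -> 'rV[R]_n) :
    'rV[R]_n -> 'rV[R]_d :=
  fun y => levi_civita_along G F X (fun z => 'D_(Y z) F z) y
           - 'D_(levi_civita (induced_metric G F) X Y y) F y.

Definition trace_second_fundamental_form {n d : nat}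
    (G : 'rV[R]_d -> 'M[R]_d) (F : 'rV[R]_n -> 'rV[R]_d) (y : 'rV[R]_n) :
    'rV[R]_d :=
  \sum_(i < n) \sum_(j < n) invmx (induced_metric G F y) i j *:
    second_fundamental_form G F (cst (basis_vec i)) (cst (basis_vec j)) y.

(* Largest absolute value at [y] of [f] and its partial derivatives of
   order at most 2. *)
Definition C2size {d : nat} (f : 'rV[R]_d -> R) (y : 'rV[R]_d) : R :=
  Num.max `|f y|
    (Num.max (\big[Num.max/0]_(i < d) `|pderive i f y|)
       (\big[Num.max/0]_(i < d) \big[Num.max/0]_(j < d)
           `|pderive i (pderive j f) y|)).

Definition C2size_mx {d : nat} (A : 'rV[R]_d -> 'M[R]_d) (y : 'rV[R]_d) : R :=
  \big[Num.max/0]_(i < d) \big[Num.max/0]_(j < d) C2size (fun z => A z i j) y.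

End EuclideanCalculus.

(* A homeomorphism [cmap] from the open set [cdom] onto an open subset of R^d;
   [cinv] is the inverse, with arbitrary values off [cmap @` cdom]. *)
Record chart (R : realType) (T : topologicalType) (d : nat) := Chart {
  cdom : set T;
  cmap : T -> 'rV[R]_d;
  cinv : 'rV[R]_d -> T;
  open_cdom : open cdom;
  open_cmap : open (cmap @` cdom);
  cmapK : forall p, cdom p -> cinv (cmap p) = p;
  continuous_cmap : forall p, cdom p -> {for p, continuous cmap};
  continuous_cinv : forall y, (cmap @` cdom) y -> {for y, continuous cinv}
}.

Definition transition_smooth (R : realType) (T : topologicalType) (d : nat)
    (c c' : chart R T d) : Prop :=
  smooth_on (cmap c @` (cdom c `&` cdom c')) (cmap c' \o cinv c).

(* Smooth d-manifold without boundary; [atlas_maximal] says both that charts of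
   the atlas are compatible and that the atlas is maximal. *)
Record manifold (R : realType) (d : nat) := Manifold {
  carrier :> topologicalType;
  atlas : set (chart R carrier d);
  carrier_hausdorff : hausdorff_space carrier;
  carrier_second_countable : @second_countable carrier;
  atlas_cover : forall p : carrier, exists c, atlas c /\ cdom c p;
  atlas_maximal : forall c, atlas c <->
    (forall c', atlas c' -> transition_smooth c c' /\ transition_smooth c' c)
}.

Section Manifolds.
Context {R : realType}.

Definition chart_near {d : nat} (M : manifold R d) (p : M)
    (c : chart R M d) : Prop :=
  atlas c /\ cdom c p.

(* Some coordinate system around [p]; the notions below that use it do not
   depend on the choice. *)
Definition chart_at {d : nat} (M : manifold R d) (p : M) : chart R M d :=
  sval (cid (atlas_cover p)).

Definition smooth_fun {d : nat} (M : manifold R d) (f : M -> R) : Prop :=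
  forall c : chart R M d, atlas c -> smooth_on (cmap c @` cdom c) (f \o cinv c).

(* A tangent vector at [p] is the family of its components in the charts
   around [p]; values at other charts are irrelevant. *)
Definition tvec {d : nat} (M : manifold R d) := chart R M d -> 'rV[R]_d.

Definition is_tangent {d : nat} (M : manifold R d) (p : M) (v : tvec M) :
    Prop :=
  forall c c', chart_near p c -> chart_near p c' ->
    v c' = v c *m jacobian (cmap c' \o cinv c) (cmap c p).

Definition tvec_nonzero {d : nat} (M : manifold R d) (p : M) (v : tvec M) :
    Prop :=
  exists c, chart_near p c /\ v c != 0.

Record sym_tensor {d : nat} (M : manifold R d) := SymTensor {
  tcomp : chart R M d -> M -> 'M[R]_d;
  tcomp_smooth : forall c, atlas c ->
    smooth_on (cmap c @` cdom c) (fun y => tcomp c (cinv c y));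
  tcomp_sym : forall c p, chart_near p c -> (tcomp c p)^T = tcomp c p;
  tcomp_law : forall c c' p, chart_near p c -> chart_near p c' ->
    let J := jacobian (cmap c' \o cinv c) (cmap c p) in
    tcomp c p = J *m tcomp c' p *m J^T
}.

Definition tcoord {d : nat} (M : manifold R d) (T : sym_tensor M)
    (c : chart R M d) : 'rV[R]_d -> 'M[R]_d :=
  fun y => tcomp T c (cinv c y).

(* The values [B p v w] of a field of bilinear forms. *)
Definition form_field {d : nat} (M : manifold R d) :=
  M -> tvec M -> tvec M -> R.

Definition tensor_val {d : nat} (M : manifold R d) (T : sym_tensor M) :
    form_field M :=
  fun p v w => let c := chart_at p in (v c *m tcomp T c p *m (w c)^T) 0 0.

Definition pos_def {d : nat} (M : manifold R d) (B : form_field M) : Prop :=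
  forall p v, is_tangent p v -> tvec_nonzero p v -> 0 < B p v v.

Definition has_signature {n m : nat} (M : manifold R (n + m))
    (g : sym_tensor M) : Prop :=
  forall p c, chart_near p c ->
    exists P : 'M[R]_(n + m), P \in unitmx /\
      P *m tcomp g c p *m P^T = block_mx 1%:M 0 0 (- 1%:M).

Definition riemann {d : nat} (M : manifold R d) (g : sym_tensor M) (p : M)
    (u v w z : tvec M) : R :=
  let c := chart_at p in
  riemann_coord (tcoord g c) (cmap c p) (u c) (v c) (w c) (z c).

Definition is_eigenvalue {d : nat} (M : manifold R d) (g B : form_field M)
    (p : M) (lambda : R) : Prop :=
  exists v, [/\ is_tangent p v, tvec_nonzero p v &
    forall w, is_tangent p w -> B p v w = lambda * g p v w].

(* Eigenvalues of a symmetric [B] with respect to an inner product [g] form a finite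
   set, nonempty if [0 < d], so the supremum is a maximum. *)
Definition largest_eigenvalue {d : nat} (M : manifold R d) (g B : form_field M)
    (p : M) : R :=
  sup [set lambda | is_eigenvalue g B p lambda].

(* The norm of [g, g^-1, S, phi] in [C^2({p})]. *)
Definition C2norm {d : nat} (M : manifold R d) (g S : sym_tensor M)
    (phi : M -> R) (p : M) : R :=
  inf [set N | exists c, [/\ chart_near p c, tcomp S c p = 1%:M &
    N = Num.max
          (Num.max (C2size_mx (tcoord g c) (cmap c p))
                   (C2size_mx (fun y => invmx (tcoord g c y)) (cmap c p)))
          (Num.max (C2size_mx (tcoord S c) (cmap c p))
                   (C2size (phi \o cinv c) (cmap c p)))]].

Section Submanifold.
Context {n d : nat} (M : manifold R n) (Mhat : manifold R d).
Implicit Type iota : M -> Mhat.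

Definition map_coord iota (x : chart R M n) (y : chart R Mhat d) :
    'rV[R]_n -> 'rV[R]_d :=
  cmap y \o iota \o cinv x.

(* [iota] is an injective immersion.  This covers embedded submanifolds, for
   which [iota] is the inclusion of a subset. *)
Definition is_submanifold iota : Prop :=
  [/\ injective iota,
      continuous iota,
      (forall x y, atlas x -> atlas y ->
         smooth_on (cmap x @` (cdom x `&` iota @^-1` cdom y))
                   (map_coord iota x y)) &
      (forall p x y, chart_near p x -> chart_near (iota p) y ->
         row_free (jacobian (map_coord iota x y) (cmap x p)))].

Definition tvec_push iota (p : M) (v : tvec M) : tvec Mhat :=
  fun y => let x := chart_at p in
    v x *m jacobian (map_coord iota x y) (cmap x p).

Definition restrict_form iota (T : sym_tensor Mhat) : form_field M :=
  fun p v w =>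
    tensor_val T (iota p) (tvec_push iota p v) (tvec_push iota p w).

Definition zero_mean_curvature iota (ghat : sym_tensor Mhat) : Prop :=
  forall p x y, chart_near p x -> chart_near (iota p) y ->
    trace_second_fundamental_form (tcoord ghat y) (map_coord iota x y)
      (cmap x p) = 0.

End Submanifold.
End Manifolds.

(* Main.v *)
Require Import Defs.
From HB Require Import structures.
From mathcomp Require Import all_boot all_order all_algebra.
From mathcomp Require Import all_classical all_reals all_analysis.
From mathcomp Require Import perm ring lra.
Set Implicit Arguments.
Unset Strict Implicit.
Unset Printing Implicit Defensive.
Import Order.TTheory GRing.Theory Num.Theory.
Import numFieldNormedType.Exports.
Local Open Scope classical_set_scope.
Local Open Scope ring_scope.

(** Let [lambda] be the maximum over [M] of the largest eigenvalue of
    [phi^(2n-2) S].  For every tangent field [W] the function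
    [phi^(2n-2) S(W, W) - lambda g(W, W)] is nonpositive, and it vanishes at [p0]
    if [W = e_n] there.  Choose [W] so that its ambient covariant derivatives
    [nu_l] along [e_l] are normal at [p0], and apply the second derivative test
    along each [e_l].  In the sum over [l], differentiating the equation of zero
    mean curvature along [e_n] (the Codazzi equation) replaces [sum_l D_l D_l W]
    by [sum_l R(e_l, e_n) e_l] up to a tangent vector [c] and a first order term.
    The contribution of [c] to [S(W, W)] cancels the one to [g(W, W)] because
    [e_n] is an eigenvector of [S].  The term [2 S(nu_l, nu_l)] absorbs all terms
    linear in [nu_l], and [- g(nu_l, nu_l)] is nonnegative because the normal space
    is negative definite.  What remains is
    [2 S(e_n, e_n) sum_l R(e_l, e_n, e_l, e_n)], bounded by a multiple of
    [phi^-2 S(e_n, e_n)^2], the powers of [S(e_n, e_n)] coming from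
    [|e_l|^2 <= S(e_n, e_n)] in an ambient chart where [S] is the identity at
    [p0]. *)

(** * Smooth functions on open subsets of Euclidean space *)

(** The largest eigenvalue need not be differentiable, which is why a fixed smooth field [W] is
    tested instead. The second derivatives of the immersion are what no bound is available for. In
    coordinates on [M] only $\sum_l\partial_l\partial_lF-dF(a)$ is controlled, where [a] is the
    trace of the Christoffel symbols of the induced metric: zero mean curvature makes it equal to
    $-\sum_l\hat\Gamma(e_l,e_l)$. Every sum of second derivatives is therefore taken together with
    $-\sum_la_l\partial_l$. This is legitimate because at the maximum the first derivatives of
    [S(W, W)] are proportional to those of [phi]. The same proportionality produces the power of
    [phi]: it turns the cross term of the second derivative into $|d\varphi|^2/\varphi^2$. Errors
    without such a factor are brought to this form by $\varphi\le N$, where [N] bounds the norm.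
    With each $e_l$ counted as $\sqrt s$, where $s=S(e_n,e_n)$, all errors have order $s^2$, and
    dividing by the factor $2s$ of the curvature leaves $\varphi^{-2}s$. *)

Section SmoothFunctions.
Context {R : realType}.

(** The first order expansion of [f] at [x] is also one of [g], and by uniqueness its linear part is
    the differential of [g]. *)
Lemma near_eq_differentiable (V W : normedModType R) (f g : V -> W) x :
  {near x, f =1 g} -> differentiable f x -> differentiable g x.
Proof.
move=> fg df; have [dfc dfx] := (diff_locallyP _ _).1 df.
have fg0 : \forall h \near (0 : V), f (h + x) = g (h + x).
  by move: fg; rewrite [X in X -> _](near_shift 0) /= subr0.
have E : g \o shift x = cst (g x) + 'd f x +o_ 0 id.
  apply/eqaddoP => e e0; move/eqaddoP : dfx => /(_ e e0) dfx.
  near=> h; have -> : (g \o shift x - (cst (g x) + 'd f x)) h =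
            (f \o shift x - (cst (f x) + 'd f x)) h.
    by rewrite !fctE /= (nbhs_singleton fg); congr (_ - _); symmetry; near: h.
  by near: h.
have dg := diff_unique dfc E.
by apply: (diff_locallyP x g).2; rewrite dg.
Unshelve. all: by end_near. Qed.

Lemma differentiable_mxP (V : normedModType R) m n (M : V -> 'M[R]_(m, n)) x :
  differentiable M x <-> forall i j, differentiable (fun y => M y i j) x.
Proof.
split=> [dM i j|dM].
  apply: (@differentiable_comp _ _ _ _ M (fun N : 'M[R]_(m, n) => N i j) x dM).
  exact: differentiable_coord.
have -> : M = \sum_i \sum_j (fun y => M y i j *: (delta_mx i j : 'M[R]_(m, n))).
  apply/funext => y; rewrite [LHS]matrix_sum_delta fct_sumE.
  by apply: eq_bigr => i _; rewrite fct_sumE.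
apply: differentiable_sum => i; apply: differentiable_sum => j.
exact: differentiableZl.
Qed.

Lemma derive_coord (V : normedModType R) m n (M : V -> 'M[R]_(m, n)) x v i j :
  differentiable M x -> ('D_v M x) i j = 'D_v (fun y => M y i j) x.
Proof. by move=> dM; rewrite derive_mx ?mxE//; exact: diff_derivable. Qed.

Context {d : nat}.
Implicit Types (U : set 'rV[R]_d) (V : normedModType R).

Lemma derive_pderive V (f : 'rV[R]_d -> V) y v : differentiable f y ->
  'D_v f y = \sum_i v 0 i *: pderive i f y.
Proof.
move=> df; rewrite deriveE// {1}[v]row_sum_delta linear_sum.
by apply: eq_bigr => i _; rewrite linearZ /pderive deriveE.
Qed.

Lemma derive_near V (f g : 'rV[R]_d -> V) U v : open U ->
  (forall y, U y -> f y = g y) -> forall y, U y -> 'D_v f y = 'D_v g y.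
Proof.
move=> oU fg y Uy; apply: near_eq_derive.
by apply: filterS (open_nbhs_nbhs (conj oU Uy)) => z /fg.
Qed.

Lemma pderive_near V (f g : 'rV[R]_d -> V) U i : open U ->
  (forall y, U y -> f y = g y) -> forall y, U y -> pderive i f y = pderive i g y.
Proof. exact: derive_near. Qed.

Lemma open_differentiable V (f g : 'rV[R]_d -> V) U y : open U -> U y ->
  (forall y, U y -> f y = g y) -> differentiable f y -> differentiable g y.
Proof.
move=> oU Uy fg; apply: near_eq_differentiable.
by apply: filterS (open_nbhs_nbhs (conj oU Uy)) => z /fg.
Qed.

(* [C^(k+1)]-like truncation of [smooth_on], which supports induction on [k]. *)
Definition smooth_upto V k U (f : 'rV[R]_d -> V) : Prop :=
  forall s y, (size s <= k)%N -> U y -> differentiable (foldr pderive f s) y.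

Lemma smooth_uptoP V U (f : 'rV[R]_d -> V) :
  smooth_on U f <-> forall k, smooth_upto k U f.
Proof.
split=> [sf k s y _|sf s y Uy]; first exact: sf.
exact: (sf (size s)).
Qed.

Lemma smooth_upto0 V U (f : 'rV[R]_d -> V) :
  smooth_upto 0 U f <-> forall y, U y -> differentiable f y.
Proof. by split=> [sf y Uy|df [|//] y _]; [exact: (sf [::])|exact: df]. Qed.

(** The derivative split off is the one taken first, the last entry of the list. Inductions on [k]
    can thus apply the product and chain rules to [f] itself and the induction hypothesis to its
    partial derivatives. *)
Lemma smooth_uptoS V k U (f : 'rV[R]_d -> V) :
  smooth_upto k.+1 U f <-> (forall y, U y -> differentiable f y) /\
    forall i, smooth_upto k U (pderive i f).
Proof.
split=> [sf|[df sf]].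
  split=> [y Uy|i s y ss Uy]; first exact: (sf [::]).
  by have := sf (rcons s i) y; rewrite size_rcons foldr_rcons; apply.
move=> s y; case/lastP: s => [|s i]; first by move=> _ /df.
by rewrite size_rcons foldr_rcons => ss; exact: sf.
Qed.

Lemma smooth_uptoW V k U (f : 'rV[R]_d -> V) :
  smooth_upto k.+1 U f -> smooth_upto k U f.
Proof. by move=> sf s y ss; apply: sf; exact: leqW. Qed.

Lemma smooth_upto_diff V k U (f : 'rV[R]_d -> V) y :
  smooth_upto k U f -> U y -> differentiable f y.
Proof. by move=> sf; exact: (sf [::]). Qed.

Lemma smooth_upto_eq V k U (f g : 'rV[R]_d -> V) : open U ->
  (forall y, U y -> f y = g y) -> smooth_upto k U f -> smooth_upto k U g.
Proof.
move=> oU; elim: k f g => [|k IH] f g fg.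
  rewrite !smooth_upto0 => df y Uy.
  exact: (open_differentiable oU Uy fg (df _ Uy)).
rewrite !smooth_uptoS => -[df sf]; split=> [y Uy|i].
  exact: (open_differentiable oU Uy fg (df _ Uy)).
apply: IH (sf i) => y Uy; exact: (pderive_near i oU fg).
Qed.

Lemma smooth_upto_cst V k U (a : V) : open U -> smooth_upto k U (fun=> a).
Proof.
move=> oU; elim: k a => [|k IH] a.
  by rewrite smooth_upto0 => y _; exact: differentiable_cst.
rewrite smooth_uptoS; split=> [y _|i]; first exact: differentiable_cst.
by apply: (smooth_upto_eq oU _ (IH 0)) => y _; rewrite /pderive derive_cst.
Qed.

Lemma smooth_uptoD V k U (f g : 'rV[R]_d -> V) : open U ->
  smooth_upto k U f -> smooth_upto k U g -> smooth_upto k U (fun y => f y + g y).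
Proof.
move=> oU; elim: k f g => [|k IH] f g.
  rewrite !smooth_upto0 => df dg y Uy; exact: differentiableD (df y Uy) (dg y Uy).
rewrite !smooth_uptoS => -[df sf] [dg sg]; split=> [y Uy|i].
  exact: differentiableD (df y Uy) (dg y Uy).
apply: (smooth_upto_eq oU _ (IH _ _ (sf i) (sg i))) => y Uy.
by rewrite /pderive deriveD//; apply: diff_derivable; [exact: df|exact: dg].
Qed.

Lemma smooth_uptoZ V k U (a : R) (f : 'rV[R]_d -> V) : open U ->
  smooth_upto k U f -> smooth_upto k U (fun y => a *: f y).
Proof.
move=> oU; elim: k f => [|k IH] f.
  rewrite !smooth_upto0 => df y Uy; exact: differentiableZ (df y Uy).
rewrite !smooth_uptoS => -[df sf]; split=> [y Uy|i].
  exact: differentiableZ (df y Uy).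
apply: (smooth_upto_eq oU _ (IH _ (sf i))) => y Uy.
by rewrite /pderive deriveZ//; apply: diff_derivable; exact: df.
Qed.

Lemma smooth_upto_sum V k U (I : finType) (f : I -> 'rV[R]_d -> V) : open U ->
  (forall i, smooth_upto k U (f i)) -> smooth_upto k U (fun y => \sum_i f i y).
Proof.
move=> oU sf; elim: (index_enum I) => [|i s IH].
  apply: (smooth_upto_eq oU _ (smooth_upto_cst (0 : V) oU)) => y _.
  by rewrite big_nil.
apply: (smooth_upto_eq oU _ (smooth_uptoD oU (sf i) IH)) => y _.
by rewrite big_cons.
Qed.

Lemma smooth_uptoM k U (f g : 'rV[R]_d -> R) : open U ->
  smooth_upto k U f -> smooth_upto k U g -> smooth_upto k U (fun y => f y * g y).
Proof.
move=> oU; elim: k f g => [|k IH] f g.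
  rewrite !smooth_upto0 => df dg y Uy; exact: differentiableM (df y Uy) (dg y Uy).
move=> sf sg; have [df sf'] := (smooth_uptoS _ _ _).1 sf.
have [dg sg'] := (smooth_uptoS _ _ _).1 sg.
rewrite !smooth_uptoS; split=> [y Uy|i].
  exact: differentiableM (df y Uy) (dg y Uy).
apply: (smooth_upto_eq oU _ (smooth_uptoD oU (IH _ _ (smooth_uptoW sf) (sg' i))
  (IH _ _ (smooth_uptoW sg) (sf' i)))) => y Uy.
by rewrite /pderive deriveM//; apply: diff_derivable; [exact: df|exact: dg].
Qed.

Lemma smooth_upto_prod k U (I : finType) (f : I -> 'rV[R]_d -> R) : open U ->
  (forall i, smooth_upto k U (f i)) -> smooth_upto k U (fun y => \prod_i f i y).
Proof.
move=> oU sf; elim: (index_enum I) => [|i s IH].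
  apply: (smooth_upto_eq oU _ (smooth_upto_cst (1 : R) oU)) => y _.
  by rewrite big_nil.
apply: (smooth_upto_eq oU _ (smooth_uptoM oU (sf i) IH)) => y _.
by rewrite big_cons.
Qed.

(** The derivative of the inverse contains the inverse again, but needs it only to one order
    less. *)
Lemma smooth_uptoV k U (f : 'rV[R]_d -> R) : open U ->
  (forall y, U y -> f y != 0) ->
  smooth_upto k U f -> smooth_upto k U (fun y => (f y)^-1).
Proof.
move=> oU f0; elim: k => [|k IH].
  rewrite !smooth_upto0 => df y Uy; exact: differentiableV (df y Uy) (f0 _ Uy).
move=> sf; have [df sf'] := (smooth_uptoS _ _ _).1 sf.
rewrite !smooth_uptoS; split=> [y Uy|i].
  exact: differentiableV (df y Uy) (f0 _ Uy).
have sV := IH (smooth_uptoW sf).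
apply: (smooth_upto_eq oU _
  (smooth_uptoZ (-1) oU (smooth_uptoM oU (smooth_uptoM oU sV sV) (sf' i)))).
move=> y Uy; rewrite /pderive deriveV ?f0//; last exact: diff_derivable (df _ Uy).
by rewrite expr2 invfM /GRing.scale /= mulN1r mulNr.
Qed.

Lemma smooth_upto_coord k U m n (M : 'rV[R]_d -> 'M[R]_(m, n)) : open U ->
  smooth_upto k U M <-> forall i j, smooth_upto k U (fun y => M y i j).
Proof.
move=> oU; elim: k M => [|k IH] M.
  rewrite smooth_upto0; split=> [dM i j|dM y Uy].
    by rewrite smooth_upto0 => y Uy; move: i j; apply/differentiable_mxP; exact: dM.
  by apply/differentiable_mxP => i j; have := dM i j; rewrite smooth_upto0; exact.
have E (dM : forall y, U y -> differentiable M y) l i j y : U y ->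
    pderive l M y i j = pderive l (fun y => M y i j) y.
  by move=> Uy; rewrite /pderive derive_coord//; exact: dM.
rewrite smooth_uptoS; split=> [[dM sM] i j|sM].
  rewrite smooth_uptoS; split=> [y Uy|l].
    by move: i j; apply/differentiable_mxP; exact: dM.
  by apply: (smooth_upto_eq oU (E dM l i j)); exact: ((IH _).1 (sM l)).
have dM y : U y -> differentiable M y.
  by move=> Uy; apply/differentiable_mxP => i j; exact: smooth_upto_diff (sM i j) Uy.
split=> // l; apply/IH => i j.
have /smooth_uptoS[_ /(_ l)] := sM i j.
by apply: smooth_upto_eq => // y Uy; rewrite E.
Qed.

End SmoothFunctions.

Section Composition.
Context {R : realType}.

Lemma derive_comp (d e : nat) (W : normedModType R) (h : 'rV[R]_e -> W)
    (F : 'rV[R]_d -> 'rV[R]_e) y v :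
  differentiable F y -> differentiable h (F y) ->
  'D_v (fun z => h (F z)) y = 'D_('D_v F y) h (F y).
Proof.
move=> dF dh; rewrite !deriveE//; last exact: differentiable_comp.
by rewrite diff_comp.
Qed.

(** The derivative is $\sum_c\partial_iF_c\,(\partial_ch)\circ F$, so the induction runs over all
    [h] with [F] fixed. *)
Lemma smooth_upto_comp (d e k : nat) U V (h : 'rV[R]_e -> R)
    (F : 'rV[R]_d -> 'rV[R]_e) : open U -> (forall y, U y -> V (F y)) ->
  smooth_upto k U F -> smooth_upto k V h -> smooth_upto k U (fun y => h (F y)).
Proof.
move=> oU FUV; elim: k h => [|k IH] h.
  rewrite !smooth_upto0 => dF dh y Uy.
  by apply: (@differentiable_comp _ _ _ _ F h y (dF _ Uy)); exact/dh/FUV.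
move=> sF sh; have [dF sF'] := (smooth_uptoS _ _ _).1 sF.
have [dh sh'] := (smooth_uptoS _ _ _).1 sh.
apply/smooth_uptoS; split=> [y Uy|i].
  by apply: (@differentiable_comp _ _ _ _ F h y (dF _ Uy)); exact/dh/FUV.
have sE c := smooth_uptoM oU ((smooth_upto_coord _ _ oU).1 (sF' i) 0 c)
  (IH _ (smooth_uptoW sF) (sh' c)).
apply: (smooth_upto_eq oU _ (smooth_upto_sum oU sE)) => y Uy.
rewrite [RHS](derive_comp (h := h) _ (dF _ Uy)); last exact/dh/FUV.
by rewrite derive_pderive; last exact/dh/FUV.
Qed.

Section Domain.
Context {d : nat} (U : set 'rV[R]_d) (oU : open U).

Lemma smooth_on_diff (V : normedModType R) (f : 'rV[R]_d -> V) y :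
  smooth_on U f -> U y -> differentiable f y.
Proof. by move=> sf; exact: (sf [::]). Qed.

Lemma smooth_on_eq (V : normedModType R) (f g : 'rV[R]_d -> V) :
  (forall y, U y -> f y = g y) -> smooth_on U f -> smooth_on U g.
Proof.
by rewrite !smooth_uptoP => fg sf k; exact: (smooth_upto_eq oU fg (sf k)).
Qed.

Lemma smooth_on_pderive (V : normedModType R) (f : 'rV[R]_d -> V) i :
  smooth_on U f -> smooth_on U (pderive i f).
Proof. by move=> sf s; rewrite -foldr_rcons; exact: sf. Qed.

Lemma smooth_on_cst (V : normedModType R) (a : V) : smooth_on U (fun=> a).
Proof. by apply/smooth_uptoP => k; exact: smooth_upto_cst. Qed.

Lemma smooth_onD (V : normedModType R) (f g : 'rV[R]_d -> V) :
  smooth_on U f -> smooth_on U g -> smooth_on U (fun y => f y + g y).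
Proof. by rewrite !smooth_uptoP => sf sg k; exact: smooth_uptoD. Qed.

Lemma smooth_onZ (V : normedModType R) a (f : 'rV[R]_d -> V) :
  smooth_on U f -> smooth_on U (fun y => a *: f y).
Proof. by rewrite !smooth_uptoP => sf k; exact: smooth_uptoZ. Qed.

Lemma smooth_onB (V : normedModType R) (f g : 'rV[R]_d -> V) :
  smooth_on U f -> smooth_on U g -> smooth_on U (fun y => f y - g y).
Proof.
move=> sf sg; apply: smooth_on_eq (smooth_onD sf (smooth_onZ (-1) sg)) => y _.
by rewrite scaleN1r.
Qed.

Lemma smooth_on_sum (V : normedModType R) (I : finType)
    (f : I -> 'rV[R]_d -> V) :
  (forall i, smooth_on U (f i)) -> smooth_on U (fun y => \sum_i f i y).
Proof.
move=> sf; apply/smooth_uptoP => k; apply: smooth_upto_sum => // i.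
by move/smooth_uptoP: (sf i).
Qed.

Lemma smooth_onM (f g : 'rV[R]_d -> R) :
  smooth_on U f -> smooth_on U g -> smooth_on U (fun y => f y * g y).
Proof. by rewrite !smooth_uptoP => sf sg k; exact: smooth_uptoM. Qed.

Lemma smooth_on_prod (I : finType) (f : I -> 'rV[R]_d -> R) :
  (forall i, smooth_on U (f i)) -> smooth_on U (fun y => \prod_i f i y).
Proof.
move=> sf; apply/smooth_uptoP => k; apply: smooth_upto_prod => // i.
by move/smooth_uptoP: (sf i).
Qed.

Lemma smooth_onX (f : 'rV[R]_d -> R) n :
  smooth_on U f -> smooth_on U (fun y => f y ^+ n).
Proof.
move=> sf; apply: smooth_on_eq (@smooth_on_prod 'I_n (fun=> f) _) => // y _.
by rewrite prodr_const card_ord.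
Qed.

Lemma smooth_onV (f : 'rV[R]_d -> R) : (forall y, U y -> f y != 0) ->
  smooth_on U f -> smooth_on U (fun y => (f y)^-1).
Proof. by rewrite !smooth_uptoP => f0 sf k; exact: smooth_uptoV. Qed.

Lemma smooth_on_coord m n (M : 'rV[R]_d -> 'M[R]_(m, n)) :
  smooth_on U M <-> forall i j, smooth_on U (fun y => M y i j).
Proof.
rewrite smooth_uptoP; split=> [sM i j|sM k].
  by apply/smooth_uptoP => k; move/smooth_upto_coord: (sM k); exact.
by apply/smooth_upto_coord => // i j; move/smooth_uptoP: (sM i j).
Qed.

Lemma smooth_on_derive (V : normedModType R) (f : 'rV[R]_d -> V) v :
  smooth_on U f -> smooth_on U ('D_v f).
Proof.
move=> sf; have sE i := smooth_onZ (v 0 i) (smooth_on_pderive i sf).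
apply: smooth_on_eq (smooth_on_sum sE) => y Uy.
by rewrite derive_pderive//; exact: smooth_on_diff.
Qed.

Lemma smooth_on_comp e W (h : 'rV[R]_e -> R) (F : 'rV[R]_d -> 'rV[R]_e) :
  (forall y, U y -> W (F y)) -> smooth_on U F -> smooth_on W h ->
  smooth_on U (fun y => h (F y)).
Proof.
by rewrite !smooth_uptoP => FUW sF sh k; exact: smooth_upto_comp FUW (sF k) (sh k).
Qed.

Lemma smooth_on_det n (M : 'rV[R]_d -> 'M[R]_n) :
  smooth_on U M -> smooth_on U (fun y => \det (M y)).
Proof.
move=> /smooth_on_coord sM; rewrite /determinant; apply: smooth_on_sum => s.
apply: smooth_onM; first exact: smooth_on_cst.
apply: (@smooth_on_prod _ (fun i y => M y i (s i))) => i; exact: sM.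
Qed.

(** Cramer's rule: the entries are cofactors divided by the determinant. *)
Lemma smooth_on_invmx n (M : 'rV[R]_d -> 'M[R]_n) :
  (forall y, U y -> M y \in unitmx) ->
  smooth_on U M -> smooth_on U (fun y => invmx (M y)).
Proof.
move=> uM sM; apply/smooth_on_coord => i j.
have sV : smooth_on U (fun y => (\det (M y))^-1).
  apply: smooth_onV; last exact: smooth_on_det.
  by move=> y /uM; rewrite unitmxE unitfE.
have sA : smooth_on U (fun y => (-1) ^+ (j + i) * \det (row' j (col' i (M y)))).
  apply: smooth_onM; first exact: smooth_on_cst.
  apply: smooth_on_det; apply/smooth_on_coord => k l.
  apply: smooth_on_eq ((smooth_on_coord _).1 sM (lift j k) (lift i l)) => y _.
  by rewrite !mxE.
apply: smooth_on_eq (smooth_onM sV sA) => y Uy.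
by rewrite /invmx uM// !mxE /cofactor.
Qed.

End Domain.

End Composition.

(** * The second derivative test along a line *)

Section SecondOrder.
Context {R : realType} {d : nat}.
Implicit Types (f : 'rV[R]_d -> R).

Lemma is_derive_line (V : normedModType R) (f : 'rV[R]_d -> V) y v t :
  differentiable f (y + t *: v) ->
  is_derive t (1 : R) (fun s : R => f (y + s *: v)) ('D_v f (y + t *: v)).
Proof.
move=> df; have E : (fun h : R => h^-1 *: (((fun s => f (y + s *: v)) \o shift t)
    (h *: (1 : R)) - f (y + t *: v))) =
    (fun h : R => h^-1 *: ((f \o shift (y + t *: v)) (h *: v) - f (y + t *: v))).
  apply/funext => h /=; congr (_ *: (f _ - _)).
  by rewrite scalerDl [_ *: 1]mulr1 addrCA addrA.
apply: DeriveDef; last by rewrite /derive E.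
by rewrite /derivable E; exact: diff_derivable.
Qed.

Lemma line_MVT f y v s : 0 < s ->
  (forall t, t \in `[0, s]%R -> differentiable f (y + t *: v)) ->
  exists2 t, t \in `]0, s[%R & f (y + s *: v) - f y = s * 'D_v f (y + t *: v).
Proof.
move=> s0 df.
have [||t ts E] := @MVT _ (fun t => f (y + t *: v)) (fun t => 'D_v f (y + t *: v)) 0 s s0.
- move=> t /subset_itv_oo_cc ts; exact/is_derive_line/df.
- apply: derivable_within_continuous => t ts.
  by have [] := is_derive_line (df _ ts).
exists t => //; by rewrite scale0r addr0 subr0 mulrC in E.
Qed.

(** If the second derivative were positive, the difference quotient defining it would make ['D_v f]
    positive at [x + t *: v] for all small [t > 0], and the mean value theorem would yield a value
    above [f x]. *)
Lemma second_derivative_test f U x v : open U -> U x ->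
  (forall y, U y -> differentiable f y) -> differentiable ('D_v f) x ->
  (forall y, U y -> f y <= f x) -> 'D_v f x = 0 /\ 'D_v ('D_v f) x <= 0.
Proof.
move=> oU Ux df d2f fmax.
have cl : {for (0:R), continuous (fun t : R => x + t *: v)}.
  by apply: cvgD; [exact: cvg_cst|apply: cvgZr_tmp; exact: cvg_id].
have [r r0 rU] : exists2 r : R, 0 < r & forall t, `|t| < r -> U (x + t *: v).
  have : nbhs (x + (0:R) *: v) U.
    by apply: open_nbhs_nbhs; split => //; rewrite scale0r addr0.
  move/cl => /nbhs_ballP[r r0 H]; exists r => // t tr.
  by apply: H; rewrite -ball_normE /= sub0r normrN.
have dl (t : R) : `|t| < r -> is_derive t (1 : R) (fun s => f (x + s *: v)) ('D_v f (x + t *: v)).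
  by move=> tr; apply/is_derive_line/df/rU.
have D0 : 'D_v f x = 0.
  have := @derive1_at_max _ (fun s => f (x + s *: v)) (- r) r 0.
  have -> : -r <= r by rewrite (le_trans _ (ltW r0))// oppr_le0 ltW.
  have I t : t \in `](- r), r[ -> `|t| < r by rewrite in_itv /= ltr_norml.
  case/(_ isT).
  - by move=> t /I tr; have [] := dl _ tr.
  - by rewrite in_itv /= oppr_lt0 r0.
  - by move=> t /I /rU /fmax; rewrite scale0r addr0.
  move=> _ E; have := dl 0; rewrite normr0 r0 => /(_ isT)[_].
  by rewrite E scale0r addr0 => <-.
split=> //; rewrite leNgt; apply/negP => pos.
have := diff_derivable (v := v) d2f; rewrite /derivable => /cvg_ex[l Hl].
have El : 'D_v ('D_v f) x = l by apply/cvg_lim.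
rewrite El in pos.
have [e /= e0 He] := cvgr_gt l Hl 0 pos.
pose s := Num.min e r / 2.
have s0 : 0 < s by rewrite divr_gt0// lt_min e0 r0.
have sr : s < Num.min e r by rewrite ltr_pdivrMr// ltr_pMr ?ltr1n// lt_min e0 r0.
move: sr; rewrite lt_min => /andP[se sr].
have [|t] := @line_MVT f x v s s0.
  move=> t; rewrite in_itv /= => /andP[t0 ts].
  by apply/df/rU; rewrite ger0_norm// (le_lt_trans ts).
rewrite in_itv /= => /andP[t0 ts] E.
have : 0 < 'D_v f (x + t *: v).
  have := He t; rewrite /= sub0r normrN gtr0_norm// (lt_trans ts se).
  move=> /(_ isT); rewrite (gt_eqF t0) => /(_ isT).
  by rewrite D0 subr0 /= pmulr_rgt0 ?invr_gt0// addrC.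
have : f (x + s *: v) - f x <= 0.
  by rewrite subr_le0; apply/fmax/rU; rewrite gtr0_norm.
by rewrite E pmulr_rle0// leNgt => /negP.
Qed.

End SecondOrder.

(** * Symmetry of mixed second derivatives *)

Section Schwarz.
Context {R : realType} {d : nat}.
Implicit Types (f : 'rV[R]_d -> R) (U : set 'rV[R]_d).

Lemma open_parallelogram U x (u v : 'rV[R]_d) : open U -> U x ->
  exists2 r : R, 0 < r & forall s t, `|s| < r -> `|t| < r ->
    U (x + s *: u + t *: v).
Proof.
move=> oU Ux; have : nbhs x U by exact: open_nbhs_nbhs.
move=> /nbhs_ballP[e /= e0 He].
(* The [1] keeps the radius below meaningful when [u] and [v] both vanish. *)
have k0 : 0 < `|u| + `|v| + 1 by rewrite ltr_wpDl ?addr_ge0.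
exists (e / (`|u| + `|v| + 1)); first by rewrite divr_gt0.
move=> s t hs ht; apply: He; rewrite -ball_normE /= -addrA opprD addrA subrr.
rewrite add0r normrN (le_lt_trans (ler_normD _ _))// !normrZ.
have [m [mr ms mt]] : exists m, [/\ m < e / (`|u| + `|v| + 1), `|s| <= m & `|t| <= m].
  by case: (leP `|s| `|t|) => h; [exists (`|t|) | exists (`|s|)]; split=> //; exact: ltW.
apply: le_lt_trans (_ : m * (`|u| + `|v| + 1) < e); last first.
  by rewrite -ltr_pdivlMr.
rewrite !mulrDr mulr1 ler_wpDr//; first by rewrite (le_trans _ ms).
by rewrite lerD// ler_wpM2r.
Qed.

Lemma derive_translate (V : normedModType R) (f : 'rV[R]_d -> V) (y u w : 'rV[R]_d) :
  'D_u (fun z => f (z + w)) y = 'D_u f (y + w).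
Proof.
rewrite /derive; set g := fun _ => _; set k := fun _ => _.
suff -> : g = k by [].
by apply/funext => h; rewrite /g /k /= addrA.
Qed.

Lemma differentiable_translate (V : normedModType R) (f : 'rV[R]_d -> V)
    (y w : 'rV[R]_d) :
  differentiable f (y + w) -> differentiable (fun z => f (z + w)) y.
Proof.
by move=> df; exact: (@differentiable_comp _ _ _ _ (fun z => z + w) f).
Qed.

(** The mean value theorem is used twice: along [u] for the difference of [f] and its translate by
    [s *: v], then along [v] for ['D_u f]. *)
Lemma second_difference f x u v s : 0 < s ->
  (forall a b, a \in `[0, s]%R -> b \in `[0, s]%R ->
     differentiable f (x + a *: u + b *: v) /\
     differentiable ('D_u f) (x + a *: u + b *: v)) ->
  exists a b, [/\ a \in `]0, s[%R, b \in `]0, s[%R &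
    f (x + s *: u + s *: v) - f (x + s *: u) - (f (x + s *: v) - f x) =
    s * (s * 'D_v ('D_u f) (x + a *: u + b *: v))].
Proof.
move=> s0 df; have in0 : 0 \in `[0, s]%R by rewrite in_itv /= lexx ltW.
have ins : s \in `[0, s]%R by rewrite in_itv /= lexx ltW.
have dfs t : t \in `[0, s]%R -> differentiable f (x + t *: u + s *: v).
  by move=> ts; have [] := df _ _ ts ins.
have df0 t : t \in `[0, s]%R -> differentiable f (x + t *: u).
  by move=> ts; have [] := df _ _ ts in0; rewrite scale0r addr0.
have [|a as0 Ea] := @line_MVT _ _ (fun y => f (y + s *: v) - f y) x u s s0.
  move=> t ts; apply: differentiableB; last exact: df0.
  exact/differentiable_translate/dfs.
have as1 := subset_itv_oo_cc as0.
have [|b bs0 Eb] := @line_MVT _ _ ('D_u f) (x + a *: u) v s s0.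
  by move=> t ts; have [] := df _ _ as1 ts.
exists a, b; split=> //; rewrite Ea -Eb; congr (_ * _).
rewrite deriveB ?derive_translate//; apply: diff_derivable; last exact: df0.
exact/differentiable_translate/dfs.
Qed.

(** The second difference over a small parallelogram is symmetric in [u] and [v], so near [x] some
    value of one mixed derivative equals some value of the other. Both are continuous at [x]. *)
Lemma Schwarz f U x u v : open U -> U x -> smooth_on U f ->
  'D_u ('D_v f) x = 'D_v ('D_u f) x.
Proof.
move=> oU Ux sf.
have sD w := smooth_on_derive oU w sf.
have cont w z : {for x, continuous ('D_w ('D_z f))}.
  apply: differentiable_continuous.
  exact: smooth_on_diff (smooth_on_derive oU w (sD z)) Ux.
apply/eqP; rewrite -subr_eq0; apply/negPn/negP => ne.
(* Half the gap: if both derivatives stay within [e] of their values at [x], a common value nearby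
   contradicts the triangle inequality. *)
set e := `|'D_u ('D_v f) x - 'D_v ('D_u f) x| / 2.
have e0 : 0 < e by rewrite divr_gt0 ?normr_gt0.
have near w z : \forall y \near x, `|'D_w ('D_z f) x - 'D_w ('D_z f) y| < e.
  by have /cvgrPdist_lt := cont w z; exact.
pose W := U `&` ([set y | `|'D_u ('D_v f) x - 'D_u ('D_v f) y| < e] `&`
   [set y | `|'D_v ('D_u f) x - 'D_v ('D_u f) y| < e]).
have nW : nbhs x W.
  apply: filterI; first exact: open_nbhs_nbhs.
  by apply: filterI; exact: near.
have [r r0 rW] := open_parallelogram u v (open_interior W) nW.
have {}rW a b : `|a| < r -> `|b| < r -> W (x + a *: u + b *: v).
  by move=> ar br; apply: interior_subset; exact: rW.
pose s := r / 2; have s0 : 0 < s by rewrite divr_gt0.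
have sr : s < r by rewrite ltr_pdivrMr// ltr_pMr ?ltr1n.
have small a : a \in `[0, s]%R -> `|a| < r.
  by rewrite in_itv /= => /andP[a0 as0]; rewrite ger0_norm// (le_lt_trans as0).
have H w z : (w = u /\ z = v) \/ (w = v /\ z = u) -> forall a b,
    a \in `[0, s]%R -> b \in `[0, s]%R -> differentiable f (x + a *: w + b *: z) /\
     differentiable ('D_w f) (x + a *: w + b *: z).
  move=> wz a b /small ar /small br.
  have Uy : U (x + a *: w + b *: z).
    case: wz => -[-> ->]; first by have [] := rW a b ar br.
    by rewrite -addrA [_ *: v + _]addrC addrA; have [] := rW b a br ar.
  by split; [exact: smooth_on_diff Uy|exact: smooth_on_diff (sD w) Uy].
have [a [b [/subset_itv_oo_cc/small as0 /subset_itv_oo_cc/small bs0 E1]]] :=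
  second_difference s0 (H u v (or_introl (conj erefl erefl))).
have [c [k [/subset_itv_oo_cc/small cs0 /subset_itv_oo_cc/small ks0 E2]]] :=
  second_difference s0 (H v u (or_intror (conj erefl erefl))).
have E : 'D_v ('D_u f) (x + a *: u + b *: v) = 'D_u ('D_v f) (x + c *: v + k *: u).
  have canc (a' b' p q t z : R) : p - q - (t - z) = s * (s * a') ->
      p - t - (q - z) = s * (s * b') -> a' = b'.
    move=> Ea Eb; apply: (mulfI (lt0r_neq0 s0)); apply: (mulfI (lt0r_neq0 s0)).
    by rewrite -Ea -Eb; ring.
  by rewrite [x + s *: v + _]addrAC in E2; exact: canc E1 E2.
have [_ [_ /= h1]] := rW a b as0 bs0.
have [_ [/= h2 _]] := rW k c ks0 cs0.
rewrite -addrA [k *: u + _]addrC addrA -E in h2.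
have := ltrD h2 h1; rewrite -[ltRHS](splitr `|_|) [X in _ + X]distrC.
by rewrite ltNge ler_distD.
Qed.

Lemma Schwarz_mx m n (F : 'rV[R]_d -> 'M[R]_(m, n)) U x u v :
  open U -> U x -> smooth_on U F -> 'D_u ('D_v F) x = 'D_v ('D_u F) x.
Proof.
move=> oU Ux sF; have sD w := smooth_on_derive oU w sF.
apply/matrixP => i j.
have E w z : ('D_w ('D_z F) x) i j = 'D_w ('D_z (fun y => F y i j)) x.
  rewrite derive_coord; last exact: smooth_on_diff (sD z) Ux.
  apply: (derive_near _ oU) => // y Uy.
  by rewrite derive_coord//; exact: smooth_on_diff sF Uy.
apply: etrans (E u v) _; apply: etrans _ (esym (E v u)).
by apply: (Schwarz u v oU Ux); exact: ((smooth_on_coord oU F).1 sF i j).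
Qed.

End Schwarz.

(** * Directional derivatives and bilinear forms *)

(* Locked: otherwise failing unifications unfold derivatives to limits. *)
HB.lock Definition dder (R : realType) (V W : normedModType R) (v : V)
  (f : V -> W) : V -> W := fun y => 'D_v f y.

HB.lock Definition bform (R : realType) (d : nat) (A : 'M[R]_d)
  (u v : 'rV[R]_d) : R := (u *m A *m v^T) 0 0.

Section DirectionalDerivative.
Context {R : realType}.

Lemma dderE (V W : normedModType R) (v : V) (f : V -> W) y :
  dder v f y = 'D_v f y.
Proof. by rewrite dder.unlock. Qed.

Lemma dder_funE (V W : normedModType R) (v : V) (f : V -> W) :
  dder v f = 'D_v f.
Proof. by apply/funext => y; rewrite dderE. Qed.

Section General.
Context {V W : normedModType R}.
Implicit Types (f g : V -> W) (v y : V).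

Lemma dder_cst (a : W) v y : dder v (fun=> a) y = 0.
Proof. by rewrite dderE derive_cst. Qed.

Lemma dderD f g v y : differentiable f y -> differentiable g y ->
  dder v (fun z => f z + g z) y = dder v f y + dder v g y.
Proof.
by move=> df dg; rewrite !dderE deriveD//; exact: diff_derivable.
Qed.

Lemma dderB f g v y : differentiable f y -> differentiable g y ->
  dder v (fun z => f z - g z) y = dder v f y - dder v g y.
Proof.
by move=> df dg; rewrite !dderE deriveB//; exact: diff_derivable.
Qed.

Lemma dderZ f a v y : differentiable f y ->
  dder v (fun z => a *: f z) y = a *: dder v f y.
Proof. by move=> df; rewrite !dderE deriveZ//; exact: diff_derivable. Qed.

Lemma differentiable_bigsum (I : finType) (f : I -> V -> W) y :
  (forall i, differentiable (f i) y) -> differentiable (fun z => \sum_i f i z) y.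
Proof.
move=> df; elim: (index_enum I) => [|i s IH].
  rewrite (_ : (fun _ => _) = cst 0); first exact: differentiable_cst.
  by apply/funext => z; rewrite big_nil.
rewrite (_ : (fun _ => _) = f i + (fun z => \sum_(j <- s) f j z)).
  exact: differentiableD.
by apply/funext => z; rewrite big_cons.
Qed.

Lemma dder_sum (I : finType) (f : I -> V -> W) v y :
  (forall i, differentiable (f i) y) ->
  dder v (fun z => \sum_i f i z) y = \sum_i dder v (f i) y.
Proof.
move=> df; elim: (index_enum I) => [|i s IH].
  rewrite big_nil (_ : (fun _ => _) = (fun=> 0)) ?dder_cst//.
  by apply/funext => z; rewrite big_nil.
rewrite big_cons -IH -dderD//; last first.
  elim: s {IH} => [|j s IH].
    rewrite (_ : (fun _ => _) = cst 0); first exact: differentiable_cst.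
    by apply/funext => z; rewrite big_nil.
  rewrite (_ : (fun _ => _) = f j + (fun z => \sum_(j <- s) f j z)).
    exact: differentiableD.
  by apply/funext => z; rewrite big_cons.
by congr (dder v _ y); apply/funext => z; rewrite big_cons.
Qed.

End General.

Lemma dderM (V : normedModType R) (f g : V -> R) v y :
  differentiable f y -> differentiable g y ->
  dder v (fun z => f z * g z) y = dder v f y * g y + f y * dder v g y.
Proof.
move=> df dg; rewrite !dderE deriveM; [|exact: diff_derivable..].
by rewrite addrC /GRing.scale /= [g y * _]mulrC.
Qed.

Lemma dder_coord (V : normedModType R) m n (M : V -> 'M[R]_(m, n)) x v i j :
  differentiable M x -> dder v M x i j = dder v (fun y => M y i j) x.
Proof. by move=> dM; rewrite !dderE derive_coord. Qed.

Section Domain.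
Context {d : nat}.
Implicit Types (W : normedModType R) (U : set 'rV[R]_d).

Lemma pderiveE W (i : 'I_d) (f : 'rV[R]_d -> W) : pderive i f = dder (basis_vec i) f.
Proof. by rewrite dder_funE. Qed.

Lemma dder_basis W (f : 'rV[R]_d -> W) y v : differentiable f y ->
  dder v f y = \sum_i v 0 i *: dder (basis_vec i) f y.
Proof.
move=> df; rewrite dderE derive_pderive//.
by apply: eq_bigr => i _; rewrite dderE.
Qed.

Lemma dder_near W (f g : 'rV[R]_d -> W) U v y : open U -> U y ->
  (forall y, U y -> f y = g y) -> dder v f y = dder v g y.
Proof. by move=> oU Uy fg; rewrite !dderE; exact: (derive_near _ oU). Qed.

Lemma dder_comp e W (h : 'rV[R]_e -> W) (F : 'rV[R]_d -> 'rV[R]_e) y v :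
  differentiable F y -> differentiable h (F y) ->
  dder v (fun z => h (F z)) y = dder (dder v F y) h (F y).
Proof. by move=> dF dh; rewrite !dderE; exact: derive_comp. Qed.

Lemma smooth_on_dder W U (f : 'rV[R]_d -> W) v : open U ->
  smooth_on U f -> smooth_on U (dder v f).
Proof. by move=> oU; rewrite dder_funE; exact: smooth_on_derive. Qed.

Lemma dder_swap m n (F : 'rV[R]_d -> 'M[R]_(m, n)) U x u v :
  open U -> U x -> smooth_on U F -> dder u (dder v F) x = dder v (dder u F) x.
Proof. by move=> oU Ux sF; rewrite !dder_funE; exact: (Schwarz_mx _ _ oU). Qed.

Lemma dder_dirD W (f : 'rV[R]_d -> W) y (u v : 'rV[R]_d) :
  differentiable f y -> dder (u + v) f y = dder u f y + dder v f y.
Proof. by move=> df; rewrite !dderE !deriveE// linearD. Qed.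

Lemma dder_dirN W (f : 'rV[R]_d -> W) y (u : 'rV[R]_d) :
  differentiable f y -> dder (- u) f y = - dder u f y.
Proof. by move=> df; rewrite !dderE !deriveE// linearN. Qed.

Lemma dder_dirZ W (f : 'rV[R]_d -> W) y (u : 'rV[R]_d) a :
  differentiable f y -> dder (a *: u) f y = a *: dder u f y.
Proof. by move=> df; rewrite !dderE !deriveE// linearZ. Qed.

Lemma dder_dir_sum W (f : 'rV[R]_d -> W) y (I : finType) (u : I -> 'rV[R]_d) :
  differentiable f y -> dder (\sum_i u i) f y = \sum_i dder (u i) f y.
Proof.
move=> df; rewrite dderE deriveE// linear_sum.
by apply: eq_bigr => i _; rewrite dderE deriveE.
Qed.

Lemma dder_max_test (f : 'rV[R]_d -> R) U x v : open U -> U x ->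
  smooth_on U f -> (forall y, U y -> f y <= f x) ->
  dder v f x = 0 /\ dder v (dder v f) x <= 0.
Proof.
move=> oU Ux sf fmax; rewrite !dder_funE.
apply: (second_derivative_test oU Ux) => //.
  by move=> y Uy; exact: smooth_on_diff Uy.
exact: smooth_on_diff (smooth_on_derive oU v sf) Ux.
Qed.

End Domain.

End DirectionalDerivative.

Section BilinearForms.
Context {R : realType}.

Section Algebra.
Context {d : nat}.
Implicit Types (A : 'M[R]_d) (u v w : 'rV[R]_d).

Lemma bform_mulmx A u v : bform A u v = (u *m A *m v^T) 0 0.
Proof. by rewrite bform.unlock. Qed.

Lemma bformE A u v : bform A u v = \sum_i \sum_j u 0 i * v 0 j * A i j.
Proof.
rewrite !bform_mulmx mxE exchange_big; apply: eq_bigr => j _.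
rewrite !mxE big_distrl; apply: eq_bigr => i _ /=; by rewrite mulrAC.
Qed.

Lemma bformDl A u v w : bform A (u + v) w = bform A u w + bform A v w.
Proof. by rewrite !bform_mulmx !mulmxDl mxE. Qed.

Lemma bformDr A u v w : bform A w (u + v) = bform A w u + bform A w v.
Proof. by rewrite !bform_mulmx linearD mulmxDr mxE. Qed.

Lemma bformDm A B u v : bform (A + B) u v = bform A u v + bform B u v.
Proof. by rewrite !bform_mulmx mulmxDr mulmxDl mxE. Qed.

Lemma bformZl A a u w : bform A (a *: u) w = a * bform A u w.
Proof. by rewrite !bform_mulmx -!scalemxAl mxE. Qed.

Lemma bformZr A a u w : bform A w (a *: u) = a * bform A w u.
Proof. by rewrite !bform_mulmx linearZ -scalemxAr mxE. Qed.

Lemma bformZm A a u w : bform (a *: A) u w = a * bform A u w.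
Proof. by rewrite !bform_mulmx -scalemxAr -scalemxAl mxE. Qed.

Lemma bformNl A u w : bform A (- u) w = - bform A u w.
Proof. by rewrite -scaleN1r bformZl mulN1r. Qed.

Lemma bformNr A u w : bform A w (- u) = - bform A w u.
Proof. by rewrite -scaleN1r bformZr mulN1r. Qed.

Lemma bformNm A u w : bform (- A) u w = - bform A u w.
Proof. by rewrite -scaleN1r bformZm mulN1r. Qed.

Lemma bformBl A u v w : bform A (u - v) w = bform A u w - bform A v w.
Proof. by rewrite bformDl bformNl. Qed.

Lemma bformBr A u v w : bform A w (u - v) = bform A w u - bform A w v.
Proof. by rewrite bformDr bformNr. Qed.

Lemma bform0l A w : bform A 0 w = 0.
Proof. by have := bformZl A 0 0 w; rewrite scale0r mul0r. Qed.

Lemma bform0r A w : bform A w 0 = 0.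
Proof. by have := bformZr A 0 0 w; rewrite scale0r mul0r. Qed.

Lemma bform_suml A (I : finType) (u : I -> 'rV[R]_d) w :
  bform A (\sum_i u i) w = \sum_i bform A (u i) w.
Proof.
rewrite bform_mulmx !mulmx_suml summxE.
by apply: eq_bigr => i _; rewrite bform_mulmx.
Qed.

Lemma bform_sumr A (I : finType) (u : I -> 'rV[R]_d) w :
  bform A w (\sum_i u i) = \sum_i bform A w (u i).
Proof.
rewrite bform_mulmx linear_sum mulmx_sumr summxE.
by apply: eq_bigr => i _; rewrite bform_mulmx.
Qed.

Lemma bform_summ (I : finType) (A : I -> 'M[R]_d) u w :
  bform (\sum_i A i) u w = \sum_i bform (A i) u w.
Proof.
rewrite bform_mulmx mulmx_sumr mulmx_suml summxE.
by apply: eq_bigr => i _; rewrite bform_mulmx.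
Qed.

Lemma bform_sym A u v : A^T = A -> bform A u v = bform A v u.
Proof.
move=> sA; rewrite !bform_mulmx; transitivity ((u *m A *m v^T)^T 0 0); first by rewrite [RHS]mxE.
by rewrite !trmx_mul trmxK sA mulmxA.
Qed.

Lemma bform_delta A i j : bform A (basis_vec i) (basis_vec j) = A i j.
Proof. by rewrite !bform_mulmx /basis_vec -rowE trmx_delta -colE !mxE. Qed.

Lemma bform_basisE A u j : bform A u (basis_vec j) = \sum_i u 0 i * A i j.
Proof. by rewrite !bform_mulmx /basis_vec trmx_delta -colE !mxE. Qed.

Lemma bform_basisr A u v : bform A u v = \sum_j v 0 j * bform A u (basis_vec j).
Proof.
rewrite {1}[v]row_sum_delta bform_sumr.
by apply: eq_bigr => j _; rewrite bformZr.
Qed.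

Lemma bform_inj A u v : A \in unitmx ->
  (forall i, bform A u (basis_vec i) = bform A v (basis_vec i)) -> u = v.
Proof.
move=> uA E; apply: (can_inj (mulmxK uA)); apply/rowP => i.
by have := E i; rewrite !bform_mulmx /basis_vec !trmx_delta -!colE !mxE.
Qed.

End Algebra.

Section Derivatives.
Context {V : normedModType R}.

Lemma differentiable_mulmx m n p (M : V -> 'M[R]_(m, n)) (N : V -> 'M[R]_(n, p)) y :
  differentiable M y -> differentiable N y ->
  differentiable (fun z => M z *m N z) y.
Proof.
move=> /differentiable_mxP dM /differentiable_mxP dN.
apply/differentiable_mxP => i j.
rewrite (_ : (fun _ => _) = \sum_k (fun z => M z i k * N z k j)).
  apply: differentiable_sum => k; exact: differentiableM.
by apply/funext => z; rewrite mxE fct_sumE.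
Qed.

Lemma derive_mulmx m n p (M : V -> 'M[R]_(m, n)) (N : V -> 'M[R]_(n, p)) y v :
  differentiable M y -> differentiable N y ->
  'D_v (fun z => M z *m N z) y = 'D_v M y *m N y + M y *m 'D_v N y.
Proof.
move=> dM dN; apply/matrixP => i j.
rewrite derive_coord; last exact: differentiable_mulmx.
have /differentiable_mxP dMc := dM; have /differentiable_mxP dNc := dN.
rewrite (_ : (fun _ => _) = \sum_k (fun z => M z i k * N z k j)); last first.
  by apply/funext => z; rewrite mxE fct_sumE.
rewrite derive_sum; last first.
  by move=> k; apply/diff_derivable/differentiableM.
rewrite !mxE -big_split; apply: eq_bigr => k _ /=.
rewrite deriveM; [|exact: diff_derivable..].
by rewrite !derive_coord// addrC /GRing.scale /= [X in _ + X]mulrC [X in X + _]mulrC mulrC addrC [X in X + _]mulrC.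
Qed.

Lemma dder_mulmx m n p (M : V -> 'M[R]_(m, n)) (N : V -> 'M[R]_(n, p)) y v :
  differentiable M y -> differentiable N y ->
  dder v (fun z => M z *m N z) y = dder v M y *m N y + M y *m dder v N y.
Proof. by move=> dM dN; rewrite !dderE derive_mulmx. Qed.

Lemma differentiable_trmx m n (M : V -> 'M[R]_(m, n)) y :
  differentiable M y -> differentiable (fun z => (M z)^T) y.
Proof.
move=> /differentiable_mxP dM; apply/differentiable_mxP => i j.
rewrite (_ : (fun _ => _) = (fun z => M z j i)) ?dM//.
by apply/funext => z; rewrite mxE.
Qed.

Lemma derive_trmx m n (M : V -> 'M[R]_(m, n)) y v :
  differentiable M y -> 'D_v (fun z => (M z)^T) y = ('D_v M y)^T.
Proof.
move=> dM; apply/matrixP => i j.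
rewrite derive_coord; last exact: differentiable_trmx.
rewrite mxE derive_coord//; congr ('D_v _ y).
by apply/funext => z; rewrite mxE.
Qed.

Context {d : nat}.

Lemma differentiable_bform (A : V -> 'M[R]_d) (X Y : V -> 'rV[R]_d) y :
  differentiable A y -> differentiable X y -> differentiable Y y ->
  differentiable (fun z => bform (A z) (X z) (Y z)) y.
Proof.
move=> dA dX dY; rewrite (_ : (fun _ => _) = (fun z => (X z *m A z *m (Y z)^T) 0 0)); last first.
  by apply/funext => z; rewrite bform_mulmx.
have := differentiable_mulmx (differentiable_mulmx dX dA)
  (differentiable_trmx dY).
by move/differentiable_mxP; exact.
Qed.

Lemma dder_bform (A : V -> 'M[R]_d) (X Y : V -> 'rV[R]_d) y v :
  differentiable A y -> differentiable X y -> differentiable Y y ->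
  dder v (fun z => bform (A z) (X z) (Y z)) y =
  bform (dder v A y) (X y) (Y y) + bform (A y) (dder v X y) (Y y)
  + bform (A y) (X y) (dder v Y y).
Proof.
move=> dA dX dY; rewrite !bform_mulmx !dderE.
have dXA := differentiable_mulmx dX dA; have dYt := differentiable_trmx dY.
have -> : (fun z => bform (A z) (X z) (Y z)) =
    (fun z => (X z *m A z *m (Y z)^T) 0 0).
  by apply/funext => z; rewrite bform_mulmx.
rewrite -(derive_coord _ _ _ (differentiable_mulmx dXA dYt)) derive_mulmx//.
rewrite derive_mulmx// derive_trmx// mulmxDl !mxE.
by rewrite -[in RHS]addrA addrCA addrA.
Qed.

End Derivatives.

End BilinearForms.

(** * Christoffel symbols, covariant derivatives and curvature *)

HB.lock Definition chr (R : realType) (d : nat) (G : 'rV[R]_d -> 'M[R]_d)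
  (y u v : 'rV[R]_d) : 'rV[R]_d := christoffel_app G y u v.

Section Christoffel.
Context {R : realType} {d : nat}.

(** For each upper index the symbol is a bilinear form, so the rules for [bform] yield those for
    [chr]. *)
Definition christoffel_mx (G : 'rV[R]_d -> 'M[R]_d) (k : 'I_d) (y : 'rV[R]_d) :
    'M[R]_d :=
  \matrix_(i, j) christoffel G y k i j.

Definition dchr (G : 'rV[R]_d -> 'M[R]_d) (y w u v : 'rV[R]_d) : 'rV[R]_d :=
  dder w (fun z => chr G z u v) y.

(** The vector $\hat D_u\hat D_vw-\hat D_v\hat D_uw$ for fields with constant components;
    [riemann_coord] pairs it with a fourth vector and changes the sign. *)
Definition curvature (G : 'rV[R]_d -> 'M[R]_d) (y u v w : 'rV[R]_d) :
    'rV[R]_d :=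
  dchr G y u v w - dchr G y v u w + chr G y u (chr G y v w)
  - chr G y v (chr G y u w).

Section Pointwise.
Context (G : 'rV[R]_d -> 'M[R]_d) (y : 'rV[R]_d).
Implicit Types u v w : 'rV[R]_d.
Local Notation chr := (chr G y).

Lemma chr_christoffel_app u v : chr u v = christoffel_app G y u v.
Proof. by rewrite chr.unlock. Qed.

Lemma chrE u v k : chr u v 0 k = bform (christoffel_mx G k y) u v.
Proof.
rewrite bformE chr_christoffel_app mxE; apply: eq_bigr => i _; apply: eq_bigr => j _.
by rewrite mxE.
Qed.

Lemma chrDl u v w : chr (u + v) w = chr u w + chr v w.
Proof.
by apply/rowP => k; rewrite [RHS]mxE !chrE bformDl.
Qed.

Lemma chrDr u v w : chr w (u + v) = chr w u + chr w v.
Proof.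
by apply/rowP => k; rewrite [RHS]mxE !chrE bformDr.
Qed.

Lemma chrZl a u w : chr (a *: u) w = a *: chr u w.
Proof.
by apply/rowP => k; rewrite [RHS]mxE !chrE bformZl.
Qed.

Lemma chrZr a u w : chr w (a *: u) = a *: chr w u.
Proof.
by apply/rowP => k; rewrite [RHS]mxE !chrE bformZr.
Qed.

Lemma chrNl u w : chr (- u) w = - chr u w.
Proof. by rewrite -scaleN1r chrZl scaleN1r. Qed.

Lemma chr0l w : chr 0 w = 0.
Proof. by have := chrZl 0 0 w; rewrite !scale0r. Qed.

Lemma chr0r w : chr w 0 = 0.
Proof. by have := chrZr 0 0 w; rewrite !scale0r. Qed.

Lemma chr_suml (I : finType) (u : I -> 'rV[R]_d) w :
  chr (\sum_i u i) w = \sum_i chr (u i) w.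
Proof.
exact: (big_morph (fun z => chr z w) (fun a b => chrDl a b w)
  (chr0l w)).
Qed.

Lemma chr_sumr (I : finType) (u : I -> 'rV[R]_d) w :
  chr w (\sum_i u i) = \sum_i chr w (u i).
Proof.
exact: (big_morph (chr w) (fun a b => chrDr a b w)
  (chr0r w)).
Qed.

End Pointwise.

Section Metric.
Context (V : set 'rV[R]_d) (oV : open V) (G : 'rV[R]_d -> 'M[R]_d).
Hypothesis sG : smooth_on V G.
Hypothesis symG : forall y, V y -> (G y)^T = G y.
Hypothesis unitG : forall y, V y -> G y \in unitmx.

Lemma smooth_on_christoffel k i j : smooth_on V (fun y => christoffel G y k i j).
Proof.
have sGc p q := (smooth_on_coord oV G).1 sG p q.
rewrite /christoffel; apply: smooth_onM => //; first exact: smooth_on_cst.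
apply: smooth_on_sum => // l; apply: smooth_onM => //.
  exact: ((smooth_on_coord oV _).1 (smooth_on_invmx oV unitG sG)).
apply: smooth_onB => //; last exact: smooth_on_pderive.
apply: smooth_onD => //; exact: smooth_on_pderive.
Qed.

Lemma smooth_on_christoffel_mx k : smooth_on V (christoffel_mx G k).
Proof.
apply/(smooth_on_coord oV) => i j.
by apply: (smooth_on_eq oV _ (smooth_on_christoffel k i j)) => y _; rewrite mxE.
Qed.

Lemma pdder_metric_sym y k i j : V y ->
  pderive k (fun z => G z i j) y = pderive k (fun z => G z j i) y.
Proof.
move=> Vy; apply: (pderive_near k oV) => // z Vz.
by rewrite -[in LHS](symG Vz) mxE.
Qed.

Lemma chr_sym y u v : V y ->
  chr G y u v = chr G y v u.
Proof.
move=> Vy; rewrite !chr_christoffel_app; apply/rowP => k.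
rewrite !mxE exchange_big; apply: eq_bigr => i _.
apply: eq_bigr => j _ /=; rewrite [u 0 j * _]mulrC; congr (_ * _).
rewrite /christoffel; congr (_ * _); apply: eq_bigr => l _; congr (_ * _).
by rewrite [X in X - _]addrC (pdder_metric_sym l j i Vy).
Qed.

(** Koszul's formula for fields with constant components: pairing with the metric cancels the
    inverse metric in the Christoffel symbol. *)
Lemma metric_chr y u v w : V y ->
  bform (G y) (chr G y u v) w =
  2^-1 * (bform (dder u G y) v w + bform (dder v G y) u w - bform (dder w G y) u v).
Proof.
move=> Vy.
(* Twice the Christoffel symbol of the first kind, as a covector; raising its index gives [chr]. *)
pose L : 'rV[R]_d := \row_l (bform (dder u G y) v (basis_vec l)
  + bform (dder v G y) u (basis_vec l) - bform (dder (basis_vec l) G y) u v).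
have dG : differentiable G y by exact: smooth_on_diff Vy.
have dE z i j : (dder z G y) i j = \sum_k z 0 k * dder (basis_vec k) (fun x => G x i j) y.
  rewrite dder_coord// dder_basis//.
  exact: ((differentiable_mxP G y).1 dG).
have EL : chr G y u v = 2^-1 *: (L *m (invmx (G y))^T).
  rewrite chr_christoffel_app; apply/rowP => k; rewrite !mxE.
  transitivity (\sum_l 2^-1 * (\sum_i \sum_j u 0 i * v 0 j * (invmx (G y) k l *
    (pderive i (fun z => G z j l) y + pderive j (fun z => G z i l) y
     - pderive l (fun z => G z i j) y)))).
    rewrite -mulr_sumr [in RHS]exchange_big mulr_sumr; apply: eq_bigr => i _ /=.
        rewrite exchange_big mulr_sumr; apply: eq_bigr => j _ /=.
    by rewrite /christoffel -[in RHS]mulr_sumr mulrCA.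
  rewrite -mulr_sumr; congr (_ * _); apply: eq_bigr => l _.
  rewrite [L 0 l]mxE [_^T _ _]mxE mulrC.
  transitivity (invmx (G y) k l *
      (\sum_i \sum_j u 0 i * v 0 j * pderive i (fun z => G z j l) y
       + \sum_i \sum_j u 0 i * v 0 j * pderive j (fun z => G z i l) y
       - \sum_i \sum_j u 0 i * v 0 j * pderive l (fun z => G z i j) y)).
    rewrite -big_split -sumrB mulr_sumr; apply: eq_bigr => i _ /=.
    rewrite -big_split -sumrB mulr_sumr; apply: eq_bigr => j _ /=.
    by rewrite -mulrDr -mulrBr mulrCA.
  congr (_ * (_ + _ - _)).
  - rewrite bform_basisE exchange_big; apply: eq_bigr => j _.
    rewrite dE mulr_sumr; apply: eq_bigr => i _ /=; rewrite pderiveE.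
    by rewrite mulrA [v 0 j * _]mulrC.
  - rewrite bform_basisE; apply: eq_bigr => i _.
    by rewrite dE mulr_sumr; apply: eq_bigr => j _ /=; rewrite pderiveE mulrA.
  - rewrite bformE; apply: eq_bigr => i _; apply: eq_bigr => j _.
    by rewrite dder_coord// pderiveE.
rewrite EL bformZl; congr (_ * _).
have -> : bform (G y) (L *m (invmx (G y))^T) w = \sum_l w 0 l * L 0 l.
  rewrite bform_mulmx -[L *m _ *m _]mulmxA -{2}(symG Vy) -trmx_mul mulmxV ?unitG//.
  by rewrite trmx1 mulmx1 mxE; apply: eq_bigr => l _; rewrite [w^T _ _]mxE mulrC.
transitivity (\sum_l w 0 l * bform (dder u G y) v (basis_vec l)
  + \sum_l w 0 l * bform (dder v G y) u (basis_vec l)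
  - \sum_l w 0 l * bform (dder (basis_vec l) G y) u v).
  rewrite -big_split -sumrB; apply: eq_bigr => l _ /=.
  by rewrite [L 0 l]mxE -mulrDr -mulrBr.
congr (_ + _ - _); [by rewrite [RHS]bform_basisr..|].
rewrite (dder_basis w dG) bform_summ; apply: eq_bigr => l _.
by rewrite bformZm.
Qed.

Lemma dder_metric_sym y w : V y -> (dder w G y)^T = dder w G y.
Proof.
move=> Vy; have dG : differentiable G y by exact: smooth_on_diff Vy.
rewrite !dderE -derive_trmx//; apply: (derive_near w oV _ Vy) => z.
exact: symG.
Qed.

(** Two instances of Koszul's formula are added; the derivatives along [u] and [v] cancel because
    derivatives of the metric are symmetric matrices. *)
Lemma metric_compat y u v w : V y ->
  bform (dder w G y) u v =
  bform (G y) (chr G y w u) v + bform (G y) u (chr G y w v).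
Proof.
move=> Vy; rewrite [X in _ + X]bform_sym ?symG// !metric_chr//.
rewrite [bform (dder w G y) v u]bform_sym ?dder_metric_sym//.
rewrite [bform (dder u G y) w v]bform_sym ?dder_metric_sym//.
by rewrite [bform (dder v G y) w u]bform_sym ?dder_metric_sym//; lra.
Qed.

(** The bracket of two constant fields vanishes, and with it the third term of the curvature. *)
Lemma riemann_coordE y u v w z :
  riemann_coord G y u v w z = - bform (G y) (curvature G y u v w) z.
Proof.
rewrite /riemann_coord /riemann_fields bform_mulmx.
congr (- (_ *m _ *m _) 0 0).
have E a b : levi_civita G (cst a) (cst b) = fun x => chr G x a b.
  by apply/funext => x; rewrite /levi_civita derive_cst add0r chr_christoffel_app.
have -> : levi_civita G (lie_bracket (cst u) (cst v)) (cst w) y = 0.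
  rewrite /levi_civita /lie_bracket /= -chr_christoffel_app !derive_cst subrr.
  by rewrite add0r chr0l.
rewrite !E subr0 /levi_civita -!chr_christoffel_app /curvature /dchr !dderE.
by rewrite opprD addrACA addrA.
Qed.

End Metric.

End Christoffel.

(** * Covariant differentiation along a map *)

Section CovariantDerivative.
Context {R : realType} {n d : nat}.
Context (U : set 'rV[R]_n) (oU : open U) (F : 'rV[R]_n -> 'rV[R]_d).
Context (V : set 'rV[R]_d) (oV : open V) (G : 'rV[R]_d -> 'M[R]_d).
Hypothesis sF : smooth_on U F.
Hypothesis FUV : forall y, U y -> V (F y).
Hypothesis sG : smooth_on V G.
Hypothesis symG : forall y, V y -> (G y)^T = G y.
Hypothesis unitG : forall y, V y -> G y \in unitmx.
Implicit Types (X Y : 'rV[R]_n -> 'rV[R]_d) (a : 'rV[R]_n -> 'rV[R]_n).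

Lemma smooth_on_comp_mx p q (A : 'rV[R]_d -> 'M[R]_(p, q)) :
  smooth_on V A -> smooth_on U (fun y => A (F y)).
Proof.
move=> sA; apply/(smooth_on_coord oU) => i j.
apply: (@smooth_on_comp _ _ U oU _ V (fun z => A z i j) F) => //.
exact: ((smooth_on_coord oV A).1 sA).
Qed.

Lemma smooth_on_bform e (A : 'rV[R]_n -> 'M[R]_e) (X Y : 'rV[R]_n -> 'rV[R]_e) :
  smooth_on U A -> smooth_on U X -> smooth_on U Y ->
  smooth_on U (fun y => bform (A y) (X y) (Y y)).
Proof.
move=> /(smooth_on_coord oU) sA /(smooth_on_coord oU) sX /(smooth_on_coord oU) sY.
have E y : U y -> \sum_i \sum_j X y 0 i * Y y 0 j * A y i j =
  bform (A y) (X y) (Y y) by rewrite bformE.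
apply: (smooth_on_eq oU E); apply: smooth_on_sum => // i.
apply: smooth_on_sum => // j.
by apply: smooth_onM => //; apply: smooth_onM.
Qed.

Lemma smooth_on_chr X Y : smooth_on U X -> smooth_on U Y ->
  smooth_on U (fun y => chr G (F y) (X y) (Y y)).
Proof.
move=> sX sY; apply/(smooth_on_coord oU) => i k; rewrite ord1.
have E y : U y -> bform (christoffel_mx G k (F y)) (X y) (Y y) =
  chr G (F y) (X y) (Y y) 0 k by rewrite chrE.
apply: (smooth_on_eq oU E); apply: smooth_on_bform => //.
apply: smooth_on_comp_mx; exact: smooth_on_christoffel_mx.
Qed.

Lemma dder_chr X Y v y : U y -> smooth_on U X -> smooth_on U Y ->
  dder v (fun z => chr G (F z) (X z) (Y z)) y =
  dchr G (F y) (dder v F y) (X y) (Y y)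
  + chr G (F y) (dder v X y) (Y y) + chr G (F y) (X y) (dder v Y y).
Proof.
move=> Uy sX sY; have Vy := FUV Uy; apply/rowP => k.
have sGk := smooth_on_christoffel_mx oV sG unitG k.
have dGk := smooth_on_diff sGk Vy.
have dX := smooth_on_diff sX Uy; have dY := smooth_on_diff sY Uy.
have dF := smooth_on_diff sF Uy.
rewrite dder_coord; last exact: smooth_on_diff (smooth_on_chr sX sY) Uy.
rewrite [RHS]mxE [X in X + _]mxE !chrE.
have -> : (fun z => chr G (F z) (X z) (Y z) 0 k) =
    (fun z => bform (christoffel_mx G k (F z)) (X z) (Y z)).
  by apply/funext => z; rewrite chrE.
rewrite dder_bform//; last exact: smooth_on_diff (smooth_on_comp_mx sGk) Uy.
rewrite dder_comp//; congr (_ + _ + _).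
have E : (fun z => chr G z (X y) (Y y) 0 k) =
    (fun z => bform (christoffel_mx G k z) (X y) (Y y)).
  by apply/funext => z; rewrite chrE.
rewrite /dchr dder_coord; last first.
  apply/differentiable_mxP => i j; rewrite ord1.
  have -> : (fun z => chr G z (X y) (Y y) 0 j) =
      (fun z => bform (christoffel_mx G j z) (X y) (Y y)).
    by apply/funext => z; rewrite chrE.
  apply: differentiable_bform; [|exact: differentiable_cst..].
  exact: smooth_on_diff (smooth_on_christoffel_mx oV sG unitG j) Vy.
rewrite E dder_bform//; [|exact: differentiable_cst..].
by rewrite !dder_cst bform0l bform0r !addr0.
Qed.

(** The direction [v] is constant on the parameter domain, so that derivatives in two such
    directions commute and no bracket terms arise. *)
Definition cov (v : 'rV[R]_n) X (y : 'rV[R]_n) : 'rV[R]_d :=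
  dder v X y + chr G (F y) (dder v F y) (X y).

Lemma smooth_on_cov v X : smooth_on U X -> smooth_on U (cov v X).
Proof.
move=> sX; apply: smooth_onD => //; first exact: smooth_on_dder.
by apply: smooth_on_chr => //; exact: smooth_on_dder.
Qed.

Lemma cov_bform X Y v y : U y -> smooth_on U X -> smooth_on U Y ->
  dder v (fun z => bform (G (F z)) (X z) (Y z)) y =
  bform (G (F y)) (cov v X y) (Y y) + bform (G (F y)) (X y) (cov v Y y).
Proof.
move=> Uy sX sY; have Vy := FUV Uy.
have dGF := smooth_on_diff (smooth_on_comp_mx sG) Uy.
rewrite (dder_bform v dGF (smooth_on_diff sX Uy) (smooth_on_diff sY Uy)).
rewrite (dder_comp v (smooth_on_diff sF Uy) (smooth_on_diff sG Vy)).
rewrite (metric_compat oV sG symG unitG _ _ _ Vy) /cov bformDl bformDr.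
by ring.
Qed.

(** Torsion freeness: partial derivatives of [F] commute and the Christoffel symbol is symmetric. *)
Lemma cov_swap u v y : U y -> cov u (dder v F) y = cov v (dder u F) y.
Proof.
move=> Uy; rewrite /cov (dder_swap u v oU Uy sF); congr (_ + _).
exact: (chr_sym oV symG _ _ (FUV Uy)).
Qed.

(** After expansion, the second derivatives of [X] and of [F] cancel by commutation, and so do the
    terms with a first derivative of [X]; what is left is tensorial in [X]. *)
Lemma cov_comm X u v y : U y -> smooth_on U X ->
  cov u (cov v X) y - cov v (cov u X) y =
  curvature G (F y) (dder u F y) (dder v F y) (X y).
Proof.
move=> Uy sX; have Vy := FUV Uy.
have sD w := smooth_on_dder w oU sX; have sDF w := smooth_on_dder w oU sF.
have E w z : cov w (cov z X) y = dder w (dder z X) y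
  + (dchr G (F y) (dder w F y) (dder z F y) (X y)
     + chr G (F y) (dder w (dder z F) y) (X y)
     + chr G (F y) (dder z F y) (dder w X y))
  + (chr G (F y) (dder w F y) (dder z X y)
     + chr G (F y) (dder w F y) (chr G (F y) (dder z F y) (X y))).
  rewrite {1}/cov -chrDr; congr (_ + _); rewrite -dder_chr//.
  rewrite dderD//; first exact: smooth_on_diff (sD z) Uy.
  exact: smooth_on_diff (smooth_on_chr (sDF z) sX) Uy.
rewrite !E (dder_swap v u oU Uy sX) (dder_swap v u oU Uy sF) /curvature.
move: (dder u (dder v X) y) (dchr _ _ _ _ _) (dchr _ _ _ _ _) (chr _ _ _ _)
  (chr _ _ _ _) (chr _ _ _ _) (chr _ _ _ _) (chr _ _ _ _) => *.
by apply/rowP => k; rewrite !mxE; ring.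
Qed.

Lemma smooth_on_scale (f : 'rV[R]_n -> R) X :
  smooth_on U f -> smooth_on U X -> smooth_on U (fun y => f y *: X y).
Proof.
move=> sf /(smooth_on_coord oU) sX; apply/(smooth_on_coord oU) => i j.
have E y : U y -> f y * X y i j = (f y *: X y) i j by move=> _; rewrite [RHS]mxE.
by apply: (smooth_on_eq oU E); exact: smooth_onM.
Qed.

Lemma cov_lincomb (I : finType) (f : I -> 'rV[R]_n -> R)
    (X : I -> 'rV[R]_n -> 'rV[R]_d) v y : U y ->
  (forall i, smooth_on U (f i)) -> (forall i, smooth_on U (X i)) ->
  cov v (fun z => \sum_i f i z *: X i z) y =
  \sum_i (dder v (f i) y *: X i y + f i y *: cov v (X i) y).
Proof.
move=> Uy sf sX; have dX i := smooth_on_diff (sX i) Uy.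
have dfX i := smooth_on_diff (smooth_on_scale (sf i) (sX i)) Uy.
rewrite /cov dder_sum// chr_sumr -big_split; apply: eq_bigr => i _ /=.
rewrite chrZr scalerDr addrA; congr (_ + _); apply/matrixP => k l.
rewrite dder_coord//.
have -> : (fun z => (f i z *: X i z) k l) = (fun z => f i z * X i z k l).
  by apply/funext => x; rewrite mxE.
rewrite dderM; [|exact: smooth_on_diff (sf i) Uy|]; last first.
  by move: k l; apply/differentiable_mxP.
by rewrite !mxE -dder_coord.
Qed.

Lemma push_lincomb a y : U y ->
  \sum_k a y 0 k *: dder (basis_vec k) F y = dder (a y) F y.
Proof. by move=> Uy; rewrite [RHS]dder_basis//; exact: smooth_on_diff sF Uy. Qed.

Lemma smooth_on_push a : smooth_on U a -> smooth_on U (fun z => dder (a z) F z).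
Proof.
move=> sa; apply: (smooth_on_eq oU (@push_lincomb a)).
apply: smooth_on_sum => // k; apply: smooth_on_scale.
  exact: ((smooth_on_coord oU a).1 sa).
exact: smooth_on_dder.
Qed.

Lemma covD X Y v y : U y -> smooth_on U X -> smooth_on U Y ->
  cov v (fun z => X z + Y z) y = cov v X y + cov v Y y.
Proof.
move=> Uy sX sY; rewrite /cov chrDr addrACA; congr (_ + _).
by rewrite dderD//; [exact: smooth_on_diff sX Uy|exact: smooth_on_diff sY Uy].
Qed.

Lemma cov_near X Y v y : U y -> (forall z, U z -> X z = Y z) ->
  cov v X y = cov v Y y.
Proof. by move=> Uy E; rewrite /cov (dder_near v oU Uy E) E. Qed.

Lemma cov_push a v y : U y -> smooth_on U a ->
  cov v (fun z => dder (a z) F z) y =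
  dder (dder v a y) F y + \sum_k a y 0 k *: cov v (dder (basis_vec k) F) y.
Proof.
move=> Uy sa; have sc k : smooth_on U (fun z => a z 0 k).
  exact: ((smooth_on_coord oU a).1 sa).
rewrite -(cov_near v Uy (@push_lincomb a)) cov_lincomb//; last first.
  by move=> k; exact: smooth_on_dder.
rewrite big_split; congr (_ + _).
rewrite -(@push_lincomb (fun z => dder v a z))//; apply: eq_bigr => k _.
by rewrite dder_coord//; exact: smooth_on_diff sa Uy.
Qed.

End CovariantDerivative.

Lemma dder_jacobian (R : realType) (n d : nat) (F : 'rV[R]_n -> 'rV[R]_d) y v :
  differentiable F y -> dder v F y = v *m jacobian F y.
Proof. by move=> dF; rewrite dderE deriveEjacobian. Qed.

Lemma bform_congr (R : realType) (n d : nat) (J : 'M[R]_(n, d)) (A : 'M[R]_d) u v :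
  bform (J *m A *m J^T) u v = bform A (u *m J) (v *m J).
Proof. by rewrite !bform_mulmx trmx_mul !mulmxA. Qed.

(** * Invariance of connection and curvature under a change of coordinates *)

Section ChangeOfCoordinates.
Context {R : realType} {d : nat}.
Context (O : set 'rV[R]_d) (oO : open O) (T : 'rV[R]_d -> 'rV[R]_d).
Context (V : set 'rV[R]_d) (oV : open V) (G H : 'rV[R]_d -> 'M[R]_d).
Hypothesis sT : smooth_on O T.
Hypothesis TOV : forall y, O y -> V (T y).
Hypothesis sG : smooth_on O G.
Hypothesis symG : forall y, O y -> (G y)^T = G y.
Hypothesis unitG : forall y, O y -> G y \in unitmx.
Hypothesis sH : smooth_on V H.
Hypothesis symH : forall y, V y -> (H y)^T = H y.
Hypothesis unitH : forall y, V y -> H y \in unitmx.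
Hypothesis GH : forall y, O y -> G y = induced_metric H T y.

Local Notation cov := (cov T H).

Let dT y : O y -> differentiable T y.
Proof. exact: smooth_on_diff. Qed.

Lemma metric_push y u v : O y ->
  bform (G y) u v = bform (H (T y)) (dder u T y) (dder v T y).
Proof. by move=> Oy; rewrite GH// bform_congr !dder_jacobian//; exact: dT. Qed.

Lemma dder_metric_push y u v w : O y -> bform (dder w G y) u v =
  bform (H (T y)) (cov w (dder u T) y) (dder v T y)
  + bform (H (T y)) (dder u T y) (cov w (dder v T) y).
Proof.
move=> Oy; have sTD z := smooth_on_dder z oO sT.
rewrite -(cov_bform oO oV sT TOV sH symH unitH w Oy (sTD u) (sTD v)).
have E z : O z -> bform (H (T z)) (dder u T z) (dder v T z) = bform (G z) u v.
  by move=> Oz; rewrite metric_push.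
rewrite (dder_near w oO Oy E) dder_bform; last 3 first.
- exact: smooth_on_diff sG Oy.
- exact: differentiable_cst.
- exact: differentiable_cst.
by rewrite !dder_cst bform0l bform0r !addr0.
Qed.

Lemma jacobian_unit y : O y -> jacobian T y \in unitmx.
Proof.
by move=> Oy; have := unitG Oy; rewrite GH// !unitmx_mul => /andP[/andP[]].
Qed.

(** Both sides have the same inner products with all coordinate vectors: Koszul's formula gives
    those of the right side, and expanding its metric derivatives by compatibility in the target
    leaves the left side once torsion freeness is used. *)
Lemma chr_push y u v : O y -> cov u (dder v T) y = dder (chr G y u v) T y.
Proof.
move=> Oy; have uJ := jacobian_unit Oy; have dTy := dT Oy; have VTy := TOV Oy.
(* The Jacobian is invertible, so the left side is the image of some vector, which can be compared
   before pushing forward. *)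
have E : cov u (dder v T) y =
    dder (cov u (dder v T) y *m invmx (jacobian T y)) T y.
  by rewrite dder_jacobian// mulmxKV.
rewrite E; congr (dder _ T y); apply: (bform_inj (unitG Oy)) => i.
rewrite metric_push// -E.
rewrite (metric_chr sG symG unitG u v _ Oy) !dder_metric_push//.
have sw a b := cov_swap oO oV sT TOV symH a b Oy.
have sy a b := bform_sym a b (symH VTy).
rewrite (sw v u) (sw (basis_vec i) u) (sw (basis_vec i) v).
rewrite (sy (dder v T y) (cov u _ _)) (sy (dder u T y)).
rewrite (sy (cov v _ y) (dder u T y)) [in X in _ - X]addrC.
by lra.
Qed.

(** The commutator formula is evaluated along [T], where every covariant derivative of a pushed
    constant field is again a pushed field by [chr_push]. *)
Lemma curvature_push y u v w : O y ->
  curvature H (T y) (dder u T y) (dder v T y) (dder w T y) =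
  dder (curvature G y u v w) T y.
Proof.
move=> Oy; have sTD z := smooth_on_dder z oO sT; have dTy := dT Oy.
rewrite -(cov_comm oO oV sT TOV sH unitH _ _ Oy (sTD w)).
have sC a b : smooth_on O (fun z => chr G z a b).
  apply/(smooth_on_coord oO) => i k; rewrite ord1.
  have E z : O z -> bform (christoffel_mx G k z) a b = chr G z a b 0 k.
    by rewrite chrE.
  apply: (smooth_on_eq oO E); apply: smooth_on_bform => //.
  - exact: smooth_on_christoffel_mx.
  - exact: smooth_on_cst.
  - exact: smooth_on_cst.
have covE a b : cov a (cov b (dder w T)) y =
    dder (dchr G y a b w) T y + dder (chr G y a (chr G y b w)) T y.
  have E z : O z -> cov b (dder w T) z = dder (chr G z b w) T z.
    by move=> Oz; exact: chr_push.
  rewrite (cov_near oO T H a Oy E).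
  rewrite (cov_push oO H sT a Oy (sC b w)); congr (_ + _).
  rewrite {2}[chr G y b w]row_sum_delta chr_sumr dder_jacobian// mulmx_suml.
  apply: eq_bigr => k _.
  by rewrite chr_push// dder_jacobian// chrZr -scalemxAl.
rewrite !covE !dder_jacobian// /curvature mulmxBl mulmxDl mulmxBl.
move: (_ *m _) (_ *m _) (_ *m _) (_ *m _) => *.
by apply/rowP => k; rewrite !mxE; ring.
Qed.

Lemma riemann_coord_push y u v w z : O y ->
  riemann_coord G y u v w z =
  riemann_coord H (T y) (u *m jacobian T y) (v *m jacobian T y)
    (w *m jacobian T y) (z *m jacobian T y).
Proof.
move=> Oy; have dTy := dT Oy.
rewrite !riemann_coordE.
by rewrite -!(dder_jacobian _ dTy) curvature_push// metric_push.
Qed.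

End ChangeOfCoordinates.

(** * The equation of zero mean curvature *)

Section AffineFunctions.
Context {R : realType} {n : nat} (U : set 'rV[R]_n) (oU : open U).

Lemma differentiable_mulmxr d (A : 'M[R]_(n, d)) y :
  differentiable (fun z : 'rV[R]_n => z *m A) y.
Proof.
by apply: (@differentiable_mulmx _ _ _ _ _ id (fun=> A)) => //;
  exact: differentiable_cst.
Qed.

Lemma dder_mulmxr d (A : 'M[R]_(n, d)) y v :
  dder v (fun z : 'rV[R]_n => z *m A) y = v *m A.
Proof.
have did : differentiable (id : 'rV[R]_n -> 'rV[R]_n) y by [].
have dA : differentiable (fun=> A) y by exact: differentiable_cst.
rewrite dderE (derive_mulmx v did dA).
by rewrite derive_id derive_cst mulmx0 addr0.
Qed.

Lemma smooth_on_mulmxr d (A : 'M[R]_(n, d)) : smooth_on U (fun z => z *m A).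
Proof.
apply/smooth_uptoP => -[|k].
  by apply/smooth_upto0 => y _; exact: differentiable_mulmxr.
apply/smooth_uptoS; split=> [y _|i]; first exact: differentiable_mulmxr.
apply: (smooth_upto_eq oU _ (smooth_upto_cst (basis_vec i *m A) oU)) => y _.
by rewrite pderiveE dder_mulmxr.
Qed.

(** Differentiate the product of the inverse with [M]; at [x] both factors are the identity. *)
Lemma dder_invmx m (M : 'rV[R]_n -> 'M[R]_m) x v : U x -> smooth_on U M ->
  (forall y, U y -> M y \in unitmx) -> M x = 1%:M ->
  dder v (fun y => invmx (M y)) x = - dder v M x.
Proof.
move=> Ux sM uM M1; have dM := smooth_on_diff sM Ux.
have dV := smooth_on_diff (smooth_on_invmx oU uM sM) Ux.
have : dder v (fun y => invmx (M y) *m M y) x = 0.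
  rewrite -(dder_cst (1%:M : 'M[R]_m) v x); apply: (dder_near _ oU Ux).
  by move=> y Uy; rewrite mulVmx// uM.
rewrite (dder_mulmx v dV dM) M1 invmx1 mulmx1 mul1mx => /eqP.
by rewrite addr_eq0 => /eqP.
Qed.

End AffineFunctions.

Section MinimalImmersion.
Context {R : realType} {n d : nat}.
Context (U : set 'rV[R]_n) (oU : open U) (F : 'rV[R]_n -> 'rV[R]_d).
Context (V : set 'rV[R]_d) (oV : open V) (G : 'rV[R]_d -> 'M[R]_d).
Hypothesis sF : smooth_on U F.
Hypothesis FUV : forall y, U y -> V (F y).
Hypothesis sG : smooth_on V G.
Hypothesis symG : forall y, V y -> (G y)^T = G y.
Hypothesis unitG : forall y, V y -> G y \in unitmx.
Hypothesis unitg : forall y, U y -> induced_metric G F y \in unitmx.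
Hypothesis minF : forall y, U y -> trace_second_fundamental_form G F y = 0.

Local Notation g := (induced_metric G F).
Local Notation cov := (cov F G).
Local Notation ee := (@basis_vec R n).

Let sDF w : smooth_on U (dder w F).
Proof. exact: smooth_on_dder. Qed.

Lemma induced_metricE y u v : U y ->
  bform (g y) u v = bform (G (F y)) (dder u F y) (dder v F y).
Proof.
move=> Uy; have dF := smooth_on_diff sF Uy.
by rewrite bform_congr !dder_jacobian.
Qed.

Lemma smooth_on_induced_metric : smooth_on U g.
Proof.
apply/(smooth_on_coord oU) => i j.
have E y : U y -> bform (G (F y)) (dder (ee i) F y) (dder (ee j) F y) = g y i j.
  by move=> Uy; rewrite -induced_metricE// bform_delta.
apply: (smooth_on_eq oU E); apply: smooth_on_bform => //.
exact: (smooth_on_comp_mx oU oV).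
Qed.

Context (x0 : 'rV[R]_n) (Ux : U x0) (gx0 : g x0 = 1%:M) (l0 : 'I_n).
Local Notation p := (fun l => dder (ee l) F x0).

(** Here [h] is the inverse induced metric and [a] the trace of its Christoffel symbols. Vanishing
    trace of the second fundamental form says that the traced ambient derivative is purely the
    intrinsic one. The derivatives of [h] at [x0] are expressed through [cov], so that later steps
    need not return to the induced metric. *)
Lemma minimal_tension : exists (h : 'rV[R]_n -> 'M[R]_n) (a : 'rV[R]_n -> 'rV[R]_n),
  [/\ smooth_on U h, smooth_on U a, h x0 = 1%:M,
    forall v i j, dder v (fun y => h y i j) x0 =
      - (bform (G (F x0)) (cov v (dder (ee i) F) x0) (p j)
         + bform (G (F x0)) (p i) (cov v (dder (ee j) F) x0)) &
    forall y, U y -> \sum_i \sum_j h y i j *: cov (ee i) (dder (ee j) F) y =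
      dder (a y) F y].
Proof.
have sg := smooth_on_induced_metric.
exists (fun y => invmx (g y)),
  (fun y => \sum_i \sum_j invmx (g y) i j *: chr g y (ee i) (ee j)).
split; [exact: smooth_on_invmx| | |move=> v i j|].
- apply: smooth_on_sum => // i; apply: smooth_on_sum => // j.
  apply: smooth_on_scale => //.
    exact: ((smooth_on_coord oU _).1 (smooth_on_invmx oU unitg smooth_on_induced_metric)).
  apply/(smooth_on_coord oU) => k l; rewrite ord1.
  have E y : U y -> christoffel g y l i j = chr g y (ee i) (ee j) 0 l.
    by move=> _; rewrite chrE bform_delta mxE.
  by apply: (smooth_on_eq oU E); apply: smooth_on_christoffel.
- by rewrite gx0 invmx1.
- have dV := smooth_on_diff (smooth_on_invmx oU unitg sg) Ux.
  rewrite -(dder_coord v i j dV) (dder_invmx oU v Ux sg unitg gx0) [LHS]mxE.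
  congr (- _); rewrite (dder_coord v i j (smooth_on_diff sg Ux)).
  have Eg y : U y -> g y i j = bform (G (F y)) (dder (ee i) F y) (dder (ee j) F y).
    by move=> Uy; rewrite -induced_metricE// bform_delta.
  rewrite (dder_near v oU Ux Eg).
  exact: (cov_bform oU oV sF FUV sG symG unitG v Ux (sDF (ee i)) (sDF (ee j))).
(* Term by term, the difference of the two sides is the trace of the second fundamental form. *)
- move=> y Uy; have dF := smooth_on_diff sF Uy; apply/eqP; rewrite -subr_eq0.
apply/eqP; rewrite -[RHS](minF Uy) /trace_second_fundamental_form.
rewrite dder_jacobian// mulmx_suml -sumrB; apply: eq_bigr => i _.
rewrite mulmx_suml -sumrB; apply: eq_bigr => j _.
rewrite -scalemxAl -scalerBr; congr (_ *: (_ - _)).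
  rewrite /levi_civita_along /cov !dderE chr_christoffel_app.
  by congr (_ + _); rewrite dder_funE.
by rewrite -dder_jacobian// dderE /levi_civita derive_cst add0r chr_christoffel_app.
Qed.

(* The field [W] extends [p l0] so that its covariant derivatives at [x0] are
   normal: the linear part of [E] cancels their tangential components. *)
Lemma adapted_field : exists (E : 'rV[R]_n -> 'rV[R]_n) (a c : 'rV[R]_n),
  let W y := dder (E y) F y in
  let nu l := cov (ee l) W x0 in
  [/\ smooth_on U E, E x0 = (ee l0),
    forall l k, bform (G (F x0)) (nu l) (p k) = 0,
    \sum_l cov (ee l) (dder (ee l) F) x0 = dder a F x0 &
    \sum_l cov (ee l) (cov (ee l) W) x0 = dder c F x0 + \sum_k a 0 k *: nu k
      + \sum_l curvature G (F x0) (p l) (p l0) (p l)].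
Proof.
have dF := smooth_on_diff sF Ux; have [h [a [sh' sa hx0 dh' Ea]]] := minimal_tension.
pose C v w := cov v (dder w F).
have sC v w : smooth_on U (C v w).
  exact: (smooth_on_cov oU oV sF FUV sG unitG v (sDF w)).
have Csw u v y : U y -> C u v y = C v u y.
  exact: (cov_swap oU oV sF FUV symG u v).
pose B := \matrix_(l, k) - bform (G (F x0)) (C (ee l) (ee l0) x0) (p k).
pose E y := (ee l0) + (y - x0) *m B.
have sE : smooth_on U E.
  apply: (smooth_on_eq oU (f := fun y => ((ee l0) - x0 *m B) + y *m B)).
    by move=> y _; rewrite /E mulmxBl addrA addrAC.
  by apply: smooth_onD => //; [exact: smooth_on_cst|exact: smooth_on_mulmxr].
have Ex0 : E x0 = (ee l0) by rewrite /E subrr mul0mx addr0.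
have dE v y : dder v E y = v *m B.
  have -> : E = fun y => ((ee l0) - x0 *m B) + y *m B.
    by apply/funext => z; rewrite /E mulmxBl addrA addrAC.
  rewrite dderD; [|exact: differentiable_cst|exact: differentiable_mulmxr].
  by rewrite dder_cst add0r dder_mulmxr.
pose W y := dder (E y) F y.
have sW : smooth_on U W by exact: smooth_on_push.
have covW v y : U y -> cov v W y = \sum_k ((v *m B) 0 k *: dder (ee k) F y
    + E y 0 k *: C v (ee k) y).
  move=> Uy; rewrite /W (cov_push oU G sF v Uy sE) dE big_split; congr (_ + _).
  by rewrite [LHS]dder_basis//; exact: smooth_on_diff sF Uy.
have sum_e (T : 'I_n -> 'rV[R]_d) : \sum_k (ee l0) 0 k *: T k = T l0.
  rewrite (bigD1 l0)//= big1 ?addr0 ?mxE ?eqxx ?scale1r// => k /negbTE kl.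
  by rewrite mxE eqxx kl scale0r.
have nuE l : cov (ee l) W x0 = dder ((ee l) *m B) F x0 + C (ee l) (ee l0) x0.
  by rewrite covW// big_split -dder_basis// Ex0 sum_e.
have rowB l k : ((ee l) *m B) 0 k = B l k by rewrite /basis_vec -rowE mxE.
have gp i j : bform (G (F x0)) (p i) (p j) = (i == j)%:R.
  by rewrite -induced_metricE// gx0 bform_delta mxE.
(* The tangent vector [c] has two sources: differentiating the coefficients of [dder (a y) F y]
   along [ee l0], and replacing [cov (ee l0) (dder (ee k) F)] by [nu k], which differs from it by
   the tangential correction stored in [B]. *)
exists E, (a x0), (dder (ee l0) a x0 - a x0 *m B) => W' nu.
have HW : W' = W by [].
have normal l k : bform (G (F x0)) (nu l) (p k) = 0.
  rewrite /nu HW nuE bformDl (dder_basis _ dF) bform_suml (bigD1 k)//= big1.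
    by rewrite bformZl gp eqxx mulr1 addr0 rowB mxE addNr.
  by move=> j /negbTE jk; rewrite bformZl gp jk mulr0.
have sumd (T : 'I_n -> 'I_n -> 'rV[R]_d) :
    \sum_i \sum_j (1%:M : 'M[R]_n) i j *: T i j = \sum_i T i i.
  apply: eq_bigr => i _; rewrite (bigD1 i)//= big1 ?addr0 ?mxE ?eqxx ?scale1r//.
  by move=> j /negbTE ji; rewrite mxE eq_sym ji scale0r.
split=> //; first by rewrite -Ea// hx0 sumd.
rewrite HW.
(* Since [E] is affine, its second derivatives do not occur; the product rule produces the cross
   term twice. *)
have second l : cov (ee l) (cov (ee l) W) x0 =
    2 *: (\sum_k B l k *: C (ee l) (ee k) x0) + cov (ee l) (C (ee l) (ee l0)) x0.
  rewrite (cov_near oU F G (ee l) Ux (covW (ee l))).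
  rewrite (cov_near oU F G (ee l) Ux (Y := fun y =>
    \sum_k ((ee l) *m B) 0 k *: dder (ee k) F y + \sum_k E y 0 k *: C (ee l) (ee k) y));
    last by move=> z _; rewrite big_split.
  have sEk k : smooth_on U (fun z => E z 0 k) := (smooth_on_coord oU E).1 sE 0 k.
  have sBk k : smooth_on U (fun=> ((ee l) *m B) 0 k) by exact: smooth_on_cst.
  rewrite (covD F G (ee l) Ux); last 2 first.
  - by apply: smooth_on_sum => // k; exact: smooth_on_scale.
  - by apply: smooth_on_sum => // k; exact: smooth_on_scale.
  rewrite (cov_lincomb oU F G (ee l) Ux sBk (fun k => sDF (ee k))).
  rewrite (cov_lincomb oU F G (ee l) Ux sEk (fun k => sC (ee l) (ee k))).
  rewrite [X in _ + X]big_split Ex0 sum_e addrA; congr (_ + _).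
  rewrite scaler_nat mulr2n; congr (_ + _); apply: eq_bigr => k _.
    by rewrite dder_cst scale0r add0r rowB.
  by rewrite -dder_coord ?dE ?rowB//; exact: smooth_on_diff sE Ux.
under eq_bigr do rewrite second.
rewrite big_split -scaler_sumr /=.
(* Symmetry of [C] and then commutation of the covariant derivatives bring the derivative along
   [ee l0] outside, in front of the diagonal terms [C (ee l) (ee l)], whose trace the equation of
   zero mean curvature knows. *)
have flip l : cov (ee l) (C (ee l) (ee l0)) x0 =
    cov (ee l0) (C (ee l) (ee l)) x0 + curvature G (F x0) (p l) (p l0) (p l).
  rewrite -(cov_comm oU oV sF FUV sG unitG (ee l) (ee l0) Ux (sDF (ee l))) addrC.
  by rewrite subrK; apply: (cov_near oU) => // y Uy; exact: Csw.
under [X in _ + X = _]eq_bigr do rewrite flip.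
rewrite big_split addrA; congr (_ + _).
have sh ij : smooth_on U (fun y => h y ij.1 ij.2).
  exact: ((smooth_on_coord oU h).1 sh').
(* The equation of zero mean curvature, differentiated along [ee l0]. *)
have Dmin : cov (ee l0) (fun y => \sum_(ij : 'I_n * 'I_n)
    h y ij.1 ij.2 *: C (ee ij.1) (ee ij.2) y) x0 =
    cov (ee l0) (fun y => dder (a y) F y) x0.
  apply: (cov_near oU) => // y Uy; rewrite -Ea//.
  by rewrite (pair_bigA _ (fun i j => h y i j *: C (ee i) (ee j) y)).
have dh i j : dder (ee l0) (fun y => h y i j) x0 = B i j + B j i.
  rewrite dh' [B i j]mxE [B j i]mxE -opprD.
  congr (- (bform _ _ _ + _)); first exact: (Csw (ee l0) (ee i) _ Ux).
  rewrite bform_sym ?symG//; last exact: FUV.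
  by congr (bform _ _ _); exact: (Csw (ee l0) (ee j) _ Ux).
rewrite (cov_lincomb oU F G (ee l0) Ux sh (fun ij => sC (ee ij.1) (ee ij.2))) in Dmin.
rewrite (cov_push oU G sF (ee l0) Ux sa) in Dmin.
rewrite big_split in Dmin.
(* The variation of the inverse metric gives exactly the cross terms of [second]; the same [B]
   governs both because it records the tangential part of the second derivatives of [F]. *)
have S1 : \sum_(ij : 'I_n * 'I_n)
    dder (ee l0) (fun y => h y ij.1 ij.2) x0 *: C (ee ij.1) (ee ij.2) x0 =
    2 *: \sum_i \sum_j B i j *: C (ee i) (ee j) x0.
  under eq_bigr do rewrite dh.
  rewrite -(pair_bigA _ (fun i j => (B i j + B j i) *: C (ee i) (ee j) x0)) /=.
  under eq_bigr do under eq_bigr do rewrite scalerDl.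
  under eq_bigr do rewrite big_split.
  rewrite big_split scaler_nat mulr2n; congr (_ + _) => /=.
  rewrite exchange_big; apply: eq_bigr => i _; apply: eq_bigr => j _.
  by rewrite Csw.
have S2 : \sum_(ij : 'I_n * 'I_n)
    h x0 ij.1 ij.2 *: cov (ee l0) (C (ee ij.1) (ee ij.2)) x0 =
    \sum_i cov (ee l0) (C (ee i) (ee i)) x0.
  rewrite hx0 -(pair_bigA _ (fun i j => (1%:M : 'M[R]_n) i j *:
    cov (ee l0) (C (ee i) (ee j)) x0)) /=.
  exact: sumd.
rewrite /= S1 S2 in Dmin; rewrite /= Dmin.
have S3 : \sum_k a x0 0 k *: nu k = dder (a x0 *m B) F x0
    + \sum_k a x0 0 k *: cov (ee l0) (dder (ee k) F) x0.
  rewrite /nu HW; under eq_bigr do rewrite nuE scalerDr.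
  rewrite big_split; congr (_ + _).
    rewrite dder_jacobian// [in RHS](row_sum_delta (a x0)) !mulmx_suml.
    by apply: eq_bigr => k _; rewrite dder_jacobian// -!scalemxAl.
  by apply: eq_bigr => k _; rewrite Csw.
rewrite S3 addrA; congr (_ + _).
by rewrite !(dder_jacobian _ dF) mulmxBl subrK.
Qed.

End MinimalImmersion.

(** * The maximum principle *)

Section Bochner.
Context {R : realType} {n d : nat}.
Context (U : set 'rV[R]_n) (oU : open U) (F : 'rV[R]_n -> 'rV[R]_d).
Context (V : set 'rV[R]_d) (oV : open V) (G : 'rV[R]_d -> 'M[R]_d).
Hypothesis sF : smooth_on U F.
Hypothesis FUV : forall y, U y -> V (F y).
Hypothesis sG : smooth_on V G.
Hypothesis symG : forall y, V y -> (G y)^T = G y.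
Hypothesis unitG : forall y, V y -> G y \in unitmx.
Local Notation cov := (cov F G).
Local Notation ee := (@basis_vec R n).

Definition hess (f : 'rV[R]_d -> R) (z u v : 'rV[R]_d) : R :=
  \sum_c u 0 c * dder v (dder (basis_vec c) f) z.

Definition hess_mx (A : 'rV[R]_d -> 'M[R]_d) (z u v : 'rV[R]_d) : 'M[R]_d :=
  \matrix_(i, j) hess (fun y => A y i j) z u v.

Lemma dder_dder_comp (f : 'rV[R]_d -> R) (X : 'rV[R]_n -> 'rV[R]_d) v y : U y ->
  smooth_on V f -> smooth_on U X ->
  dder v (fun z => dder (X z) f (F z)) y =
  dder (dder v X y) f (F y) + hess f (F y) (X y) (dder v F y).
Proof.
move=> Uy sf sX; have Vy := FUV Uy.
have sfc c := smooth_on_dder (basis_vec c) oV sf.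
have dXc c : differentiable (fun z => X z 0 c) y.
  exact: ((differentiable_mxP X y).1 (smooth_on_diff sX Uy)).
have dfc c : differentiable (fun z => dder (basis_vec c) f (F z)) y.
  apply: (@differentiable_comp _ _ _ _ F (dder (basis_vec c) f)).
    exact: smooth_on_diff sF Uy.
  exact: smooth_on_diff (sfc c) Vy.
have E z : U z -> dder (X z) f (F z) =
    \sum_c X z 0 c * dder (basis_vec c) f (F z).
  by move=> Uz; rewrite dder_basis//; exact: smooth_on_diff sf (FUV Uz).
rewrite (dder_near v oU Uy E) dder_sum; last first.
  by move=> c; exact: differentiableM.
rewrite [X in _ = X + _](dder_basis _ (smooth_on_diff sf Vy)) -big_split.
apply: eq_bigr => c _ /=; rewrite dderM//; congr (_ * _ + _ * _).
  by rewrite dder_coord//; exact: smooth_on_diff sX Uy.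
rewrite dder_comp//; first exact: smooth_on_diff sF Uy.
exact: smooth_on_diff (sfc c) Vy.
Qed.

Lemma smooth_on_dder_comp (A : 'rV[R]_d -> 'M[R]_d) (X : 'rV[R]_n -> 'rV[R]_d) :
  smooth_on V A -> smooth_on U X -> smooth_on U (fun z => dder (X z) A (F z)).
Proof.
move=> sA sX; have E z : U z -> \sum_c X z 0 c *: dder (basis_vec c) A (F z) =
    dder (X z) A (F z).
  by move=> Uz; rewrite [RHS]dder_basis//; exact: smooth_on_diff sA (FUV Uz).
apply: (smooth_on_eq oU E); apply: smooth_on_sum => // c.
have sAc := smooth_on_comp_mx oU oV sF FUV (smooth_on_dder (basis_vec c) oV sA).
apply/(smooth_on_coord oU) => i j.
have E2 z : U z -> X z 0 c * dder (basis_vec c) A (F z) i j =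
    (X z 0 c *: dder (basis_vec c) A (F z)) i j by move=> _; rewrite [RHS]mxE.
apply: (smooth_on_eq oU E2); apply: smooth_onM => //.
  exact: ((smooth_on_coord oU X).1 sX).
exact: ((smooth_on_coord oU _).1 sAc).
Qed.

Lemma dder_dder_comp_mx (A : 'rV[R]_d -> 'M[R]_d) (X : 'rV[R]_n -> 'rV[R]_d) v y :
  U y -> smooth_on V A -> smooth_on U X ->
  dder v (fun z => dder (X z) A (F z)) y =
  dder (dder v X y) A (F y) + hess_mx A (F y) (X y) (dder v F y).
Proof.
move=> Uy sA sX; apply/matrixP => i j.
have sAc : smooth_on V (fun z => A z i j) by exact: ((smooth_on_coord oV A).1 sA).
rewrite dder_coord; last exact: smooth_on_diff (smooth_on_dder_comp sA sX) Uy.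
have E z : U z -> dder (X z) A (F z) i j = dder (X z) (fun x => A x i j) (F z).
  by move=> Uz; rewrite dder_coord//; exact: smooth_on_diff sA (FUV Uz).
rewrite (dder_near v oU Uy E) dder_dder_comp// [RHS]mxE [in RHS]mxE.
by rewrite dder_coord//; exact: smooth_on_diff sA (FUV Uy).
Qed.

(** Plain derivatives are used here, because a general [A] is not parallel and its own first and
    second derivatives appear in any case. *)
Lemma dder2_bform (A : 'rV[R]_d -> 'M[R]_d) (W : 'rV[R]_n -> 'rV[R]_d) v y :
  U y -> smooth_on V A -> (forall z, V z -> (A z)^T = A z) -> smooth_on U W ->
  dder v (fun z => bform (A (F z)) (W z) (W z)) y =
    bform (dder (dder v F y) A (F y)) (W y) (W y)
    + 2 * bform (A (F y)) (dder v W y) (W y) /\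
  dder v (dder v (fun z => bform (A (F z)) (W z) (W z))) y =
    bform (hess_mx A (F y) (dder v F y) (dder v F y)) (W y) (W y)
    + bform (dder (dder v (dder v F) y) A (F y)) (W y) (W y)
    + 4 * bform (dder (dder v F y) A (F y)) (dder v W y) (W y)
    + 2 * bform (A (F y)) (dder v W y) (dder v W y)
    + 2 * bform (A (F y)) (dder v (dder v W) y) (W y).
Proof.
move=> Uy sA symA sW; have Vy := FUV Uy.
have sAF := smooth_on_comp_mx oU oV sF FUV sA.
have sDW := smooth_on_dder v oU sW; have sDF := smooth_on_dder v oU sF.
have sDA := smooth_on_dder_comp sA sDF.
have E z : U z -> dder v (fun z => bform (A (F z)) (W z) (W z)) z =
    bform (dder (dder v F z) A (F z)) (W z) (W z)
    + 2 * bform (A (F z)) (dder v W z) (W z).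
  move=> Uz; have dW := smooth_on_diff sW Uz.
  rewrite dder_bform//; last exact: smooth_on_diff sAF Uz.
  rewrite (dder_comp v (smooth_on_diff sF Uz) (smooth_on_diff sA (FUV Uz))).
  rewrite -addrA; congr (_ + _).
  rewrite (bform_sym (W z) _ (symA _ (FUV Uz))) mulr_natl mulr2n //.
split; first exact: E.
rewrite (dder_near v oU Uy E); have dW := smooth_on_diff sW Uy.
have dDW := smooth_on_diff sDW Uy; have dDA := smooth_on_diff sDA Uy.
have dAF := smooth_on_diff sAF Uy.
rewrite dderD; [|exact: differentiable_bform| ]; last first.
  apply: differentiableM; first exact: differentiable_cst.
  exact: differentiable_bform.
rewrite dderM; [|exact: differentiable_cst|exact: differentiable_bform].
rewrite dder_cst mul0r add0r !dder_bform//.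
rewrite (dder_comp v (smooth_on_diff sF Uy) (smooth_on_diff sA Vy)).
rewrite (dder_dder_comp_mx v Uy sA sDF) bformDm.
have sym1 := dder_metric_sym oV sA symA (dder v F y) Vy.
rewrite (bform_sym (W y) _ sym1).
move: (bform _ _ _) (bform _ _ _) (bform _ _ _) (bform _ _ _) (bform _ _ _) => *.
by ring.
Qed.

(** The metric is parallel, so with covariant derivatives no derivative of its coefficients
    remains. *)
Lemma dder2_bform_cov (W : 'rV[R]_n -> 'rV[R]_d) v y :
  U y -> smooth_on U W ->
  dder v (fun z => bform (G (F z)) (W z) (W z)) y =
    2 * bform (G (F y)) (cov v W y) (W y) /\
  dder v (dder v (fun z => bform (G (F z)) (W z) (W z))) y =
    2 * bform (G (F y)) (cov v W y) (cov v W y)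
    + 2 * bform (G (F y)) (cov v (cov v W) y) (W y).
Proof.
move=> Uy sW; have Vy := FUV Uy.
have scW := smooth_on_cov oU oV sF FUV sG unitG v sW.
have sGF := smooth_on_comp_mx oU oV sF FUV sG.
have E z : U z -> dder v (fun z => bform (G (F z)) (W z) (W z)) z =
    2 * bform (G (F z)) (cov v W z) (W z).
  move=> Uz; rewrite (cov_bform oU oV sF FUV sG symG unitG v Uz sW sW).
  by rewrite (bform_sym (W z) _ (symG (FUV Uz))) mulr_natl mulr2n.
split; first exact: E.
rewrite (dder_near v oU Uy E) dderM; last 2 first.
- exact: differentiable_cst.
- exact: smooth_on_diff (smooth_on_bform oU sGF scW sW) Uy.
rewrite dder_cst mul0r add0r (cov_bform oU oV sF FUV sG symG unitG v Uy scW sW).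
by rewrite mulrDr addrC.
Qed.

(** Links the covariant second derivative of [W], which [adapted_field] controls, to the plain one
    in [dder2_bform]. *)
Lemma cov2E (W : 'rV[R]_n -> 'rV[R]_d) v y : U y -> smooth_on U W ->
  cov v (cov v W) y = dder v (dder v W) y
    + dchr G (F y) (dder v F y) (dder v F y) (W y)
    + chr G (F y) (dder v (dder v F) y) (W y)
    + chr G (F y) (dder v F y) (dder v W y)
    + chr G (F y) (dder v F y) (cov v W y).
Proof.
move=> Uy sW; have sDW := smooth_on_dder v oU sW.
have sDF := smooth_on_dder v oU sF.
rewrite {1}/cov; congr (_ + _).
rewrite {1}/cov dderD; last 2 first.
- exact: smooth_on_diff sDW Uy.
- exact: smooth_on_diff (smooth_on_chr oU oV sF FUV sG unitG sDF sW) Uy.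
by rewrite (dder_chr oU oV sF FUV sG unitG v Uy sDF sW) !addrA.
Qed.

End Bochner.

Section MaximumPrinciple.
Context {R : realType} {n : nat} (U : set 'rV[R]_n) (oU : open U).

Lemma differentiable_pow (f : 'rV[R]_n -> R) k y : differentiable f y ->
  differentiable (fun z => f z ^+ k) y.
Proof.
move=> df; elim: k => [|k IH].
  by rewrite (_ : (fun _ => _) = cst 1); [exact: differentiable_cst|].
rewrite (_ : (fun _ => _) = (fun z => f z * f z ^+ k)).
  exact: differentiableM.
by apply/funext => z; rewrite exprS.
Qed.

(** For [k = 0] the truncated exponent [k.-1] is multiplied by zero. *)
Lemma dderX (f : 'rV[R]_n -> R) k v y : differentiable f y ->
  dder v (fun z => f z ^+ k) y = k%:R * f y ^+ k.-1 * dder v f y.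
Proof.
move=> df; elim: k => [|k IH].
  by rewrite (_ : (fun _ => _) = (fun=> 1)) ?dder_cst ?mul0r.
rewrite (_ : (fun _ => _) = (fun z => f z * f z ^+ k)); last first.
  by apply/funext => z; rewrite exprS.
rewrite dderM//; last exact: differentiable_pow.
rewrite IH -[k.+1%:R]natr1; case: k {IH} => [|k] /=; first by rewrite !expr0; ring.
by rewrite exprS; ring.
Qed.

(** The difference of the two sides of the assumed inequality has its maximum, zero, at [x]. The
    first order condition eliminates the derivative of [f] from the cross term of the second order
    one; the coefficient of the squared derivative of [P] becomes $2k^2-k(k-1)=k(k+1)$. *)
Lemma max_test_product (P f h : 'rV[R]_n -> R) (k : nat) (x v : 'rV[R]_n) : U x ->
  smooth_on U P -> smooth_on U f -> smooth_on U h -> 0 < P x -> h x = 1 ->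
  dder v h x = 0 ->
  (forall y, U y -> P y ^+ k * f y <= P x ^+ k * f x * h y) ->
  P x * dder v f x = - k%:R * f x * dder v P x /\
  P x ^+ 2 * (dder v (dder v f) x - f x * dder v (dder v h) x) <=
  f x * (k%:R * (k%:R + 1) * dder v P x ^+ 2 - k%:R * P x * dder v (dder v P) x).
Proof.
move=> Ux sP sf sh P0 hx hv fmax.
have sPk j : smooth_on U (fun y => P y ^+ j) by exact: smooth_onX.
have [dP dP1] : (forall y, U y -> differentiable P y) /\
    differentiable (dder v P) x.
  by split=> [y|]; [exact: smooth_on_diff|exact: smooth_on_diff (smooth_on_dder v oU sP) Ux].
have [df df1] : (forall y, U y -> differentiable f y) /\
    differentiable (dder v f) x.
  by split=> [y|]; [exact: smooth_on_diff|exact: smooth_on_diff (smooth_on_dder v oU sf) Ux].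
have [dh dh1] : (forall y, U y -> differentiable h y) /\
    differentiable (dder v h) x.
  by split=> [y|]; [exact: smooth_on_diff|exact: smooth_on_diff (smooth_on_dder v oU sh) Ux].
pose L := P x ^+ k * f x; pose psi y := P y ^+ k * f y - L * h y.
have spsi : smooth_on U psi.
  apply: smooth_onB => //; first exact: smooth_onM.
  by apply: smooth_onM => //; exact: smooth_on_cst.
have psimax y : U y -> psi y <= psi x.
  by move=> Uy; rewrite {2}/psi hx mulr1 subrr subr_le0; exact: fmax.
have [D1 D2] := dder_max_test v oU Ux spsi psimax.
have E y : U y -> dder v psi y = k%:R * P y ^+ k.-1 * dder v P y * f y
    + P y ^+ k * dder v f y - L * dder v h y.
  move=> Uy; have dPk := smooth_on_diff (sPk k) Uy.
  rewrite /psi dderB; [|exact: differentiableM dPk (df _ Uy)| ]; last first.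
    by apply: differentiableM; [exact: differentiable_cst|exact: dh].
  rewrite (dderM v dPk (df _ Uy)) (dderM v (differentiable_cst L y) (dh _ Uy)).
  by rewrite dder_cst mul0r add0r (dderX k v (dP _ Uy)).
rewrite (dder_near v oU Ux E) in D2; rewrite E// hv mulr0 subr0 in D1.
have dPj j : differentiable (fun y => P y ^+ j) x by exact: smooth_on_diff (sPk j) Ux.
have dc c : differentiable (fun=> c : R) x by exact: differentiable_cst.
have d1 : differentiable (fun y => k%:R * P y ^+ k.-1) x.
  exact: differentiableM.
have d2 : differentiable (fun y => k%:R * P y ^+ k.-1 * dder v P y) x.
  exact: differentiableM.
have d3 : differentiable (fun y => k%:R * P y ^+ k.-1 * dder v P y * f y) x.
  exact: differentiableM d2 (df _ Ux).
have d4 : differentiable (fun y => P y ^+ k * dder v f y) x.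
  exact: differentiableM.
have d34 : differentiable (fun y => k%:R * P y ^+ k.-1 * dder v P y * f y
    + P y ^+ k * dder v f y) x by exact: differentiableD.
have d5 : differentiable (fun y => L * dder v h y) x by exact: differentiableM.
rewrite (dderB v d34 d5) (dderD v d3 d4) (dderM v d2 (df _ Ux)) in D2.
rewrite (dderM v d1 dP1) (dderM v (dc _) (dPj k.-1)) in D2.
rewrite (dderM v (dPj k) df1) (dderM v (dc L) dh1) in D2.
rewrite !dder_cst !mul0r !add0r !(dderX _ v (dP _ Ux)) in D2.
have Pk0 : 0 < P x ^+ k by rewrite exprn_gt0.
move: (dder v P x) (dder v f x) (dder v (dder v f) x) (dder v (dder v P) x)
  (dder v (dder v h) x) D1 D2 => Pv fv fvv Pvv hvv.
rewrite /L; move: (P x) (f x) P0 Pk0 => X s X0 Xk0 D1 D2.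
(* Both identities also hold for [k < 2], where the truncated exponents come with a zero
   coefficient. *)
have e1 : k%:R * X ^+ k.-1 * X = k%:R * X ^+ k.
  by case: (k) => [|j]; rewrite ?mul0r//= -mulrA -exprSr.
have e2 : k%:R * (k.-1%:R * X ^+ k.-2) * X ^+ 2 = k%:R * (k%:R - 1) * X ^+ k.
  case: (k) => [|[|j]]; rewrite ?mul0r ?mulr0//= ?subrr ?mulr0 ?mul0r//.
  by rewrite -[j.+2%:R]natr1 addrK !exprSr; ring.
have E1 : X * fv = - k%:R * s * Pv.
  apply: (mulfI (lt0r_neq0 Xk0)).
  have : (k%:R * X ^+ k.-1 * X) * (Pv * s) + X ^+ k * (X * fv) = 0.
    by rewrite -[RHS](mulr0 X) -[in RHS]D1; ring.
  rewrite e1 => /eqP; rewrite addrC addr_eq0 => /eqP ->; by ring.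
split=> //; rewrite -(ler_pM2l Xk0) -subr_le0.
have : X ^+ 2 * (k%:R * (k.-1%:R * X ^+ k.-2 * Pv) * Pv + k%:R * X ^+ k.-1 * Pvv) * s
   + X ^+ 2 * (2 * k%:R * X ^+ k.-1 * Pv * fv) + X ^+ 2 * X ^+ k * fvv
   - X ^+ 2 * X ^+ k * s * hvv <= 0.
  have := ler_wpM2l (sqr_ge0 X) D2; rewrite mulr0; apply: le_trans.
  by rewrite le_eqVlt; apply/orP; left; apply/eqP; ring.
apply: le_trans; rewrite le_eqVlt; apply/orP; left; apply/eqP.
transitivity (k%:R * (k%:R - 1) * X ^+ k * Pv ^+ 2 * s
  + (k%:R * X ^+ k) * X * Pvv * s + 2 * (k%:R * X ^+ k) * Pv * (X * fv)
  + X ^+ 2 * X ^+ k * fvv - X ^+ 2 * X ^+ k * s * hvv).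
  by rewrite E1; ring.
by rewrite -e2 -e1; ring.
Qed.

End MaximumPrinciple.

(** * The differential inequality at the maximum point *)

Section BochnerInequality.
Context {R : realType} {n d : nat}.
Context (U : set 'rV[R]_n) (oU : open U) (F : 'rV[R]_n -> 'rV[R]_d).
Context (V : set 'rV[R]_d) (oV : open V) (G S : 'rV[R]_d -> 'M[R]_d).
Context (phi : 'rV[R]_d -> R).
Hypothesis sF : smooth_on U F.
Hypothesis FUV : forall y, U y -> V (F y).
Hypothesis sG : smooth_on V G.
Hypothesis symG : forall y, V y -> (G y)^T = G y.
Hypothesis unitG : forall y, V y -> G y \in unitmx.
Hypothesis unitg : forall y, U y -> induced_metric G F y \in unitmx.
Hypothesis minF : forall y, U y -> trace_second_fundamental_form G F y = 0.
Hypothesis sS : smooth_on V S.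
Hypothesis symS : forall y, V y -> (S y)^T = S y.
Hypothesis sphi : smooth_on V phi.
Context (x0 : 'rV[R]_n) (Ux : U x0) (k : nat) (l0 : 'I_n).
Hypothesis gx0 : induced_metric G F x0 = 1%:M.

Local Notation z0 := (F x0).
Local Notation p := (fun l => dder (basis_vec l) F x0).
Local Notation chr := (chr G z0).
Local Notation curv := (curvature G z0).

Hypothesis phi0 : 0 < phi z0.
Hypothesis orthS : forall l, l != l0 -> bform (S z0) (p l) (p l0) = 0.
Local Notation s := (bform (S z0) (p l0) (p l0)).
Hypothesis maxS : forall y u, U y ->
  phi (F y) ^+ k * bform (S (F y)) (dder u F y) (dder u F y) <=
  phi z0 ^+ k * s * bform (G (F y)) (dder u F y) (dder u F y).

(** The trace over the tangent space of the covariant Hessian of [phi]; as the mean curvature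
    vanishes, this is the Laplacian of its restriction to the submanifold, written without second
    derivatives of [F]. *)
Definition lap_phi : R :=
  \sum_l (hess phi z0 (p l) (p l) - dder (chr (p l) (p l)) phi z0).

(* The second order terms of [S(W, W)] that are left once the contribution of
   the tangential part of [sum_l D_l D_l W] is removed; [q] is the plain
   derivative of [W] whose covariant derivative is [nu]. *)
Definition bochner_term (nu : 'rV[R]_d) (l : 'I_n) : R :=
  let q := nu - chr (p l) (p l0) in
  bform (hess_mx S z0 (p l) (p l)) (p l0) (p l0)
  - bform (dder (chr (p l) (p l)) S z0) (p l0) (p l0)
  + 4 * bform (dder (p l) S z0) q (p l0)
  + 2 * bform (S z0) q q
  + 2 * bform (S z0) (curv (p l) (p l0) (p l) - dchr G z0 (p l) (p l) (p l0)
          - chr (p l) q - chr (p l) nu + chr (chr (p l) (p l)) (p l0)) (p l0).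

(** The second order tests are summed over [l], and the first order conditions, weighted by the
    components of [a], are added. The combinations $\sum_l\partial_l\partial_l-\sum_la_l\partial_l$
    that result can be written in terms of ambient data and [nu]. *)
Lemma bochner_inequality : exists nu : 'I_n -> 'rV[R]_d,
  (forall l j, bform (G z0) (nu l) (p j) = 0) /\
  phi z0 ^+ 2 * (\sum_l (bochner_term (nu l) l
    - 2 * s * bform (G z0) (nu l) (nu l)
    - 2 * s * bform (G z0) (curv (p l) (p l0) (p l)) (p l0))) <=
  s * (k%:R * (k%:R + 1) * (\sum_l dder (p l) phi z0 ^+ 2)
       - k%:R * phi z0 * lap_phi).
Proof.
have [E [a [c [sE Ex0 normal tension key]]]] :=
  adapted_field oU oV sF FUV sG symG unitG unitg minF Ux gx0 l0.
pose W y := dder (E y) F y; pose nu l := cov F G (basis_vec l) W x0.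
exists nu; split; first exact: normal.
have Vz := FUV Ux.
have sW : smooth_on U W by exact: smooth_on_push.
have W0 : W x0 = p l0 by rewrite /W Ex0.
have sDW v := smooth_on_dder v oU sW; have sDF v := smooth_on_dder v oU sF.
pose P y := phi (F y); pose f y := bform (S (F y)) (W y) (W y).
pose h y := bform (G (F y)) (W y) (W y).
have sP : smooth_on U P by exact: smooth_on_comp sF sphi.
have sf : smooth_on U f.
  by apply: smooth_on_bform => //; exact: (smooth_on_comp_mx oU oV).
have sh : smooth_on U h.
  by apply: smooth_on_bform => //; exact: (smooth_on_comp_mx oU oV).
have gp i j : bform (G z0) (p i) (p j) = (i == j)%:R.
  by rewrite -(induced_metricE G sF)// gx0 bform_delta mxE.
have hx : h x0 = 1 by rewrite /h W0 gp eqxx.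
have fx : f x0 = s by rewrite /f W0.
have hder l : dder (basis_vec l) h x0 = 0.
  have [-> _] := dder2_bform_cov oU oV sF FUV sG symG unitG (basis_vec l) Ux sW.
  by rewrite W0 -/(nu l) normal mulr0.
have fmax y : U y -> P y ^+ k * f y <= P x0 ^+ k * f x0 * h y.
  by move=> Uy; rewrite fx; exact: maxS.
have max l := max_test_product oU Ux sP sf sh phi0 hx (hder l) fmax.
have P1 v y : U y -> dder v P y = dder (dder v F y) phi (F y).
  move=> Uy.
  exact: (dder_comp v (smooth_on_diff sF Uy) (smooth_on_diff sphi (FUV Uy))).
have P2 v : dder v (dder v P) x0 = dder (dder v (dder v F) x0) phi z0
    + hess phi z0 (dder v F x0) (dder v F x0).
  rewrite (dder_near v oU Ux (P1 v)).
  exact: (dder_dder_comp oU oV sF FUV v Ux sphi (sDF v)).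
have dphi := smooth_on_diff sphi Vz; have dF := smooth_on_diff sF Ux.
pose q l := nu l - chr (p l) (p l0).
have dW l : dder (basis_vec l) W x0 = q l.
  by rewrite /q /nu /cov W0 addrK.
pose FF := \sum_l dder (basis_vec l) (dder (basis_vec l) F) x0.
(* The only combination in which second derivatives of [F] survive. *)
have LF : FF - dder a F x0 = - \sum_l chr (p l) (p l).
  rewrite -tension -sumrB -sumrN; apply: eq_bigr => l _.
  by rewrite /cov opprD addrA subrr add0r.
pose WW := \sum_l dder (basis_vec l) (dder (basis_vec l) W) x0.
pose LW := WW - \sum_l a 0 l *: q l.
have dS := smooth_on_diff sS Vz.
have aF : dder a F x0 = \sum_l a 0 l *: p l by rewrite (dder_basis a dF).
have A1 : \sum_l dder (basis_vec l) (dder (basis_vec l) P) x0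
    - \sum_l a 0 l * dder (basis_vec l) P x0 = lap_phi.
  have -> : \sum_l a 0 l * dder (basis_vec l) P x0 = dder (dder a F x0) phi z0.
    rewrite aF dder_dir_sum//; apply: eq_bigr => l _.
    by rewrite dder_dirZ// P1.
  under eq_bigr do rewrite P2.
  rewrite big_split /= addrAC -dder_dir_sum// -dder_dirN// -dder_dirD// -/FF LF.
  by rewrite dder_dirN// dder_dir_sum// addrC /lap_phi sumrB.
pose X l := curv (p l) (p l0) (p l) - dchr G z0 (p l) (p l) (p l0)
  - chr (p l) (q l) - chr (p l) (nu l) + chr (chr (p l) (p l)) (p l0).
(* The analogue of [LF] for [W]: rewriting [key] with plain derivatives makes the first order terms
   with [a] and the second derivatives of [F] disappear together. *)
have A3 : LW = dder c F x0 + \sum_l X l.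
  have HFF : chr FF (p l0) = \sum_l a 0 l *: chr (p l) (p l0)
      - \sum_l chr (chr (p l) (p l)) (p l0).
    have -> : FF = dder a F x0 - \sum_l chr (p l) (p l) by rewrite -LF addrC subrK.
    rewrite chrDl chrNl aF !chr_suml; congr (_ - _).
    by apply: eq_bigr => l _; rewrite chrZl.
  have Haq : \sum_l a 0 l *: q l =
      \sum_l a 0 l *: nu l - \sum_l a 0 l *: chr (p l) (p l0).
    by rewrite -sumrB; apply: eq_bigr => l _; rewrite /q scalerBr.
  have Hcov : \sum_l cov F G (basis_vec l) (cov F G (basis_vec l) W) x0 =
      WW + \sum_l (dchr G z0 (p l) (p l) (p l0) + chr (p l) (q l) + chr (p l) (nu l))
      + chr FF (p l0).
    rewrite /WW /FF chr_suml -!big_split /=; apply: eq_bigr => l _.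
    rewrite (cov2E oU oV sF FUV sG unitG _ Ux sW) W0 dW -/(nu l).
    move: (dchr _ _ _ _ _) (dder _ (dder _ W) _) (chr _ _) (chr _ _) (chr _ _).
    by move=> *; apply/rowP => j; rewrite !mxE; ring.
  rewrite /LW.
  have -> : \sum_l X l = \sum_l curv (p l) (p l0) (p l)
      - \sum_l (dchr G z0 (p l) (p l) (p l0) + chr (p l) (q l) + chr (p l) (nu l))
      + \sum_l chr (chr (p l) (p l)) (p l0).
    rewrite -sumrB -big_split; apply: eq_bigr => l _ /=.
    by rewrite /X !opprD !addrA.
  have -> : WW = dder c F x0 + \sum_l a 0 l *: nu l
      + \sum_l curv (p l) (p l0) (p l)
      - \sum_l (dchr G z0 (p l) (p l) (p l0) + chr (p l) (q l) + chr (p l) (nu l))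
      - chr FF (p l0).
    rewrite -key Hcov; move: (\sum_l (_ + _)) (chr FF _) => *.
    by apply/rowP => j; rewrite !mxE; ring.
  have zid (t1 t2 t3 t4 t5 t6 : 'rV[R]_d) :
      t1 + t2 + t3 - t4 - (t5 - t6) - (t2 - t5) = t1 + (t3 - t4 + t6).
    by apply/rowP => j; rewrite !mxE; ring.
  rewrite HFF Haq; exact: zid.
have cF : dder c F x0 = \sum_l c 0 l *: p l by rewrite (dder_basis c dF).
(* Since [p l0] is [S]-orthogonal to the other [p l], only the component [c 0 l0] of the tangent
   vector contributes. *)
have A4 : bform (S z0) LW (p l0) = c 0 l0 * s + \sum_l bform (S z0) (X l) (p l0).
  rewrite A3 bformDl bform_suml; congr (_ + _).
  rewrite cF bform_suml (bigD1 l0)//= bformZl big1 ?addr0// => l ll0.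
  by rewrite bformZl orthS// mulr0.
(* Normality of [nu] removes the first order term of [key]. The component [c 0 l0] that remains,
   once multiplied by [s], matches the one in [A4]. *)
have A5 : \sum_l dder (basis_vec l) (dder (basis_vec l) h) x0 =
    2 * \sum_l bform (G z0) (nu l) (nu l)
    + 2 * (c 0 l0 + \sum_l bform (G z0) (curv (p l) (p l0) (p l)) (p l0)).
  have E2 l : dder (basis_vec l) (dder (basis_vec l) h) x0 =
      2 * bform (G z0) (nu l) (nu l) +
      2 * bform (G z0) (cov F G (basis_vec l) (cov F G (basis_vec l) W) x0) (p l0).
    have [_ ->] := dder2_bform_cov oU oV sF FUV sG symG unitG (basis_vec l) Ux sW.
    by rewrite W0.
  under eq_bigr do rewrite E2.
  rewrite big_split /= -!mulr_sumr; congr (_ + 2 * _).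
  rewrite -bform_suml key !bformDl bform_suml; congr (_ + _).
  rewrite cF !bform_suml [X in _ + X]big1 ?addr0; last first.
    by move=> l _; rewrite bformZl normal mulr0.
  rewrite (bigD1 l0)//= bformZl gp eqxx mulr1 big1 ?addr0// => l /negbTE ll0.
  by rewrite bformZl gp ll0 mulr0.
have A2 : \sum_l dder (basis_vec l) (dder (basis_vec l) f) x0
    - \sum_l a 0 l * dder (basis_vec l) f x0 =
    \sum_l bochner_term (nu l) l + 2 * (c 0 l0 * s).
  have D1 l : dder (basis_vec l) f x0 =
      bform (dder (p l) S z0) (p l0) (p l0) + 2 * bform (S z0) (q l) (p l0).
    have [-> _] := dder2_bform oU oV sF FUV (basis_vec l) Ux sS symS sW.
    by rewrite W0 dW.
  have D2 l : dder (basis_vec l) (dder (basis_vec l) f) x0 =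
      (bform (hess_mx S z0 (p l) (p l)) (p l0) (p l0)
       + 4 * bform (dder (p l) S z0) (q l) (p l0) + 2 * bform (S z0) (q l) (q l))
      + bform (dder (dder (basis_vec l) (dder (basis_vec l) F) x0) S z0) (p l0) (p l0)
      + 2 * bform (S z0) (dder (basis_vec l) (dder (basis_vec l) W) x0) (p l0).
    have [_ ->] := dder2_bform oU oV sF FUV (basis_vec l) Ux sS symS sW.
    by rewrite W0 dW; ring.
  have Ba : \sum_l a 0 l * dder (basis_vec l) f x0 =
      bform (dder (dder a F x0) S z0) (p l0) (p l0)
      + 2 * bform (S z0) (\sum_l a 0 l *: q l) (p l0).
    rewrite aF dder_dir_sum// bform_summ bform_suml mulr_sumr -big_split.
    apply: eq_bigr => l _ /=; rewrite D1 dder_dirZ// bformZm bformZl; ring.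
  have Bl : \sum_l bochner_term (nu l) l =
      \sum_l (bform (hess_mx S z0 (p l) (p l)) (p l0) (p l0)
       + 4 * bform (dder (p l) S z0) (q l) (p l0) + 2 * bform (S z0) (q l) (q l))
      - bform (dder (\sum_l chr (p l) (p l)) S z0) (p l0) (p l0)
      + 2 * \sum_l bform (S z0) (X l) (p l0).
    rewrite dder_dir_sum// bform_summ mulr_sumr -sumrB -big_split.
    apply: eq_bigr => l _ /=; rewrite /bochner_term -/(q l) -/(X l); ring.
  rewrite Ba Bl; under eq_bigr do rewrite D2.
  have HF : \sum_l bform (dder (dder (basis_vec l) (dder (basis_vec l) F) x0) S z0)
      (p l0) (p l0) = bform (dder FF S z0) (p l0) (p l0).
    by rewrite /FF dder_dir_sum// bform_summ.
  rewrite big_split /= big_split /= HF -[X in _ + X - _]mulr_sumr -bform_suml.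
  have LFS : bform (dder FF S z0) (p l0) (p l0) - bform (dder (dder a F x0) S z0) (p l0) (p l0)
      = - bform (dder (\sum_l chr (p l) (p l)) S z0) (p l0) (p l0).
    rewrite -!bformNm -bformDm; congr (bform _ _ _).
    by rewrite -(dder_dirN (dder a F x0) dS) -(dder_dirD _ _ dS) LF dder_dirN.
  have LWS : bform (S z0) WW (p l0) - bform (S z0) (\sum_l a 0 l *: q l) (p l0) =
      c 0 l0 * s + \sum_l bform (S z0) (X l) (p l0).
    by rewrite -bformBl -A4.
  rewrite -/FF -/WW; lra.
have B1 : phi z0 ^+ 2 * (\sum_l dder (basis_vec l) (dder (basis_vec l) f) x0
      - s * \sum_l dder (basis_vec l) (dder (basis_vec l) h) x0) <=
    s * (k%:R * (k%:R + 1) * (\sum_l dder (p l) phi z0 ^+ 2)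
      - k%:R * phi z0 * \sum_l dder (basis_vec l) (dder (basis_vec l) P) x0).
  rewrite !mulr_sumr -!sumrB !mulr_sumr; apply: ler_sum => l _.
  by have [_] := max l; rewrite fx P1.
(* The first order conditions weighted by [a]: they exchange first derivatives of [f] for those of
   [P], which complete [lap_phi] on the right side. *)
have B2 : phi z0 * \sum_l a 0 l * dder (basis_vec l) f x0 =
    - k%:R * s * \sum_l a 0 l * dder (basis_vec l) P x0.
  rewrite !mulr_sumr; apply: eq_bigr => l _.
  by have [] := max l; rewrite fx /P => e _; rewrite mulrCA e; ring.
have -> : \sum_l (bochner_term (nu l) l - 2 * s * bform (G z0) (nu l) (nu l)
    - 2 * s * bform (G z0) (curv (p l) (p l0) (p l)) (p l0)) =
  \sum_l dder (basis_vec l) (dder (basis_vec l) f) x0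
  - \sum_l a 0 l * dder (basis_vec l) f x0
  - s * \sum_l dder (basis_vec l) (dder (basis_vec l) h) x0.
  by rewrite A2 A5 !sumrB -!mulr_sumr; ring.
rewrite -A1.
move: B1 B2; move: (\sum_l dder _ (dder _ f) _) (\sum_l dder _ (dder _ h) _)
  (\sum_l a 0 l * dder _ f _) (\sum_l dder _ (dder _ P) _)
  (\sum_l a 0 l * dder _ P _) (\sum_l _ ^+ 2) => f2 h2 af P3 aP p2 B1 B2.
have -> : phi z0 ^+ 2 * (f2 - af - s * h2) =
    phi z0 ^+ 2 * (f2 - s * h2) - phi z0 * (phi z0 * af) by ring.
rewrite B2; apply: le_trans (lerB B1 (lexx _)) _.
by rewrite le_eqVlt; apply/orP; left; apply/eqP; ring.
Qed.

End BochnerInequality.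

(** * Estimates *)

Section Estimates.
Context {R : realType} {d : nat}.
Implicit Types (u v w : 'rV[R]_d) (A : 'M[R]_d).
Local Notation D := (d%:R : R).

Lemma ler_norm_coord u i : `|u 0 i| <= `|u|.
Proof.
rewrite [leRHS]/Num.Def.normr /= mx_normrE.
exact: (le_bigmax _ (fun ij : 'I_1 * 'I_d => `|u ij.1 ij.2|) (0, i)).
Qed.

Lemma norm_rV_le u a : 0 <= a -> (forall i, `|u 0 i| <= a) -> `|u| <= a.
Proof.
move=> a0 ua; rewrite [leLHS]/Num.Def.normr /= mx_normrE.
by apply: bigmax_le => // -[i j] _ /=; rewrite ord1.
Qed.

Lemma ler_norm_sum_const (f : 'I_d -> R) a : (forall i, `|f i| <= a) ->
  `|\sum_i f i| <= D * a.
Proof.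
move=> fa; apply: le_trans (ler_norm_sum _ _ _) _.
apply: le_trans (ler_sum _ (fun i _ => fa i)) _.
by rewrite sumr_const card_ord mulr_natl.
Qed.

Lemma ler_norm_bform A u v a : (forall i j, `|A i j| <= a) ->
  `|bform A u v| <= D ^+ 2 * a * `|u| * `|v|.
Proof.
move=> Aa; rewrite bformE.
apply: le_trans (_ : D * (D * (`|u| * `|v| * a)) <= _); last first.
  by rewrite le_eqVlt; apply/orP; left; apply/eqP; ring.
apply: ler_norm_sum_const => i; apply: ler_norm_sum_const => j.
by rewrite !normrM ler_pM ?mulr_ge0 ?ler_pM ?ler_norm_coord.
Qed.

Lemma ler_norm_dder (f : 'rV[R]_d -> R) z u a : differentiable f z ->
  (forall c, `|dder (basis_vec c) f z| <= a) -> `|dder u f z| <= D * a * `|u|.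
Proof.
move=> df fa; rewrite dder_basis// -mulrA; apply: ler_norm_sum_const => c.
by rewrite normrZ mulrC ler_pM ?ler_norm_coord.
Qed.

Lemma ler_norm_hess (f : 'rV[R]_d -> R) z u v a :
  (forall c, differentiable (dder (basis_vec c) f) z) ->
  (forall c e, `|dder (basis_vec e) (dder (basis_vec c) f) z| <= a) ->
  `|hess f z u v| <= D ^+ 2 * a * `|u| * `|v|.
Proof.
move=> df fa; apply: le_trans (_ : D * (`|u| * (D * a * `|v|)) <= _); last first.
  by rewrite le_eqVlt; apply/orP; left; apply/eqP; ring.
apply: ler_norm_sum_const => c; rewrite normrM ler_pM ?ler_norm_coord//.
exact: ler_norm_dder.
Qed.

Section Christoffel.
Context (V : set 'rV[R]_d) (oV : open V) (G : 'rV[R]_d -> 'M[R]_d).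
Hypothesis sG : smooth_on V G.
Hypothesis unitG : forall y, V y -> G y \in unitmx.
Context (z : 'rV[R]_d) (Vz : V z) (N : R) (N0 : 0 <= N).
Hypothesis dG_le : forall c i j, `|dder (basis_vec c) (fun y => G y i j) z| <= N.
Hypothesis ddG_le : forall c e i j,
  `|dder (basis_vec e) (dder (basis_vec c) (fun y => G y i j)) z| <= N.
Hypothesis iG_le : forall i j, `|invmx (G z) i j| <= N.
Hypothesis diG_le : forall c i j,
  `|dder (basis_vec c) (fun y => invmx (G y) i j) z| <= N.

(** The [3] counts the metric derivatives in each summand of the Christoffel symbol. Its factor
    $1/2$ is given away for the symbol itself and compensates the two terms of the product rule for
    its derivative, so one [K] serves both. *)
Let K : R := 3 * D * N ^+ 2.

Let K0 : 0 <= K. Proof. by rewrite !mulr_ge0 ?exprn_ge0. Qed.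

Lemma christoffelE y k i j : christoffel G y k i j =
  2^-1 * \sum_l invmx (G y) k l * (dder (basis_vec i) (fun z => G z j l) y
    + dder (basis_vec j) (fun z => G z i l) y - dder (basis_vec l) (fun z => G z i j) y).
Proof. by congr (_ * _); apply: eq_bigr => l _; rewrite !pderiveE. Qed.

Lemma ler_norm_christoffel k i j : `|christoffel G z k i j| <= K.
Proof.
rewrite christoffelE normrM ger0_norm ?invr_ge0//.
apply: le_trans (_ : 2^-1 * (D * (N * (N + N + N))) <= _).
  rewrite ler_wpM2l ?invr_ge0//; apply: ler_norm_sum_const => l.
  rewrite normrM ler_pM//; apply: le_trans (ler_normB _ _) _; rewrite lerD//.
  by apply: le_trans (ler_normD _ _) _; rewrite lerD.
have -> : 2^-1 * (D * (N * (N + N + N))) = 2^-1 * K by rewrite /K; ring.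
by rewrite ler_piMl// invf_le1 ?ler1n.
Qed.

Lemma ler_norm_dchristoffel c k i j :
  `|dder (basis_vec c) (fun y => christoffel G y k i j) z| <= K.
Proof.
have dGc a e f : differentiable (dder (basis_vec a) (fun y => G y e f)) z.
  apply: smooth_on_diff (smooth_on_dder (basis_vec a) oV _) Vz.
  exact: ((smooth_on_coord oV G).1 sG).
have diG e f : differentiable (fun y => invmx (G y) e f) z.
  apply: smooth_on_diff Vz.
  exact: ((smooth_on_coord oV _).1 (smooth_on_invmx oV unitG sG)).
have dB e : differentiable (fun y => dder (basis_vec i) (fun z => G z j e) y
    + dder (basis_vec j) (fun z => G z i e) y - dder (basis_vec e) (fun z => G z i j) y) z.
  by apply: differentiableB => //; apply: differentiableD.
have dM e := differentiableM (diG k e) (dB e).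
rewrite (_ : (fun y => christoffel G y k i j) = (fun y => 2^-1 *: \sum_l
  invmx (G y) k l * (dder (basis_vec i) (fun z => G z j l) y
    + dder (basis_vec j) (fun z => G z i l) y
    - dder (basis_vec l) (fun z => G z i j) y))); last first.
  by apply/funext => y; rewrite christoffelE.
rewrite dderZ; last by apply: differentiable_bigsum => l; exact: dM.
rewrite dder_sum; last by move=> l; exact: dM.
rewrite normrZ ger0_norm ?invr_ge0//.
apply: le_trans (_ : 2^-1 * (D * (N * (N + N + N) + N * (N + N + N))) <= _); last first.
  by rewrite le_eqVlt; apply/orP; left; apply/eqP; rewrite /K; lra.
rewrite ler_wpM2l ?invr_ge0//; apply: ler_norm_sum_const => l.
rewrite dderM//; apply: le_trans (ler_normD _ _) _; rewrite !normrM.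
have B3 (a b e : R) : `|a| <= N -> `|b| <= N -> `|e| <= N -> `|a + b - e| <= N + N + N.
  move=> aN bN eN; apply: le_trans (ler_normB _ _) _; rewrite lerD//.
  by apply: le_trans (ler_normD _ _) _; rewrite lerD.
rewrite lerD// ler_pM//; first exact: B3.
rewrite dderB ?dderD//; first exact: B3.
exact: differentiableD.
Qed.

(** A bilinear form has [D ^+ 2] entries; the direction of differentiation accounts for one more
    factor [D] in [c2]. *)
Let c1 : R := D ^+ 2 * K.
Let c2 : R := D ^+ 3 * K.

Lemma ler_norm_chr u v : `|chr G z u v| <= c1 * `|u| * `|v|.
Proof.
apply: norm_rV_le; first by rewrite !mulr_ge0 ?exprn_ge0.
move=> k; rewrite chrE; apply: ler_norm_bform => i j; rewrite mxE.
exact: ler_norm_christoffel.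
Qed.

Lemma ler_norm_dchr w u v : `|dchr G z w u v| <= c2 * `|w| * `|u| * `|v|.
Proof.
apply: norm_rV_le; first by rewrite !mulr_ge0 ?exprn_ge0.
move=> k; have sk := smooth_on_christoffel_mx oV sG unitG.
have E j : (fun y => chr G y u v 0 j) =
    (fun y => bform (christoffel_mx G j y) u v).
  by apply/funext => y; rewrite chrE.
have dj j : differentiable (fun y => chr G y u v 0 j) z.
  rewrite E; apply: differentiable_bform; [|exact: differentiable_cst..].
  exact: smooth_on_diff (sk j) Vz.
rewrite /dchr dder_coord; last first.
  by apply/differentiable_mxP => i j; rewrite ord1.
rewrite E dder_bform; [|exact: smooth_on_diff (sk k) Vz|exact: differentiable_cst..].
rewrite !dder_cst bform0l bform0r !addr0.
have -> : c2 * `|w| * `|u| * `|v| = D ^+ 2 * (D * K * `|w|) * `|u| * `|v|.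
  by rewrite /c2; ring.
apply: ler_norm_bform => i j; rewrite dder_coord; last exact: smooth_on_diff (sk k) Vz.
have -> : (fun y => christoffel_mx G k y i j) = (fun y => christoffel G y k i j).
  by apply/funext => y; rewrite mxE.
apply: ler_norm_dder; last by move=> c; exact: ler_norm_dchristoffel.
exact: smooth_on_diff (smooth_on_christoffel oV sG unitG k i j) Vz.
Qed.

Lemma ler_norm_curvature u v w :
  `|curvature G z u v w| <= 2 * (c2 + c1 ^+ 2) * `|u| * `|v| * `|w|.
Proof.
have c10 : 0 <= c1 by rewrite !mulr_ge0 ?exprn_ge0.
have chr2 a b c : `|chr G z a (chr G z b c)| <= c1 ^+ 2 * `|a| * `|b| * `|c|.
  apply: le_trans (ler_norm_chr _ _) _.
  have -> : c1 ^+ 2 * `|a| * `|b| * `|c| = c1 * `|a| * (c1 * `|b| * `|c|) by ring.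
  by rewrite ler_wpM2l ?mulr_ge0// ler_norm_chr.
rewrite /curvature; apply: le_trans (ler_normB _ _) _.
apply: le_trans (lerD (ler_normD _ _) (lexx _)) _.
apply: le_trans (lerD (lerD (ler_normB _ _) (lexx _)) (lexx _)) _.
apply: le_trans (lerD (lerD (lerD (ler_norm_dchr _ _ _) (ler_norm_dchr _ _ _))
  (chr2 _ _ _)) (chr2 _ _ _)) _.
by rewrite le_eqVlt; apply/orP; left; apply/eqP; ring.
Qed.

End Christoffel.

End Estimates.

(** * From the differential inequality to a curvature bound in a chart *)

Section RicciBound.
Context {R : realType}.

(* [K] bounds the Christoffel symbols and their first derivatives; [c1] and [c2]
   bound them as multilinear maps for the maximum norm. *)
Definition bochner_error (d : nat) (N : R) : R :=
  let D := d%:R in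
  let K := 3 * D * N ^+ 2 in
  let c1 := D ^+ 2 * K in
  let c2 := D ^+ 3 * K in
  D ^+ 4 * N + 5 * D ^+ 3 * N * c1
  + 2 * D ^+ 2 * (2 * (c2 + c1 ^+ 2) + c2 + 2 * c1 ^+ 2)
  + (4 * D ^+ 3 * N + 8 * D ^+ 2 * c1) ^+ 2.

(** The summands come from the errors in [bochner_term] multiplied by [phi ^+ 2], from the gradient
    of [phi], and from [lap_phi]. The factor [n] counts the directions [l], and [2^-1] undoes the
    factor [2] of the curvature term. *)
Definition ricci_const (n d k : nat) (N : R) : R :=
  let D := d%:R in
  let c1 := D ^+ 2 * (3 * D * N ^+ 2) in
  2^-1 * n%:R * (bochner_error d N * N ^+ 2
    + k%:R * (k%:R + 1) * (D * N) ^+ 2 + k%:R * N * (D ^+ 2 * N + D * N * c1)).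

Context {n d : nat}.
Context (U : set 'rV[R]_n) (oU : open U) (F : 'rV[R]_n -> 'rV[R]_d).
Context (V : set 'rV[R]_d) (oV : open V) (G S : 'rV[R]_d -> 'M[R]_d).
Context (phi : 'rV[R]_d -> R).
Hypothesis sF : smooth_on U F.
Hypothesis FUV : forall y, U y -> V (F y).
Hypothesis sG : smooth_on V G.
Hypothesis symG : forall y, V y -> (G y)^T = G y.
Hypothesis unitG : forall y, V y -> G y \in unitmx.
Hypothesis unitg : forall y, U y -> induced_metric G F y \in unitmx.
Hypothesis minF : forall y, U y -> trace_second_fundamental_form G F y = 0.
Hypothesis sS : smooth_on V S.
Hypothesis symS : forall y, V y -> (S y)^T = S y.
Hypothesis sphi : smooth_on V phi.
Context (x0 : 'rV[R]_n) (Ux : U x0) (k : nat) (l0 : 'I_n).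
Hypothesis gx0 : induced_metric G F x0 = 1%:M.

Local Notation z0 := (F x0).
Local Notation p := (fun l => dder (basis_vec l) F x0).
Local Notation chr := (chr G z0).
Local Notation curv := (curvature G z0).

Hypothesis phi0 : 0 < phi z0.
Hypothesis S1 : S z0 = 1%:M.
Hypothesis orthS : forall l, l != l0 -> bform (S z0) (p l) (p l0) = 0.
Local Notation s := (bform (S z0) (p l0) (p l0)).
Hypothesis maxS : forall y u, U y ->
  phi (F y) ^+ k * bform (S (F y)) (dder u F y) (dder u F y) <=
  phi z0 ^+ k * s * bform (G (F y)) (dder u F y) (dder u F y).
Hypothesis normal_le0 : forall nu,
  (forall j, bform (G z0) nu (p j) = 0) -> bform (G z0) nu nu <= 0.

Context (N : R) (N0 : 0 <= N).
Hypothesis dG_le : forall c i j, `|dder (basis_vec c) (fun y => G y i j) z0| <= N.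
Hypothesis ddG_le : forall c e i j,
  `|dder (basis_vec e) (dder (basis_vec c) (fun y => G y i j)) z0| <= N.
Hypothesis iG_le : forall i j, `|invmx (G z0) i j| <= N.
Hypothesis diG_le : forall c i j,
  `|dder (basis_vec c) (fun y => invmx (G y) i j) z0| <= N.
Hypothesis dS_le : forall c i j, `|dder (basis_vec c) (fun y => S y i j) z0| <= N.
Hypothesis ddS_le : forall c e i j,
  `|dder (basis_vec e) (dder (basis_vec c) (fun y => S y i j)) z0| <= N.
Hypothesis phi_le : `|phi z0| <= N.
Hypothesis dphi_le : forall c, `|dder (basis_vec c) phi z0| <= N.
Hypothesis ddphi_le : forall c e,
  `|dder (basis_vec e) (dder (basis_vec c) phi) z0| <= N.

Local Notation D := (d%:R : R).
Let K : R := 3 * D * N ^+ 2.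
Let c1 : R := D ^+ 2 * K.
Let c2 : R := D ^+ 3 * K.
Let sg : R := Num.sqrt s.

(** In this chart [S z0] is the identity, so the form is the Euclidean square, which dominates that
    of the maximum norm. *)
Let dot_ge (u : 'rV[R]_d) : `|u| ^+ 2 <= bform (S z0) u u.
Proof.
have E : bform (S z0) u u = \sum_i u 0 i ^+ 2.
  rewrite S1 bform_mulmx mulmx1 mxE; apply: eq_bigr => i _.
  by rewrite mxE expr2.
have s0 : 0 <= bform (S z0) u u by rewrite E sumr_ge0// => i _; rewrite sqr_ge0.
rewrite -(sqr_sqrtr s0) ler_sqr ?nnegrE ?sqrtr_ge0//.
apply: norm_rV_le => [|i]; first exact: sqrtr_ge0.
rewrite -sqrtr_sqr ler_wsqrtr// E (bigD1 i)//= lerDl sumr_ge0// => j _.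
exact: sqr_ge0.
Qed.

Let s_ge0 : 0 <= s.
Proof. by apply: le_trans (dot_ge _); rewrite exprn_ge0. Qed.

Let sg2 : sg ^+ 2 = s. Proof. by rewrite sqr_sqrtr. Qed.
Let sg0 : 0 <= sg. Proof. exact: sqrtr_ge0. Qed.

(** The hypothesis [maxS] at the point [x0] itself, for the vector [p l] of unit length in the
    metric. *)
Let p_le l : `|p l| <= sg.
Proof.
rewrite -(@ler_pXn2r _ 2) ?nnegrE ?normr_ge0// sg2.
apply: le_trans (dot_ge _) _.
have := maxS (basis_vec l) Ux; rewrite -(induced_metricE G sF)// gx0 bform_delta.
by rewrite mxE eqxx mulr1 ler_pM2l// exprn_gt0.
Qed.

Let K0 : 0 <= K. Proof. by rewrite !mulr_ge0 ?exprn_ge0. Qed.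
Let c10 : 0 <= c1. Proof. by rewrite mulr_ge0 ?exprn_ge0. Qed.
Let c20 : 0 <= c2. Proof. by rewrite mulr_ge0 ?exprn_ge0. Qed.
Let D0 : 0 <= D. Proof. exact: ler0n. Qed.

Let Vz : V z0. Proof. exact: FUV. Qed.

Let chr_le u v a b : `|u| <= a -> `|v| <= b -> `|chr u v| <= c1 * a * b.
Proof.
move=> ua vb; apply: le_trans (ler_norm_chr N0 dG_le iG_le u v) _.
by rewrite ler_pM ?mulr_ge0// ler_pM ?mulr_ge0 ?exprn_ge0.
Qed.

Let bform_le (A : 'M[R]_d) u v a x y : (forall i j, `|A i j| <= a) ->
  `|u| <= x -> `|v| <= y -> `|bform A u v| <= D ^+ 2 * a * x * y.
Proof.
move=> Aa ux vy; apply: le_trans (ler_norm_bform u v Aa) _.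
(* The sign of [a] is read off from an entry of [A], so the empty matrix is treated separately. *)
have [d0|dpos] := posnP d.
  have -> : D = 0 by rewrite d0.
  by rewrite expr0n /= !mul0r.
have a0 : 0 <= a.
  exact: le_trans (normr_ge0 _) (Aa (Ordinal dpos) (Ordinal dpos)).
by rewrite ler_pM ?mulr_ge0 ?exprn_ge0// ler_pM ?mulr_ge0 ?exprn_ge0.
Qed.

Let dS_bound u v w a x y : `|u| <= a -> `|v| <= x -> `|w| <= y ->
  `|bform (dder u S z0) v w| <= D ^+ 3 * N * a * x * y.
Proof.
move=> ua vx wy; have -> : D ^+ 3 * N * a * x * y = D ^+ 2 * (D * N * a) * x * y by ring.
have dS := smooth_on_diff sS Vz.
apply: bform_le => // i j; rewrite dder_coord//.
apply: le_trans (_ : D * N * `|u| <= _); last by rewrite ler_wpM2l ?mulr_ge0.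
by apply: ler_norm_dder => //; exact: ((differentiable_mxP S z0).1 dS).
Qed.

(** Nothing bounds [nu] from above, so its norm [r] is kept as a variable of the same weight as [s],
    while each [p l] weighs [sg]. Every term then has total weight [s ^+ 2], and a quadratic
    polynomial in [r] has to be bounded from below. *)
Lemma bochner_term_ge (nu : 'rV[R]_d) l :
  - bochner_error d N * s ^+ 2 <= bochner_term F G S x0 l0 nu l.
Proof.
set r := `|nu|; have r0 : 0 <= r by exact: normr_ge0.
set q := nu - chr (p l) (p l0).
have cpp : `|chr (p l) (p l0)| <= c1 * s.
  by rewrite -sg2 expr2 mulrA chr_le.
have cll : `|chr (p l) (p l)| <= c1 * s by rewrite -sg2 expr2 mulrA chr_le.
have q_le : `|q| <= r + c1 * s.
  by apply: le_trans (ler_normB _ _) _; rewrite lerD2l.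
have t1 : `|bform (hess_mx S z0 (p l) (p l)) (p l0) (p l0)| <= D ^+ 4 * N * s ^+ 2.
  have -> : D ^+ 4 * N * s ^+ 2 = D ^+ 2 * (D ^+ 2 * N * sg * sg) * sg * sg.
    by rewrite -sg2; ring.
  apply: bform_le => // i j; rewrite mxE.
  apply: le_trans (ler_norm_hess _ _ _ _) _.
  - move=> c; apply: smooth_on_diff (smooth_on_dder (basis_vec c) oV _) Vz.
    exact: ((smooth_on_coord oV S).1 sS).
  - by move=> c e; exact: ddS_le.
  by rewrite ler_pM ?mulr_ge0 ?exprn_ge0// ler_pM ?mulr_ge0 ?exprn_ge0.
have t2 : `|bform (dder (chr (p l) (p l)) S z0) (p l0) (p l0)| <=
    D ^+ 3 * N * c1 * s ^+ 2.
  have -> : D ^+ 3 * N * c1 * s ^+ 2 = D ^+ 3 * N * (c1 * s) * sg * sg.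
    by rewrite -sg2; ring.
  exact: dS_bound.
have t3 : `|bform (dder (p l) S z0) q (p l0)| <= D ^+ 3 * N * s * (r + c1 * s).
  have -> : D ^+ 3 * N * s * (r + c1 * s) = D ^+ 3 * N * sg * (r + c1 * s) * sg.
    by rewrite -sg2; ring.
  exact: dS_bound.
have S1le i j : `|S z0 i j| <= 1.
  by rewrite S1 mxE; case: (i == j); rewrite ?normr1 ?normr0.
(* The square of the Christoffel part of [q] is nonnegative and is dropped. *)
have t4 : 2 * r ^+ 2 - 4 * D ^+ 2 * c1 * (s * r) <= 2 * bform (S z0) q q.
  have e : bform (S z0) q q = bform (S z0) nu nu
      - 2 * bform (S z0) nu (chr (p l) (p l0))
      + bform (S z0) (chr (p l) (p l0)) (chr (p l) (p l0)).
    rewrite /q bformBl !bformBr (bform_sym (chr _ _) nu) ?symS//; ring.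
  have e1 : `|bform (S z0) nu (chr (p l) (p l0))| <= D ^+ 2 * 1 * r * (c1 * s).
    exact: bform_le.
  have e2 := le_trans (exprn_ge0 2 (normr_ge0 _)) (dot_ge (chr (p l) (p l0))).
  have e3 := dot_ge nu; rewrite -/r in e3.
  move: e1; rewrite ler_norml => /andP[_ e1]; rewrite e; lra.
set X := curv (p l) (p l0) (p l) - dchr G z0 (p l) (p l) (p l0)
  - chr (p l) q - chr (p l) nu + chr (chr (p l) (p l)) (p l0).
have X_le : `|X| <= (2 * (c2 + c1 ^+ 2) * s + c2 * s + c1 * (r + c1 * s) + c1 * r
    + c1 ^+ 2 * s) * sg.
  apply: le_trans (ler_normD _ _) _; rewrite mulrDl; apply: lerD; last first.
    have -> : c1 ^+ 2 * s * sg = c1 * (c1 * s) * sg by ring.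
    exact: chr_le.
  apply: le_trans (ler_normB _ _) _; rewrite mulrDl; apply: lerD; last first.
    have -> : c1 * r * sg = c1 * sg * r by ring.
    exact: chr_le.
  apply: le_trans (ler_normB _ _) _; rewrite mulrDl; apply: lerD; last first.
    have -> : c1 * (r + c1 * s) * sg = c1 * sg * (r + c1 * s) by ring.
    exact: chr_le.
  have cube (c a1 a2 a3 : R) : 0 <= c -> 0 <= a1 -> 0 <= a2 -> 0 <= a3 ->
      a1 <= sg -> a2 <= sg -> a3 <= sg -> c * a1 * a2 * a3 <= c * s * sg.
    move=> *; rewrite -sg2 expr2 mulrA.
    by rewrite ler_pM ?mulr_ge0// ler_pM ?mulr_ge0// ler_wpM2l.
  apply: le_trans (ler_normB _ _) _; rewrite mulrDl; apply: lerD.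
    apply: le_trans (ler_norm_curvature oV sG unitG Vz N0 dG_le ddG_le iG_le diG_le _ _ _) _.
    by apply: cube => //; rewrite mulr_ge0 ?addr_ge0 ?exprn_ge0.
  apply: le_trans (ler_norm_dchr oV sG unitG Vz N0 dG_le ddG_le iG_le diG_le _ _ _) _.
  exact: cube.
have t5 : `|bform (S z0) X (p l0)| <= D ^+ 2 * (2 * (c2 + c1 ^+ 2) * s + c2 * s
    + c1 * (r + c1 * s) + c1 * r + c1 ^+ 2 * s) * s.
  have e (t : R) : D ^+ 2 * t * s = D ^+ 2 * 1 * (t * sg) * sg.
    by rewrite -sg2; ring.
  by rewrite e; exact: bform_le.
rewrite /bochner_term -/q -/X /bochner_error -/K -/c1 -/c2.
move: t1 t2 t3 t4 t5; rewrite !ler_norml.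
move=> /andP[t1 _] /andP[_ t2] /andP[t3 _] t4 /andP[t5 _].
(* The total coefficient of [s * r]: [4 * D ^+ 3 * N] comes from [t3], and [4 * D ^+ 2 * c1] from
   each of [t4] and [t5]. Completing the square costs at most the last summand of
   [bochner_error]. *)
pose B := 4 * D ^+ 3 * N + 8 * D ^+ 2 * c1.
have sq : - (B ^+ 2 * s ^+ 2) <= 2 * r ^+ 2 - B * (s * r).
  by have := sqr_ge0 (r - B * s / 2); have := sqr_ge0 r;
    have := sqr_ge0 (B * s); nra.
pose T1 := D ^+ 4 * N * s ^+ 2; pose T2 := D ^+ 3 * N * c1 * s ^+ 2.
pose T3 := D ^+ 3 * N * s * (r + c1 * s).
pose T4 := 2 * r ^+ 2 - 4 * D ^+ 2 * c1 * (s * r).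
pose T5 := D ^+ 2 * (2 * (c2 + c1 ^+ 2) * s + c2 * s
    + c1 * (r + c1 * s) + c1 * r + c1 ^+ 2 * s) * s.
apply: le_trans (_ : - T1 - T2 - 4 * T3 + T4 - 2 * T5 <= _); last first.
  by rewrite -/T1 -/T2 -/T3 -/T4 -/T5 in t1 t2 t3 t4 t5; lra.
have -> : - T1 - T2 - 4 * T3 + T4 - 2 * T5 = - (D ^+ 4 * N
    + 5 * D ^+ 3 * N * c1 + 2 * D ^+ 2 * (2 * (c2 + c1 ^+ 2) + c2 + 2 * c1 ^+ 2))
    * s ^+ 2 + (2 * r ^+ 2 - B * (s * r)).
  by rewrite /T1 /T2 /T3 /T4 /T5 /B; ring.
by rewrite -/B opprD mulrDl lerD2l mulNr.
Qed.

Lemma dder_phi_le (u : 'rV[R]_d) a : `|u| <= a -> `|dder u phi z0| <= D * N * a.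
Proof.
move=> ua; apply: le_trans (_ : D * N * `|u| <= _); last by rewrite ler_wpM2l ?mulr_ge0.
by apply: ler_norm_dder => //; exact: smooth_on_diff sphi Vz.
Qed.

(** The lower bound [low] for the left side of [bochner_inequality] is linear in the curvature sum
    with coefficient [2 * s]; the upper bound [up] is quadratic in [s]. Dividing by
    [2 * s * phi z0 ^+ 2] gives the claim. *)
Lemma ricci_bound :
  \sum_l - bform (G z0) (curv (p l) (p l0) (p l)) (p l0) <=
  ricci_const n d k N * phi z0 ^- 2 * s.
Proof.
have [nu [normal main]] := bochner_inequality oU oV sF FUV sG symG unitG unitg minF
  sS symS sphi Ux gx0 phi0 orthS maxS.
(* If [s] vanished, so would [p l0], which is a unit vector for the metric. *)
have s_gt0 : 0 < s.
  rewrite lt0r s_ge0 andbT; apply/negP => /eqP sz.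
  have := dot_ge (p l0); rewrite sz => p00.
  have : p l0 = 0.
    by apply/eqP; rewrite -normr_eq0 -sqrf_eq0 eq_le sqr_ge0 p00.
  move=> pl0; have : bform (G z0) (p l0) (p l0) = 1.
    by rewrite -(induced_metricE G sF)// gx0 bform_delta mxE eqxx.
  by rewrite pl0 bform0l => /eqP; rewrite eq_sym oner_eq0.
have P0 := phi0; have PN : phi z0 <= N by rewrite -(gtr0_norm phi0).
set P := phi z0 in P0 PN main *.
have P2 : P ^+ 2 <= N ^+ 2 by rewrite ler_sqr ?nnegrE// ltW.
pose rc := \sum_l - bform (G z0) (curv (p l) (p l0) (p l)) (p l0).
pose er := bochner_error d N.
have er0 : 0 <= er.
  rewrite /er /bochner_error -/K -/c1 -/c2.
  by do ![done|exact: sqr_ge0|apply: addr_ge0|apply: mulr_ge0|apply: exprn_ge0].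
have low : 2 * s * rc - n%:R * (er * s ^+ 2) <=
    \sum_l (bochner_term F G S x0 l0 (nu l) l - 2 * s * bform (G z0) (nu l) (nu l)
      - 2 * s * bform (G z0) (curv (p l) (p l0) (p l)) (p l0)).
  have -> : n%:R * (er * s ^+ 2) = \sum_(l < n) er * s ^+ 2.
    by rewrite sumr_const card_ord mulr_natl.
  rewrite mulr_sumr -sumrB; apply: ler_sum => l _.
  have h1 := bochner_term_ge (nu l) l; have h2 := normal_le0 (normal l).
  have h3 : 0 <= - (2 * s * bform (G z0) (nu l) (nu l)).
    by rewrite oppr_ge0 mulr_ge0_le0// mulr_ge0// ltW.
  by rewrite -/er in h1; lra.
have up1 : \sum_l dder (p l) phi z0 ^+ 2 <= n%:R * ((D * N) ^+ 2 * s).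
  have -> : n%:R * ((D * N) ^+ 2 * s) = \sum_(l < n) (D * N) ^+ 2 * s.
    by rewrite sumr_const card_ord mulr_natl.
  apply: ler_sum => l _; rewrite -sg2 -exprMn -real_normK ?num_real//.
  by rewrite ler_sqr ?nnegrE ?mulr_ge0// dder_phi_le.
have up2 : - lap_phi F G phi x0 <= n%:R * ((D ^+ 2 * N + D * N * c1) * s).
  have -> : n%:R * ((D ^+ 2 * N + D * N * c1) * s) =
      \sum_(l < n) (D ^+ 2 * N + D * N * c1) * s.
    by rewrite sumr_const card_ord mulr_natl.
  rewrite /lap_phi -sumrN; apply: ler_sum => l _.
  apply: le_trans (ler_norm _) _; rewrite normrN.
  apply: le_trans (ler_normB _ _) _; rewrite mulrDl; apply: lerD.
    rewrite -sg2 expr2 mulrA; apply: le_trans (ler_norm_hess _ _ _ ddphi_le) _.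
      move=> c; exact: smooth_on_diff (smooth_on_dder (basis_vec c) oV sphi) Vz.
    by rewrite ler_pM ?mulr_ge0 ?exprn_ge0// ler_wpM2l ?mulr_ge0 ?exprn_ge0.
  rewrite -mulrA; apply: dder_phi_le.
  by rewrite -sg2 expr2 mulrA chr_le.
pose A := k%:R * (k%:R + 1) * (D * N) ^+ 2.
pose B := D ^+ 2 * N + D * N * c1.
have B0 : 0 <= B by rewrite addr_ge0 ?mulr_ge0 ?exprn_ge0.
have up : P ^+ 2 * (2 * s * rc - n%:R * (er * s ^+ 2)) <=
    s * (n%:R * (A + k%:R * N * B) * s).
  apply: le_trans (ler_wpM2l (sqr_ge0 P) low) _; apply: le_trans main _.
  rewrite ler_pM2l//.
  apply: le_trans (_ : k%:R * (k%:R + 1) * (n%:R * ((D * N) ^+ 2 * s))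
    + k%:R * N * (n%:R * (B * s)) <= _); last first.
    by rewrite le_eqVlt; apply/orP; left; apply/eqP; rewrite /A; ring.
  apply: lerD; first by rewrite ler_wpM2l// mulr_ge0// addr_ge0.
  rewrite -mulrN; apply: le_trans (ler_wpM2l _ up2) _.
    by rewrite mulr_ge0// ltW.
  apply: ler_wpM2r; last exact: ler_wpM2l.
  exact: mulr_ge0 (ler0n _ _) (mulr_ge0 B0 s_ge0).
have P20 : 0 < P ^+ 2 by rewrite exprn_gt0.
rewrite -/rc -mulrA mulrC -mulrA -(ler_pM2l P20) [P ^+ 2 * (_ * _)]mulVKf ?lt0r_neq0//.
rewrite -(ler_pM2l s_gt0).
(* This puts the errors free of derivatives of [phi] on the same footing as the others, all divided
   by [P ^+ 2] in the end. *)
have low2 : P ^+ 2 * (n%:R * (er * s ^+ 2)) <= N ^+ 2 * (n%:R * (er * s ^+ 2)).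
  by rewrite ler_wpM2r ?mulr_ge0 ?exprn_ge0.
have -> : s * (s * ricci_const n d k N) = 2^-1 * (N ^+ 2 * (n%:R * (er * s ^+ 2))
    + s * (n%:R * (A + k%:R * N * B) * s)).
  by rewrite /ricci_const -/K -/c1 -/er -/A -/B; ring.
rewrite ler_pdivlMl//; nra.
Qed.

End RicciBound.

(** * Linear algebra *)

Section LinearAlgebra.
Context {R : realType}.

Definition pos_def_mx n (A : 'M[R]_n) : Prop :=
  forall u : 'rV[R]_n, u != 0 -> 0 < bform A u u.

Lemma pos_def_unitmx n (A : 'M[R]_n) : pos_def_mx A -> A \in unitmx.
Proof.
move=> pA; rewrite -row_free_unit -kermx_eq0; apply/negPn/negP => /rowV0Pn[u].
move=> /sub_kermxP uA u0; have := pA u u0.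
by rewrite bform_mulmx uA mul0mx mxE ltxx.
Qed.

(** The vector [(a + 1) *: u - b *: w] has the value [- (a + 2) * b ^+ 2], which forces [b = 0].
    Taking [a + 1] in place of the usual [a] covers the case [a = 0]. *)
Lemma semidef_kernel n (A : 'M[R]_n) u w : A^T = A ->
  (forall v, 0 <= bform A v v) -> bform A u u = 0 -> bform A u w = 0.
Proof.
move=> sA psd uu; set b := bform A u w; set a := bform A w w.
have a0 : 0 <= a by exact: psd.
have a1 : 0 < a + 1 by rewrite ltr_wpDl.
have := psd ((a + 1) *: u - b *: w).
rewrite bformBl !bformBr !bformZl !bformZr uu (bform_sym w u sA) -/a -/b => h.
have : 0 <= - (b ^+ 2 * (a + 2)) by apply: le_trans h _; rewrite le_eqVlt; apply/orP; left; apply/eqP; ring.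
rewrite oppr_ge0 pmulr_lle0 ?ltr_wpDl// => b2; apply/eqP.
by rewrite -sqrf_eq0 eq_le b2 sqr_ge0.
Qed.

(** The quotient of the two forms attains its maximum [lambda] on the compact unit sphere of the
    maximum norm and is homogeneous of degree zero. Then [lambda *: g - A] is semidefinite and
    vanishes on [u], so [u] lies in its kernel. *)
Lemma rayleigh_max n (A g : 'M[R]_n) : (0 < n)%N -> A^T = A -> g^T = g ->
  pos_def_mx g -> exists lambda u, [/\ u != 0,
    forall w, bform A u w = lambda * bform g u w &
    forall w, bform A w w <= lambda * bform g w w].
Proof.
move=> n0 sA sg pg; pose B := [set u : 'rV[R]_n | `|u| = 1].
have B_neq0 u : B u -> u != 0 by move=> Bu; rewrite -normr_eq0 Bu oner_eq0.
have unit_u (w : 'rV[R]_n) : w != 0 -> B (`|w|^-1 *: w).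
  by move=> w0; rewrite /B /= normrZ normfV normr_id mulVf// normr_eq0.
have B0 : B !=set0.
  exists (`|const_mx 1 : 'rV[R]_n|^-1 *: const_mx 1); apply: unit_u.
  apply/eqP => /rowP/(_ (Ordinal n0)); rewrite !mxE => /eqP.
  by rewrite oner_eq0.
have cB : compact B.
  apply: bounded_closed_compact.
    by exists 1; split=> // x x1 u /= ->; exact: ltW.
  rewrite (_ : B = (fun u : 'rV[R]_n => `|u|) @^-1` [set 1])//.
  apply: closed_comp; last exact: closed_eq.
  by move=> u _; exact: norm_continuous.
have cont M : continuous (fun u : 'rV[R]_n => bform M u u).
  move=> u; apply: differentiable_continuous.
  by apply: differentiable_bform => //; exact: differentiable_cst.
have [|u] := @EVT_max_rV R n (fun u => bform A u u / bform g u u) B B0 cB.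
  apply: continuous_in_subspaceT => u /set_mem Bu.
  have gu0 : bform g u u != 0 by rewrite gt_eqF// pg// B_neq0.
  exact: (continuousM (cont A u) (continuousV gu0 (cont g u))).
move=> /set_mem Bu umax; have u0 := B_neq0 _ Bu.
pose lambda := bform A u u / bform g u u.
have le_l w : bform A w w <= lambda * bform g w w.
  have [->|w0] := eqVneq w 0; first by rewrite !bform0l mulr0.
  have := umax (`|w|^-1 *: w) (mem_set (unit_u _ w0)).
  rewrite !bformZl !bformZr -/lambda.
  have nw : `|w|^-1 != 0 by rewrite invr_neq0// normr_eq0.
  by rewrite -!mulf_div divff// !mul1r ler_pdivrMr// pg.
exists lambda, u; split=> // w; apply/eqP; rewrite -subr_eq0 -oppr_eq0 opprB.
rewrite -bformZm -bformNm -bformDm; apply/eqP; apply: semidef_kernel.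
- by rewrite linearB linearZ /= sA sg.
- by move=> v; rewrite bformDm bformNm bformZm subr_ge0.
- rewrite bformDm bformNm bformZm /lambda divfK ?subrr// gt_eqF// pg//.
Qed.

(** Induction on the size: [P1] clears the first row and column, the Schur complement [D1] inherits
    symmetry and positivity, and the first diagonal entry is normalized by its square root. *)
Lemma cholesky n (A : 'M[R]_n) : A^T = A -> pos_def_mx A ->
  exists2 P : 'M[R]_n, P \in unitmx & P *m A *m P^T = 1%:M.
Proof.
elim: n A => [|n IH] A sA pA.
  by exists 1%:M; rewrite ?unitmx1//; apply/matrixP => -[].
move: A sA pA; rewrite -[n.+1]/(1 + n)%N => A sA pA.
pose a := ulsubmx A; pose b := ursubmx A; pose D := drsubmx A.
have EA : A = block_mx a b b^T D.
  by rewrite -[LHS]submxK -/a -/b -/D; congr block_mx; rewrite /b trmx_ursub sA.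
have sa : a^T = a by rewrite /a trmx_ulsub sA.
have sD : D^T = D by rewrite /D trmx_drsub sA.
pose t := a 0 0.
have at0 : a = t%:M by rewrite [LHS]mx11_scalar.
have t0 : 0 < t.
  have := pA (row_mx 1 0); rewrite row_mx_eq0 oner_eq0 => /(_ isT).
  rewrite bform_mulmx EA mul_row_block tr_row_mx mul_row_col !mul1mx !mul0mx.
  by rewrite !addr0 trmx1 mulmx1 trmx0 mulmx0 addr0.
pose P1 : 'M[R]_(1 + n) := block_mx 1%:M 0 (- t^-1 *: b^T) 1%:M.
pose D1 := D - t^-1 *: (b^T *m b).
have E1 : P1 *m A *m P1^T = block_mx a 0 0 D1.
  have P1T : P1^T = block_mx 1%:M (- t^-1 *: b) 0 1%:M.
    by rewrite /P1 tr_block_mx !trmx1 trmx0 linearZ /= trmxK.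
  have ta : - t^-1 *: b^T *m a + 1%:M *m b^T = 0.
    rewrite at0 mul_mx_scalar mul1mx scalerA mulrN divff ?gt_eqF//.
    by rewrite scaleN1r addNr.
  have tb : a *m (- t^-1 *: b) + b = 0.
    rewrite at0 mul_scalar_mx scalerA mulrN divff ?gt_eqF//.
    by rewrite scaleN1r addNr.
  rewrite P1T EA /P1 !mulmx_block !mul1mx !mul0mx !mulmx1 !mulmx0 !addr0.
  rewrite mul1mx in ta; rewrite ta tb mul0mx add0r; congr block_mx.
  by rewrite /D1 -scalemxAl scaleNr addrC.
have uP1 : P1 \in unitmx.
  by rewrite unitmxE /P1 det_lblock !det1 mulr1 unitr1.
have pD1 : pos_def_mx D1.
  move=> u u0; have := pA (row_mx 0 u *m P1).
  have -> : bform A (row_mx 0 u *m P1) (row_mx 0 u *m P1) = bform D1 u u.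
    rewrite -bform_congr E1 !bform_mulmx mul_row_block tr_row_mx mul_row_col.
    by rewrite !mul0mx !mulmx0 !add0r trmx0 mulmx0 add0r.
  apply; apply: contra_neq u0 => /(congr1 (mulmx^~ (invmx P1))).
  rewrite mulmxK// mul0mx => /(congr1 rsubmx).
  by rewrite row_mxKr linear0.
have sD1 : D1^T = D1.
  by rewrite /D1 linearB linearZ /= trmx_mul trmxK sD.
have [Q uQ EQ] := IH D1 sD1 pD1.
have st : Num.sqrt t ^+ 2 = t by rewrite sqr_sqrtr// ltW.
have st0 : Num.sqrt t != 0 by rewrite sqrtr_eq0 -ltNge.
pose P2 : 'M[R]_(1 + n) := block_mx (Num.sqrt t)^-1%:M 0 0 Q.
exists (P2 *m P1).
  rewrite unitmx_mul uP1 andbT unitmxE det_ublock unitrM -!unitmxE uQ andbT.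
  by rewrite unitmxE det_scalar expr1 unitfE invr_eq0.
have -> : P2 *m P1 *m A *m (P2 *m P1)^T = P2 *m (P1 *m A *m P1^T) *m P2^T.
  by rewrite trmx_mul !mulmxA.
have P2T : P2^T = block_mx (Num.sqrt t)^-1%:M 0 0 Q^T.
  by rewrite /P2 tr_block_mx !trmx0 tr_scalar_mx.
rewrite E1 P2T /P2 !mulmx_block !(mulmx0, mul0mx, addr0, add0r).
rewrite EQ at0 -!scalar_mxM scalar_mx_block.
by congr (block_mx _%:M _ _ _); rewrite -[X in _ * X * _]st; field.
Qed.

(** A dimension count. If [nu] were positive, the rows of [p] with [nu] would span a positive
    definite space of dimension [n + 1], too large to avoid the negative definite space spanned by
    the last [m] rows of [P]. *)
Lemma normal_semidef n m (G P : 'M[R]_(n + m)) (p : 'M[R]_(n, n + m)) nu :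
  P *m G *m P^T = block_mx 1%:M 0 0 (- 1%:M) -> G^T = G ->
  p *m G *m p^T = 1%:M -> nu *m G *m p^T = 0 -> bform G nu nu <= 0.
Proof.
move=> EP sG Ep En; rewrite leNgt; apply/negP => nu0.
pose Q := dsubmx P.
have EQ : Q *m G *m Q^T = - 1%:M.
  have := congr1 drsubmx EP; rewrite block_mxKdr => <-.
  by rewrite -{1 2}[P]vsubmxK tr_col_mx mul_col_mx mul_col_row block_mxKdr.
pose M := col_mx (col_mx p nu) Q.
(* [M] has one row more than it has columns, so its rows satisfy a nontrivial linear relation
   [c]. *)
have : kermx M != 0.
  rewrite -mxrank_eq0 mxrank_ker -lt0n subn_gt0.
  by apply: leq_ltn_trans (rank_leq_col M) _; rewrite ltn_add2r addn1.
move=> /rowV0Pn[c /sub_kermxP cM c0].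
pose c1 := lsubmx (lsubmx c); pose c2 := rsubmx (lsubmx c); pose c3 := rsubmx c.
have Ec : c = row_mx (row_mx c1 c2) c3 by rewrite !hsubmxK.
have E0 : c1 *m p + c2 *m nu = - (c3 *m Q).
  by apply/eqP; rewrite -addr_eq0 -!mul_row_col -Ec cM.
have sq k (v : 'rV[R]_k) : (v *m v^T) 0 0 = \sum_i v 0 i ^+ 2.
  by rewrite mxE; apply: eq_bigr => i _; rewrite mxE expr2.
have sq0 k (v : 'rV[R]_k) : \sum_i v 0 i ^+ 2 = 0 -> v = 0.
  move=> /eqP; rewrite psumr_eq0 => [/allP h|i _]; last exact: sqr_ge0.
  apply/rowP => i; rewrite mxE; apply/eqP; rewrite -sqrf_eq0.
  by have := h i; rewrite mem_index_enum => /(_ isT).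
have ge0 k (v : 'rV[R]_k) : 0 <= \sum_i v 0 i ^+ 2.
  by rewrite sumr_ge0// => i _; exact: sqr_ge0.
have H1 : bform G (c3 *m Q) (c3 *m Q) = - \sum_i c3 0 i ^+ 2.
  by rewrite -bform_congr EQ bform_mulmx mulmxN mulmx1 mulNmx mxE sq.
have H2 : bform G (c1 *m p + c2 *m nu) (c1 *m p + c2 *m nu) =
    \sum_i c1 0 i ^+ 2 + c2 0 0 ^+ 2 * bform G nu nu.
  have -> : c2 *m nu = c2 0 0 *: nu by rewrite {1}[c2]mx11_scalar mul_scalar_mx.
  have En' : bform G nu (c1 *m p) = 0.
    by rewrite bform_mulmx trmx_mul mulmxA En mul0mx mxE.
  have Ep' : bform G (c1 *m p) (c1 *m p) = \sum_i c1 0 i ^+ 2.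
    by rewrite -bform_congr Ep bform_mulmx mulmx1 sq.
  rewrite !bformDl !bformDr !bformZl !bformZr Ep' (bform_sym (c1 *m p) nu sG) En'.
  by rewrite !mulr0 addr0 add0r mulrA expr2.
have : bform G (c1 *m p + c2 *m nu) (c1 *m p + c2 *m nu) = - \sum_i c3 0 i ^+ 2.
  by rewrite E0 bformNl bformNr opprK H1.
rewrite H2 => /eqP; rewrite -addr_eq0 => /eqP H.
have c20 : 0 <= c2 0 0 ^+ 2 * bform G nu nu by rewrite mulr_ge0 ?sqr_ge0 ?ltW.
have h1 : \sum_i c1 0 i ^+ 2 = 0.
  by apply/eqP; rewrite eq_le ge0 andbT; have := ge0 _ c3; have := ge0 _ c1; lra.
have h3 : \sum_i c3 0 i ^+ 2 = 0.
  by apply/eqP; rewrite eq_le ge0 andbT; have := ge0 _ c3; have := ge0 _ c1; lra.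
have h2 : c2 0 0 = 0.
  apply/eqP; rewrite -sqrf_eq0; have : c2 0 0 ^+ 2 * bform G nu nu = 0 by lra.
  by move/eqP; rewrite mulf_eq0 (gt_eqF nu0) orbF.
move/eqP: c0; apply; rewrite Ec (sq0 _ _ h1) (sq0 _ _ h3).
have -> : c2 = 0 by apply/rowP => i; rewrite ord1 h2 mxE.
by rewrite !row_mx0.
Qed.

End LinearAlgebra.

(** * Charts and tensors *)

Section Charts.
Context {R : realType}.

Lemma row_jacobian (a b : nat) (F : 'rV[R]_a -> 'rV[R]_b) y i :
  differentiable F y -> row i (jacobian F y) = dder (basis_vec i) F y.
Proof. by move=> dF; rewrite rowE dder_jacobian. Qed.

Lemma jacobian_comp (a b c : nat) (F : 'rV[R]_a -> 'rV[R]_b) (H : 'rV[R]_b -> 'rV[R]_c) y :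
  differentiable F y -> differentiable H (F y) ->
  jacobian (H \o F) y = jacobian F y *m jacobian H (F y).
Proof.
move=> dF dH; have dHF : differentiable (H \o F) y by exact: differentiable_comp.
apply/row_matrixP => i; apply: etrans (row_jacobian i dHF) _.
apply: etrans (dder_comp (basis_vec i) dF dH) _.
by rewrite row_mul (row_jacobian i dF) dder_jacobian.
Qed.

Lemma jacobian_near (a b : nat) (F H : 'rV[R]_a -> 'rV[R]_b) U y : open U -> U y ->
  (forall z, U z -> F z = H z) -> differentiable F y ->
  jacobian F y = jacobian H y.
Proof.
move=> oU Uy FH dF; have dH := open_differentiable oU Uy FH dF.
apply/row_matrixP => i; apply: etrans (row_jacobian i dF) _.
apply: etrans _ (esym (row_jacobian i dH)); exact: (dder_near _ oU Uy FH).
Qed.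

Lemma jacobian_mulmxr (a b : nat) (A : 'M[R]_(a, b)) y :
  jacobian (fun z : 'rV[R]_a => z *m A) y = A.
Proof.
apply/row_matrixP => i; rewrite (row_jacobian i (differentiable_mulmxr A y)).
by rewrite dder_mulmxr rowE.
Qed.

Lemma smooth_on_subset (d : nat) (W : normedModType R) (U V : set 'rV[R]_d)
    (f : 'rV[R]_d -> W) : U `<=` V -> smooth_on V f -> smooth_on U f.
Proof. by move=> UV sf s y /UV; exact: sf. Qed.

Section Transitions.
Context {d : nat} (M : manifold R d).
Implicit Types (c : chart R M d) (p : M) (W : set M).

Lemma open_chart_image c W : open W -> open (cmap c @` (cdom c `&` W)).
Proof.
move=> oW; rewrite openE => _ [p [cp Wp] <-].
have oi : (cmap c @` cdom c) (cmap c p) by exists p.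
have nW : nbhs (cinv c (cmap c p)) W by rewrite cmapK//; exact: open_nbhs_nbhs.
have nWi : nbhs (cmap c p) (cinv c @^-1` W) := continuous_cinv oi nW.
have nD : nbhs (cmap c p) (cmap c @` cdom c).
  by apply: open_nbhs_nbhs; split; first exact: open_cmap.
suff : nbhs (cmap c p) (cmap c @` (cdom c `&` W)) by [].
apply: (filterS _ (filterI nWi nD)) => y [Wy [q cq qy]]; exists q => //; split=> //.
by move: Wy; rewrite /= -qy (cmapK cq).
Qed.

Lemma transition_smooth_on c c' : atlas c -> atlas c' ->
  smooth_on (cmap c @` (cdom c `&` cdom c')) (cmap c' \o cinv c).
Proof. by move=> ac ac'; have [] := (atlas_maximal c).1 ac c' ac'. Qed.

Lemma transition_diff p c c' : chart_near p c -> chart_near p c' ->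
  differentiable (cmap c' \o cinv c) (cmap c p).
Proof.
move=> [ac cp] [ac' cp'].
by apply: smooth_on_diff (transition_smooth_on ac ac') _; exists p.
Qed.

Lemma jacobian_transition p c c' c'' :
  chart_near p c -> chart_near p c' -> chart_near p c'' ->
  jacobian (cmap c'' \o cinv c) (cmap c p) =
  jacobian (cmap c' \o cinv c) (cmap c p) *m
  jacobian (cmap c'' \o cinv c') (cmap c' p).
Proof.
move=> n1 n2 n3; have [_ cp] := n1; have [_ cp'] := n2; have [_ cp''] := n3.
have E : (cmap c' \o cinv c) (cmap c p) = cmap c' p by rewrite /= cmapK.
rewrite -[in RHS]E -jacobian_comp; [|exact: transition_diff|]; last first.
  by rewrite E; exact: transition_diff.
have oU := @open_chart_image c _ (@open_cdom _ _ _ c').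
apply: (@jacobian_near _ _ _ _ (cmap c @` (cdom c `&` cdom c'))) => //.
- by exists p.
- by move=> _ [q [cq cq'] <-] /=; rewrite !cmapK.
- exact: transition_diff.
Qed.

Lemma jacobian_transition_id p c : chart_near p c ->
  jacobian (cmap c \o cinv c) (cmap c p) = 1%:M.
Proof.
move=> [ac cp]; rewrite -[RHS](jacobian_mulmxr 1%:M (cmap c p)); symmetry.
apply: (jacobian_near (@open_cmap _ _ _ c)); first by exists p.
  by move=> _ [q cq <-] /=; rewrite mulmx1 cmapK.
exact: differentiable_mulmxr.
Qed.

Definition tangent_of c p (u : 'rV[R]_d) : tvec M :=
  fun x => u *m jacobian (cmap x \o cinv c) (cmap c p).

Lemma tangent_ofP c p u : chart_near p c -> is_tangent p (tangent_of c p u).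
Proof.
move=> nc x x' nx nx'; rewrite /tangent_of -mulmxA.
by rewrite -(jacobian_transition nc nx nx').
Qed.

Lemma tangent_ofK c p u : chart_near p c -> tangent_of c p u c = u.
Proof. by move=> nc; rewrite /tangent_of jacobian_transition_id// mulmx1. Qed.

Lemma chart_atP p : chart_near p (chart_at p).
Proof. by rewrite /chart_at; case: cid. Qed.

Lemma tensor_valE (T : sym_tensor M) c p v w : chart_near p c ->
  is_tangent p v -> is_tangent p w ->
  tensor_val T p v w = bform (tcomp T c p) (v c) (w c).
Proof.
move=> nc tv tw; have n0 := chart_atP p.
rewrite (tv _ _ n0 nc) (tw _ _ n0 nc) -bform_congr -tcomp_law//.
by rewrite bform_mulmx.
Qed.

Section LinearChart.
Context (c : chart R M d) (A : 'M[R]_d) (uA : A \in unitmx).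

Let lmap p := cmap c p *m A.
Let linv y := cinv c (y *m invmx A).

Lemma continuous_mulmxr (B : 'M[R]_d) : continuous (fun y : 'rV[R]_d => y *m B).
Proof.
by move=> y; apply: differentiable_continuous; exact: differentiable_mulmxr.
Qed.

Lemma lmap_image (W : set M) :
  lmap @` W = (fun y => y *m invmx A) @^-1` (cmap c @` W).
Proof.
apply/seteqP; split=> [_ [p Wp <-] /=|y [p Wp py]].
  by exists p => //; rewrite /lmap mulmxK.
by exists p => //; rewrite /lmap py mulmxKV.
Qed.

Lemma open_lmap_image (W : set M) : open W -> open (lmap @` (cdom c `&` W)).
Proof.
move=> oW; rewrite lmap_image; apply: open_comp; last exact: open_chart_image.
by move=> y _; exact: continuous_mulmxr.
Qed.

Fact linear_chart_open : open (lmap @` cdom c).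
Proof. by rewrite -[cdom c]setIT; apply: open_lmap_image; exact: openT. Qed.

Fact linear_chartK p : cdom c p -> linv (lmap p) = p.
Proof. by move=> cp; rewrite /linv /lmap mulmxK// cmapK. Qed.

Fact linear_chart_cmap p : cdom c p -> {for p, continuous lmap}.
Proof.
move=> cp; apply: (@continuous_comp _ _ _ (cmap c) (fun y => y *m A)).
  exact: continuous_cmap.
exact: continuous_mulmxr.
Qed.

Fact linear_chart_cinv y : (lmap @` cdom c) y -> {for y, continuous linv}.
Proof.
rewrite lmap_image => cy.
have cA : {for y, continuous (fun z : 'rV[R]_d => z *m invmx A)}.
  exact: continuous_mulmxr.
by have := continuous_comp cA (continuous_cinv cy).
Qed.

(** Normalizes data at one point: it makes a positive definite tensor the identity in
    [normal_chart], and a frame the standard basis in [adapted_chart]. *)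
Definition linear_chart : chart R M d :=
  Chart (@open_cdom _ _ _ c) linear_chart_open linear_chartK linear_chart_cmap
    linear_chart_cinv.

(** Maximality of the atlas reduces membership to compatibility with every chart, which a linear
    change of coordinates preserves. *)
Lemma linear_chart_atlas : atlas c -> atlas linear_chart.
Proof.
move=> ac; apply/atlas_maximal => c' ac'; split.
  rewrite /transition_smooth /=.
  have -> : (cmap c' \o linv) = (fun y => (cmap c' \o cinv c) (y *m invmx A)) by [].
  apply: (smooth_on_comp_mx _ _ _ _ (transition_smooth_on ac ac')).
  - exact: (open_lmap_image (@open_cdom _ _ _ c')).
  - exact: open_chart_image (@open_cdom _ _ _ c').
  - apply: smooth_on_mulmxr; exact: (open_lmap_image (@open_cdom _ _ _ c')).
  - by move=> y; rewrite lmap_image.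
rewrite /transition_smooth /=.
have oO := @open_chart_image c' _ (@open_cdom _ _ _ c).
have := smooth_on_mulmxr (@openT _) A => sA.
exact: (smooth_on_comp_mx oO (@openT _) (transition_smooth_on ac' ac) (fun _ _ => I) sA).
Qed.

Lemma linear_chart_near p : chart_near p c -> chart_near p linear_chart.
Proof. by case=> ac cp; split=> //; exact: linear_chart_atlas. Qed.

Lemma jacobian_linear_chart p : chart_near p c ->
  jacobian (cmap linear_chart \o cinv c) (cmap c p) = A.
Proof.
move=> [ac cp]; rewrite -[RHS](jacobian_mulmxr A (cmap c p)); symmetry.
apply: (jacobian_near (@open_cmap _ _ _ c)); first by exists p.
  by move=> _ [q cq <-] /=; rewrite /lmap cmapK.
exact: differentiable_mulmxr.
Qed.

End LinearChart.

End Transitions.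

End Charts.

Section TensorsInCharts.
Context {R : realType} {d : nat} (M : manifold R d).

Lemma tvec_nonzero_chart c (p : M) (v : tvec M) : chart_near p c ->
  is_tangent p v -> tvec_nonzero p v -> v c != 0.
Proof.
move=> nc tv [c' [nc' v0]]; apply: contra_neq v0 => vc.
by rewrite (tv _ _ nc nc') vc mul0mx.
Qed.

Lemma pos_def_tensor (T : sym_tensor M) c p : pos_def (tensor_val T) ->
  chart_near p c -> pos_def_mx (tcomp T c p).
Proof.
move=> pT nc u u0; have tu := tangent_ofP u nc.
have := pT p _ tu; rewrite (tensor_valE T nc tu tu) tangent_ofK//; apply.
by exists c; split=> //; rewrite tangent_ofK.
Qed.

(** The Jacobian of the linear change is the inverse of the Cholesky factor. Applied to [Shat], this
    makes the set behind [C2norm] nonempty. *)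
Lemma normal_chart (T : sym_tensor M) p : pos_def (tensor_val T) ->
  exists c, chart_near p c /\ tcomp T c p = 1%:M.
Proof.
move=> pT; have n0 := chart_atP p; set c0 := chart_at p in n0.
have [P uP EP] := cholesky (tcomp_sym T n0) (pos_def_tensor pT n0).
have uV : invmx P \in unitmx by rewrite unitmx_inv.
exists (linear_chart c0 uV); have nl := linear_chart_near uV n0; split=> //.
have := tcomp_law T n0 nl; rewrite jacobian_linear_chart// => E.
rewrite -EP E !mulmxA mulmxV// mul1mx -mulmxA -trmx_mul mulmxV// trmx1 mulmx1//.
Qed.

(** The value [mu] is an eigenvalue because of [u], and it bounds every other eigenvalue when the
    inequality of forms is tested on an eigenvector. *)
Lemma largest_eigenvalueE (g B : form_field M) p x (Mg MB : 'M[R]_d) mu u :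
  chart_near p x ->
  (forall v w, is_tangent p v -> is_tangent p w -> g p v w = bform Mg (v x) (w x)) ->
  (forall v w, is_tangent p v -> is_tangent p w -> B p v w = bform MB (v x) (w x)) ->
  pos_def_mx Mg -> u != 0 ->
  (forall w, bform MB u w = mu * bform Mg u w) ->
  (forall w, bform MB w w <= mu * bform Mg w w) ->
  largest_eigenvalue g B p = mu.
Proof.
move=> nx Eg EB pg u0 Eu ub; have tu := tangent_ofP u nx.
have mem : [set lambda | is_eigenvalue g B p lambda] mu.
  exists (tangent_of x p u); split=> //.
    by exists x; split=> //; rewrite tangent_ofK.
  by move=> w tw; rewrite EB// Eg// tangent_ofK.
have upper : ubound [set lambda | is_eigenvalue g B p lambda] mu.
  move=> lambda [v [tv v0 Ev]]; have vx := tvec_nonzero_chart nx tv v0.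
  have := ub (v x); rewrite -EB// Ev// Eg// ler_pM2r//; exact: pg.
apply/eqP; rewrite eq_le; apply/andP; split.
  by apply: ge_sup => //; exists mu.
by apply: ub_le_sup => //; exists mu.
Qed.

(** Replaces eigenvalues by inequalities between quadratic forms. The scaling rule extracts the
    power of [phi], including points where [phi] vanishes, since the eigenvector found for [B]
    serves for all multiples. *)
Lemma form_le_largest_eigenvalue (g B : form_field M) p x (Mg MB : 'M[R]_d) :
  (0 < d)%N -> chart_near p x ->
  (forall v w, is_tangent p v -> is_tangent p w -> g p v w = bform Mg (v x) (w x)) ->
  (forall v w, is_tangent p v -> is_tangent p w -> B p v w = bform MB (v x) (w x)) ->
  Mg^T = Mg -> MB^T = MB -> pos_def_mx Mg ->
  (forall w, bform MB w w <= largest_eigenvalue g B p * bform Mg w w) /\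
  forall (f : R), 0 <= f ->
    largest_eigenvalue g (fun q v w => f * B q v w) p = f * largest_eigenvalue g B p.
Proof.
move=> d0 nx Eg EB sg sB pg.
have [lambda [u [u0 Eu ub]]] := rayleigh_max d0 sB sg pg.
rewrite (largest_eigenvalueE nx Eg EB pg u0 Eu ub); split=> // f f0.
apply: (largest_eigenvalueE (MB := f *: MB) nx Eg _ pg u0).
- by move=> v w tv tw; rewrite bformZm EB.
- by move=> w; rewrite bformZm Eu mulrA.
- by move=> w; rewrite bformZm -mulrA ler_wpM2l.
Qed.

End TensorsInCharts.

(** * Restriction of vectors and tensors to a submanifold *)

Section Submanifolds.
Context {R : realType} {n d : nat} (M : manifold R n) (Mhat : manifold R d).
Context (iota : M -> Mhat) (subm : is_submanifold iota).
Implicit Types (x : chart R M n) (y : chart R Mhat d) (p : M).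

Definition chart_overlap x y : set 'rV[R]_n :=
  cmap x @` (cdom x `&` iota @^-1` cdom y).

Lemma open_chart_overlap x y : open (chart_overlap x y).
Proof.
apply: (@open_chart_image _ _ _ x); apply: open_comp; last exact: open_cdom.
by have [_ ci _ _] := subm; move=> q _; exact: ci.
Qed.

Lemma smooth_on_map_coord x y : atlas x -> atlas y ->
  smooth_on (chart_overlap x y) (map_coord iota x y).
Proof. by have [_ _ sm _] := subm; exact: sm. Qed.

Lemma chart_overlap_near p x y : chart_near p x -> chart_near (iota p) y ->
  chart_overlap x y (cmap x p).
Proof. by move=> [_ xp] [_ yp]; exists p. Qed.

Lemma map_coordE p x y : chart_near p x ->
  map_coord iota x y (cmap x p) = cmap y (iota p).
Proof. by move=> [_ xp]; rewrite /map_coord /= cmapK. Qed.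

Lemma map_coord_diff p x y : chart_near p x -> chart_near (iota p) y ->
  differentiable (map_coord iota x y) (cmap x p).
Proof.
move=> nx ny; have [ax _] := nx; have [ay _] := ny.
exact: smooth_on_diff (smooth_on_map_coord ax ay) (chart_overlap_near nx ny).
Qed.

Lemma jacobian_map_coordr p x y y' : chart_near p x ->
  chart_near (iota p) y -> chart_near (iota p) y' ->
  jacobian (map_coord iota x y') (cmap x p) =
  jacobian (map_coord iota x y) (cmap x p) *m
  jacobian (cmap y' \o cinv y) (cmap y (iota p)).
Proof.
move=> nx ny ny'; have dF := map_coord_diff nx ny.
have dT := transition_diff ny ny'.
rewrite -(map_coordE y nx) in dT *; rewrite -(jacobian_comp dF dT).
apply: (jacobian_near (@open_chart_overlap x y)).
- exact: chart_overlap_near.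
- by move=> _ [q [xq yq] <-]; rewrite /map_coord /= !cmapK.
- exact: map_coord_diff.
Qed.

Lemma jacobian_map_coordl p x x' y : chart_near p x -> chart_near p x' ->
  chart_near (iota p) y ->
  jacobian (map_coord iota x y) (cmap x p) =
  jacobian (cmap x' \o cinv x) (cmap x p) *m
  jacobian (map_coord iota x' y) (cmap x' p).
Proof.
move=> nx nx' ny; have [_ xp] := nx; have [_ xp'] := nx'; have [_ yp] := ny.
have dF := map_coord_diff nx' ny; have dT := transition_diff nx nx'.
have E : (cmap x' \o cinv x) (cmap x p) = cmap x' p by rewrite /= cmapK.
rewrite -E in dF *; rewrite -(jacobian_comp dT dF).
apply: (jacobian_near (@open_chart_image _ _ _ x _ (@open_cdom _ _ _ x'))).
- by exists p.
- by move=> _ [q [xq xq'] <-]; rewrite /map_coord /= !cmapK.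
- exact: map_coord_diff.
Qed.

Lemma tvec_pushE p x y v : chart_near p x -> chart_near (iota p) y ->
  is_tangent p v ->
  tvec_push iota p v y = v x *m jacobian (map_coord iota x y) (cmap x p).
Proof.
move=> nx ny tv; rewrite /tvec_push /= (jacobian_map_coordl (chart_atP p) nx ny).
by rewrite mulmxA -tv//; exact: chart_atP.
Qed.

Lemma tvec_push_tangent p v : is_tangent p v ->
  is_tangent (iota p) (tvec_push iota p v).
Proof.
move=> tv y y' ny ny'; rewrite /tvec_push /=.
by rewrite (jacobian_map_coordr (chart_atP p) ny ny') mulmxA.
Qed.

Definition restrict_mx (T : sym_tensor Mhat) x y p : 'M[R]_n :=
  let J := jacobian (map_coord iota x y) (cmap x p) in
  J *m tcomp T y (iota p) *m J^T.

Lemma restrict_formE (T : sym_tensor Mhat) p x y v w : chart_near p x ->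
  chart_near (iota p) y -> is_tangent p v -> is_tangent p w ->
  restrict_form iota T p v w = bform (restrict_mx T x y p) (v x) (w x).
Proof.
move=> nx ny tv tw; rewrite /restrict_form /restrict_mx /= bform_congr.
rewrite (tensor_valE T ny (tvec_push_tangent tv) (tvec_push_tangent tw)).
by rewrite !(tvec_pushE nx ny).
Qed.

Lemma restrict_mx_sym (T : sym_tensor Mhat) p x y : chart_near (iota p) y ->
  (restrict_mx T x y p)^T = restrict_mx T x y p.
Proof.
move=> ny; rewrite /restrict_mx /= !trmx_mul trmxK (tcomp_sym T ny).
by rewrite mulmxA.
Qed.

Lemma restrict_mx_pos_def (T : sym_tensor Mhat) p x y :
  pos_def (restrict_form iota T) -> chart_near p x -> chart_near (iota p) y ->
  pos_def_mx (restrict_mx T x y p).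
Proof.
move=> pT nx ny u u0; have tu := tangent_ofP u nx.
have := pT p _ tu; rewrite (restrict_formE T nx ny tu tu) tangent_ofK//; apply.
by exists x; split=> //; rewrite tangent_ofK.
Qed.

End Submanifolds.

Section C2Bounds.
Context {R : realType} {d : nat}.

Lemma C2size_bound (f : 'rV[R]_d -> R) y N : C2size f y <= N ->
  [/\ `|f y| <= N, forall i, `|dder (basis_vec i) f y| <= N &
    forall i j, `|dder (basis_vec i) (dder (basis_vec j) f) y| <= N].
Proof.
rewrite /C2size !ge_max => /andP[h0 /andP[h1 h2]]; split=> // [i|i j].
  rewrite -pderiveE; apply: le_trans h1.
  exact: (le_bigmax _ (fun i => `|pderive i f y|)).
rewrite -!pderiveE; apply: le_trans h2.
apply: le_trans (le_bigmax _ (fun i => \big[Num.max/0]_(j < d)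
  `|pderive i (pderive j f) y|) i).
exact: (le_bigmax _ (fun j => `|pderive i (pderive j f) y|)).
Qed.

Lemma C2size_mx_bound (A : 'rV[R]_d -> 'M[R]_d) y N : C2size_mx A y <= N ->
  forall i j, C2size (fun z => A z i j) y <= N.
Proof.
move=> AN i j; apply: le_trans AN.
apply: le_trans (le_bigmax _ (fun i => \big[Num.max/0]_(j < d)
  C2size (fun z => A z i j) y) i).
exact: (le_bigmax _ (fun j => C2size (fun z => A z i j) y)).
Qed.

End C2Bounds.

Section RiemannInCharts.
Context {R : realType} {d : nat} (M : manifold R d) (g : sym_tensor M).
Hypothesis unitg : forall c (p : M), chart_near p c -> tcomp g c p \in unitmx.

Lemma tcoordE c p : chart_near p c -> tcoord g c (cmap c p) = tcomp g c p.
Proof. by move=> [_ cp]; rewrite /tcoord cmapK. Qed.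

Lemma tcoord_sym c y : atlas c -> (cmap c @` cdom c) y ->
  (tcoord g c y)^T = tcoord g c y.
Proof. by move=> ac [p cp <-]; rewrite tcoordE// tcomp_sym. Qed.

Lemma tcoord_unit c y : atlas c -> (cmap c @` cdom c) y ->
  tcoord g c y \in unitmx.
Proof. by move=> ac [p cp <-]; rewrite tcoordE// unitg. Qed.

(** The definition evaluates the curvature in an unspecified chart; the estimate is made in a chart
    chosen for the size of its components. *)
Lemma riemannE c p u v w z : chart_near p c -> is_tangent p u ->
  is_tangent p v -> is_tangent p w -> is_tangent p z ->
  riemann g p u v w z =
  riemann_coord (tcoord g c) (cmap c p) (u c) (v c) (w c) (z c).
Proof.
move=> nc tu tv tw tz; have n0 := chart_atP p; rewrite /riemann /=.
rewrite (tu _ _ n0 nc) (tv _ _ n0 nc) (tw _ _ n0 nc) (tz _ _ n0 nc).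
set c0 := chart_at p in n0 *; have [a0 d0] := n0; have [ac dc] := nc.
pose O := cmap c0 @` (cdom c0 `&` cdom c).
have oO : open O by apply: (@open_chart_image _ _ _ c0); exact: open_cdom.
have OV y : O y -> (cmap c0 @` cdom c0) y by move=> [q [q0 _] <-]; exists q.
have sG : smooth_on O (tcoord g c0) := smooth_on_subset OV (tcomp_smooth g a0).
have TOV y : O y -> (cmap c @` cdom c) ((cmap c \o cinv c0) y).
  by move=> [q [q0 qc] <-]; exists q => //=; rewrite cmapK.
have GH y : O y -> tcoord g c0 y = induced_metric (tcoord g c) (cmap c \o cinv c0) y.
  move=> [q [q0 qc] <-]; have nq0 : chart_near q c0 by [].
  have nqc : chart_near q c by [].
  rewrite tcoordE// (tcomp_law g nq0 nqc) /induced_metric /=.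
  by rewrite cmapK// tcoordE.
have E : (cmap c \o cinv c0) (cmap c0 p) = cmap c p by rewrite /= cmapK.
rewrite -E; apply: (riemann_coord_push oO (@open_cmap _ _ _ c) (transition_smooth_on a0 ac)
  TOV sG (fun y Oy => tcoord_sym a0 (OV y Oy)) (fun y Oy => tcoord_unit a0 (OV y Oy))
  (tcomp_smooth g ac) (fun y => @tcoord_sym c y ac) (fun y => @tcoord_unit c y ac) GH).
by exists p.
Qed.

End RiemannInCharts.

Lemma signature_unitmx (R : realType) (n m : nat) (M : manifold R (n + m))
    (g : sym_tensor M) c (p : M) : has_signature g -> chart_near p c ->
  tcomp g c p \in unitmx.
Proof.
move=> sg nc; have [P [uP E]] := sg p c nc.
have : P *m tcomp g c p *m P^T \in unitmx.
  (* The block matrix is its own inverse. *)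
  rewrite E; apply: (@mulmx1_unit _ _ _ (block_mx 1%:M 0 0 (- 1%:M)) _).1.
  rewrite mulmx_block !(mulmx0, mul0mx, mul1mx, mulmx1, addr0, add0r).
  by rewrite mulNmx mulmxN opprK mul1mx -scalar_mx_block.
by rewrite !unitmx_mul => /andP[/andP[]].
Qed.

(** * The curvature bound *)

Section MainEstimate.
Context {R : realType} {n m : nat}.
Context (Mhat : manifold R (n + m)) (M : manifold R n).
Context (ghat Shat : sym_tensor Mhat) (phihat : Mhat -> R) (iota : M -> Mhat).
Context (p0 : M) (e : 'I_n -> tvec M) (last : 'I_n).
Hypothesis sgn : has_signature ghat.
Hypothesis subm : is_submanifold iota.
Local Notation g := (restrict_form iota ghat).
Local Notation S := (restrict_form iota Shat).
Local Notation phi := (phihat \o iota).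
Local Notation k := (2 * n - 2)%N.
Hypothesis pg : pos_def g.
Hypothesis minimal : zero_mean_curvature iota ghat.
Hypothesis pS : pos_def (tensor_val Shat).
Hypothesis sphi : smooth_fun phihat.
Hypothesis phi_ge0 : forall q, 0 <= phihat q.
Hypothesis phi0 : 0 < phi p0.
Hypothesis max_p0 : forall p,
  largest_eigenvalue g (fun q v w => phi q ^+ k * S q v w) p <=
  largest_eigenvalue g (fun q v w => phi q ^+ k * S q v w) p0.
Hypothesis te : forall i, is_tangent p0 (e i).
Hypothesis orthg : forall i j, g p0 (e i) (e j) = (i == j)%:R.
Hypothesis orthS : forall i j, i != j -> S p0 (e i) (e j) = 0.
Hypothesis Slast : S p0 (e last) (e last) = largest_eigenvalue g S p0.

(** Orthonormality makes the matrix [E] of the frame invertible, and the coordinates are changed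
    linearly by its inverse. *)
Lemma adapted_chart : exists x, chart_near p0 x /\ forall i, e i x = basis_vec i.
Proof.
have n0 := chart_atP p0; set x0 := chart_at p0 in n0.
pose E := \matrix_i e i x0.
have rE i : row i E = e i x0 by rewrite rowK.
have uE : E \in unitmx.
  have ny := chart_atP (iota p0).
  suff : E *m restrict_mx iota ghat x0 (chart_at (iota p0)) p0 *m E^T \in unitmx.
    by rewrite unitmx_mul => /andP[]; rewrite unitmx_mul => /andP[].
  suff -> : E *m restrict_mx iota ghat x0 (chart_at (iota p0)) p0 *m E^T = 1%:M.
    exact: unitmx1.
  apply/matrixP => i j; rewrite [RHS]mxE -orthg (restrict_formE subm ghat n0 ny)//.
  by rewrite -[LHS]bform_delta bform_congr /basis_vec -!rowE !rE.
have uV : invmx E \in unitmx by rewrite unitmx_inv.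
exists (linear_chart x0 uV); have nl := linear_chart_near uV n0; split=> // i.
by rewrite (te i n0 nl) jacobian_linear_chart// -rE rowE -mulmxA mulmxV// mulmx1.
Qed.

(** The ambient chart [c] carries the bounds and is normalized for [Shat], while the chart on [M] is
    normalized for the frame. In this pair the geometric hypotheses become those of
    [ricci_bound]. *)
Lemma ricci_bound_chart (c : chart R Mhat (n + m)) (N : R) : chart_near (iota p0) c ->
  tcomp Shat c (iota p0) = 1%:M ->
  C2size_mx (tcoord ghat c) (cmap c (iota p0)) <= N ->
  C2size_mx (fun y => invmx (tcoord ghat c y)) (cmap c (iota p0)) <= N ->
  C2size_mx (tcoord Shat c) (cmap c (iota p0)) <= N ->
  C2size (phihat \o cinv c) (cmap c (iota p0)) <= N ->
  \sum_(l < n) riemann ghat (iota p0) (tvec_push iota p0 (e l))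
      (tvec_push iota p0 (e last)) (tvec_push iota p0 (e l))
      (tvec_push iota p0 (e last))
    <= ricci_const n (n + m) k N * phi p0 ^- 2 * S p0 (e last) (e last).
Proof.
move=> nc S1 N1 N2 N3 N4; have [x [nx ex]] := adapted_chart.
have [ac dc] := nc; have [ax dx] := nx.
have ug c' q : chart_near q c' -> tcomp ghat c' q \in unitmx.
  exact: signature_unitmx.
pose U := chart_overlap iota x c; pose F := map_coord iota x c.
pose V := cmap c @` cdom c; pose G := tcoord ghat c; pose T := tcoord Shat c.
pose f := phihat \o cinv c; pose y0 := cmap x p0.
have n_gt0 : (0 < n)%N by exact: leq_ltn_trans (ltn_ord last).
have Fy0 : F y0 = cmap c (iota p0) by exact: map_coordE.
have Uy0 : U y0 by exact: chart_overlap_near.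
have oU : open U by exact: (@open_chart_overlap _ _ _ _ _ _ subm).
have oV : open V by exact: open_cmap.
have sF : smooth_on U F by exact: smooth_on_map_coord.
have Unear y : U y -> exists p, [/\ chart_near p x, chart_near (iota p) c,
    y = cmap x p & F y = cmap c (iota p)].
  move=> [p [xp cp] <-]; exists p; split=> //.
  by apply: map_coordE.
have FUV y : U y -> V (F y).
  by move=> /Unear[p [_ [_ cp] _ ->]]; exists (iota p).
have sG : smooth_on V G by exact: tcomp_smooth.
have symG y : V y -> (G y)^T = G y by exact: tcoord_sym.
have unitG y : V y -> G y \in unitmx by move=> Vy; exact: (tcoord_unit ug ac Vy).
have sT : smooth_on V T by exact: tcomp_smooth.
have symT y : V y -> (T y)^T = T y by exact: tcoord_sym.
have sf : smooth_on V f by exact: sphi.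
have gE y p : chart_near p x -> chart_near (iota p) c -> y = cmap x p ->
    induced_metric G F y = restrict_mx iota ghat x c p.
  move=> xp cp ->; have Fp : F (cmap x p) = cmap c (iota p) by exact: map_coordE.
  by rewrite /induced_metric Fp /G tcoordE.
have unitg y : U y -> induced_metric G F y \in unitmx.
  move=> /Unear[p [xp cp yp _]]; rewrite (gE _ _ xp cp yp).
  by apply: pos_def_unitmx; exact: restrict_mx_pos_def.
have minF y : U y -> trace_second_fundamental_form G F y = 0.
  by move=> /Unear[p [xp cp -> _]]; exact: minimal.
have dF := smooth_on_diff sF Uy0.
have pE l : dder (basis_vec l) F y0 = tvec_push iota p0 (e l) c.
  by rewrite (tvec_pushE subm nx nc (te l)) ex dder_jacobian.
have Gy0 : G (F y0) = tcomp ghat c (iota p0) by rewrite Fy0 /G tcoordE.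
have Ty0 : T (F y0) = 1%:M by rewrite Fy0 /T tcoordE.
have pushG i j : bform (G (F y0)) (dder (basis_vec i) F y0) (dder (basis_vec j) F y0)
    = (i == j)%:R.
  rewrite !pE Gy0 -orthg /restrict_form.
  by rewrite (tensor_valE ghat nc) //; exact: tvec_push_tangent.
have pushT i j : bform (T (F y0)) (dder (basis_vec i) F y0) (dder (basis_vec j) F y0)
    = S p0 (e i) (e j).
  rewrite !pE Fy0 /T tcoordE// /restrict_form.
  by rewrite (tensor_valE Shat nc) //; exact: tvec_push_tangent.
have gy0 : induced_metric G F y0 = 1%:M.
  apply/matrixP => i j; rewrite [RHS]mxE -pushG.
  by rewrite -(induced_metricE G sF _ _ Uy0) bform_delta.
have f0 : f (F y0) = phi p0 by rewrite Fy0 /f /= cmapK.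
(* Maximality of the largest eigenvalue at [p0] as an inequality of quadratic forms at every point
   of the chart; this is the form in which it can be differentiated along [W]. *)
have lin p : chart_near p x -> chart_near (iota p) c ->
    (forall u, phi p ^+ k * bform (restrict_mx iota Shat x c p) u u <=
      phi p0 ^+ k * S p0 (e last) (e last) *
      bform (restrict_mx iota ghat x c p) u u).
  move=> xp cp u.
  have [_ scale0] := form_le_largest_eigenvalue n_gt0 nx
    (fun v w => restrict_formE subm ghat nx nc (v := v) (w := w))
    (fun v w => restrict_formE subm Shat nx nc (v := v) (w := w))
    (restrict_mx_sym ghat x nc) (restrict_mx_sym Shat x nc)
    (restrict_mx_pos_def subm pg nx nc).
  have [le1 scale1] := form_le_largest_eigenvalue n_gt0 xp
    (fun v w => restrict_formE subm ghat xp cp (v := v) (w := w))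
    (fun v w => restrict_formE subm Shat xp cp (v := v) (w := w))
    (restrict_mx_sym ghat x cp) (restrict_mx_sym Shat x cp)
    (restrict_mx_pos_def subm pg xp cp).
  have := max_p0 p.
  have -> : largest_eigenvalue g (fun q v w => phi q ^+ k * S q v w) p =
      phi p ^+ k * largest_eigenvalue g S p.
    by apply: scale1; rewrite exprn_ge0//; exact: phi_ge0.
  have -> : largest_eigenvalue g (fun q v w => phi q ^+ k * S q v w) p0 =
      phi p0 ^+ k * largest_eigenvalue g S p0.
    by apply: scale0; rewrite exprn_ge0//; exact: phi_ge0.
  rewrite -Slast => le0; apply: le_trans (ler_wpM2l _ (le1 u)) _.
    by rewrite exprn_ge0//; exact: phi_ge0.
  rewrite mulrA ler_wpM2r//.
  have [->|u0] := eqVneq u 0; first by rewrite bform0l.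
  by apply/ltW/(restrict_mx_pos_def subm pg xp cp).
have maxS y u : U y -> f (F y) ^+ k * bform (T (F y)) (dder u F y) (dder u F y) <=
    f (F y0) ^+ k * bform (T (F y0)) (dder (basis_vec last) F y0)
      (dder (basis_vec last) F y0) * bform (G (F y)) (dder u F y) (dder u F y).
  move=> Uy; have dFy := smooth_on_diff sF Uy.
  have [p [xp cp yp Fy]] := Unear y Uy.
  rewrite pushT f0 !(dder_jacobian _ dFy) -!bform_congr.
  have -> : f (F y) = phi p by rewrite Fy /f /= cmapK//; case: cp.
  have -> : jacobian F y *m T (F y) *m (jacobian F y)^T = restrict_mx iota Shat x c p.
    by rewrite /restrict_mx /= -/F -yp Fy /T tcoordE.
  have -> : jacobian F y *m G (F y) *m (jacobian F y)^T = restrict_mx iota ghat x c p.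
    by rewrite /restrict_mx /= -/F -yp Fy /G tcoordE.
  exact: lin.
have normal nu : (forall j, bform (G (F y0)) nu (dder (basis_vec j) F y0) = 0) ->
    bform (G (F y0)) nu nu <= 0.
  move=> nuj; have [P [uP EP]] := sgn nc; rewrite -Gy0 in EP.
  apply: (normal_semidef (p := jacobian F y0) EP).
  - by apply: symG; exact: FUV.
  - exact: gy0.
  apply/rowP => j; rewrite [RHS]mxE -(nuj j) bform_mulmx.
  have -> : (dder (basis_vec j) F y0)^T = (jacobian F y0)^T *m (basis_vec j)^T.
    by rewrite dder_jacobian// trmx_mul.
  by rewrite mulmxA /basis_vec trmx_delta -colE [RHS]mxE.
have N0 : 0 <= N.
  by have [h _ _] := C2size_bound N4; exact: le_trans (normr_ge0 _) h.
rewrite -Fy0 in N1 N2 N3 N4.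
have bG i j := C2size_bound (C2size_mx_bound N1 i j).
have biG i j := C2size_bound (C2size_mx_bound N2 i j).
have bT i j := C2size_bound (C2size_mx_bound N3 i j).
have [bf bdf bddf] := C2size_bound N4.
have orthT l : l != last ->
    bform (T (F y0)) (dder (basis_vec l) F y0) (dder (basis_vec last) F y0) = 0.
  by move=> ll; rewrite pushT orthS.
have fpos : 0 < f (F y0) by rewrite f0.
have := ricci_bound oU oV sF FUV sG symG unitG unitg minF sT symT sf Uy0 gy0 fpos
  Ty0 orthT maxS normal N0.
rewrite pushT f0.
have -> : \sum_l - bform (G (F y0)) (curvature G (F y0) (dder (basis_vec l) F y0)
    (dder (basis_vec last) F y0) (dder (basis_vec l) F y0))
    (dder (basis_vec last) F y0) =
  \sum_(l < n) riemann ghat (iota p0) (tvec_push iota p0 (e l))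
      (tvec_push iota p0 (e last)) (tvec_push iota p0 (e l))
      (tvec_push iota p0 (e last)).
  apply: eq_bigr => l _; have tp i := tvec_push_tangent subm (te i).
  by rewrite (riemannE ug nc)// riemann_coordE -!pE Fy0.
apply.
- by move=> i a b; have [_ h _] := bG a b; exact: h.
- by move=> i j a b; have [_ _ h] := bG a b; exact: h.
- by move=> a b; have [h _ _] := biG a b; exact: h.
- by move=> i a b; have [_ h _] := biG a b; exact: h.
- by move=> i a b; have [_ h _] := bT a b; exact: h.
- by move=> i j a b; have [_ _ h] := bT a b; exact: h.
- by rewrite -f0; exact: bf.
- exact: bdf.
- by move=> i j; exact: bddf.
Qed.

(** Some admissible chart has all its sizes below the infimum increased by [1], and this number may
    serve as [N] there. *)
Lemma ricci_bound_C2norm :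
  \sum_(l < n) riemann ghat (iota p0) (tvec_push iota p0 (e l))
      (tvec_push iota p0 (e last)) (tvec_push iota p0 (e l))
      (tvec_push iota p0 (e last))
    <= ricci_const n (n + m) k (C2norm ghat Shat phihat (iota p0) + 1)
       * phi p0 ^- 2 * S p0 (e last) (e last).
Proof.
rewrite /C2norm; set A := [set N | _].
have [c0 [n0 E0]] := normal_chart (iota p0) pS.
have hA : has_inf A.
  split; first by eexists; exists c0; split.
  (* Zero is a lower bound, since each maximum dominates an absolute value of [phihat]. *)
  exists 0 => N [c [_ _ ->]]; rewrite !le_max; apply/orP; right; apply/orP; right.
  by rewrite normr_ge0.
have [N [c [nc Sc ->]] lt1] := inf_adherent ltr01 hA.
have := ltW lt1; rewrite ge_max => /andP[].
rewrite ge_max => /andP[N1 N2]; rewrite ge_max => /andP[N3 N4].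
exact: (ricci_bound_chart nc).
Qed.

End MainEstimate.

Theorem proposition3 (R : realType) :
  exists C : nat -> nat -> R -> R,
  forall (n m : nat) (Mhat : manifold R (n + m)) (M : manifold R n)
    (ghat Shat : sym_tensor Mhat) (phihat : Mhat -> R) (iota : M -> Mhat)
    (p0 : M) (e : 'I_n -> tvec M) (last : 'I_n),
  nat_of_ord last = n.-1 ->
  has_signature ghat ->
  is_submanifold iota ->
  let g := restrict_form iota ghat in
  let S := restrict_form iota Shat in
  let phi := phihat \o iota in
  pos_def g ->
  zero_mean_curvature iota ghat ->
  pos_def (tensor_val Shat) ->
  smooth_fun phihat ->
  (forall q, 0 <= phihat q) ->
  0 < phi p0 ->
  (forall p, largest_eigenvalue g
               (fun q v w => phi q ^+ (2 * n - 2) * S q v w) p <=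
             largest_eigenvalue g
               (fun q v w => phi q ^+ (2 * n - 2) * S q v w) p0) ->
  (forall i, is_tangent p0 (e i)) ->
  (forall i j, g p0 (e i) (e j) = (i == j)%:R) ->
  (forall i j, i != j -> S p0 (e i) (e j) = 0) ->
  S p0 (e last) (e last) = largest_eigenvalue g S p0 ->
  let ehat := fun i => tvec_push iota p0 (e i) in
  \sum_(l < n) riemann ghat (iota p0) (ehat l) (ehat last) (ehat l) (ehat last)
    <= C n m (C2norm ghat Shat phihat (iota p0)) * phi p0 ^- 2
       * S p0 (e last) (e last).
Proof.
(* The infimum defining [C2norm] need not be attained, hence [N + 1]. *)
exists (fun n m N => ricci_const n (n + m) (2 * n - 2) (N + 1)).
move=> n m Mhat M ghat Shat phihat iota p0 e last _ sgn subm g S phi pg minimal pS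
  sphi phi_ge0 phi0 max_p0 te orthg orthS Slast.
exact: (ricci_bound_C2norm sgn subm pg minimal pS sphi phi_ge0 phi0 max_p0 te
  orthg orthS Slast).
Qed.
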